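(* Let $\Omega\subset\mathbb{R}^n$ be a strictly convex connected domain containing the origin, and let $(\Omega,F,\mathscr L^n)$ be an $n$-dimensional forward complete projectively flat Finsler manifold endowed with the Lebesgue measure $\mathscr L^n$. If $(\Omega,F)$ has constant flag curvature, then the following statements are equivalent: (i) the reversibility $\lambda_F(\Omega)=+\infty$; (ii) the Finsler manifold $(\Omega,F)$ is not backward complete; (iii) the Sobolev space $W^{1,p}_0(\Omega,F,\mathscr L^n)$ is nonlinear for some $p\in(1,+\infty)$; (iv) the Sobolev space $W^{1,p}_0(\Omega,F,\mathscr L^n)$ is nonlinear for every $p\in(1,+\infty)$.
   Context: Throughout $n\ge 2$; $T\Omega$ is identified with $\Omega\times\mathbb{R}^n$ with coordinates $(x^i,y^i)$; subscripts $x^i,y^i$ denote partial derivatives and repeated indices are summed. A Minkowski norm on $\mathbb{R}^n$ is a function $\psi\ge0$, vanishing only at $\mathbf 0$, with $\psi(\alpha y)=\alpha\psi(y)$ for $\alpha>0$, smooth on $\mathbb{R}^n\setminus\{\mathbf 0\}$, with $([\psi^2]_{y^iy^j}(y))$ positive definite for $y\neq\mathbf 0$. A Finsler metric on $\Omega$ is a function $F$ on $T\Omega$, smooth on $T\Omega\setminus\{0\}$, with $F(x,\cdot)$ a Minkowski norm for each $x$. Geodesics are the constant-speed curves satisfying $\ddot\gamma^i+2G^i(\gamma,\dot\gamma)=0$, $G^i=\frac14 g^{ij}\{[F^2]_{x^ky^j}y^k-[F^2]_{x^j}\}$, with $(g^{ij})$ the inverse of $g_{ij}=\frac12[F^2]_{y^iy^j}$.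 $(\Omega,F)$ is forward (resp. backward) complete if every geodesic can be extended to parameter $+\infty$ (resp. $-\infty$). $F$ is projectively flat if the images of all geodesics are straight lines; equivalently $G^i=Py^i$ with $P=\frac{y^kF_{x^k}}{2F}$. The flag curvature is the Finsler generalization of sectional curvature; for projectively flat $F$, $\mathbf K=\frac{P^2-y^iP_{x^i}}{F^2}$. The reversibility is $\lambda_F(\Omega)=\sup_{x\in\Omega}\sup_{y\ne\mathbf 0}\frac{F(x,-y)}{F(x,y)}$. The co-metric is $F^*(x,\xi)=\sup_{y\ne\mathbf 0}\frac{\xi(y)}{F(x,y)}$ for $\xi\in T^*_x\Omega$. Set $$\|u\|_{W^{1,p}}:=\Big(\int_\Omega|u|^p\,d\mathscr L^n\Big)^{1/p}+\Big(\int_\Omega F^{*}(x,du)^p\,d\mathscr L^n\Big)^{1/p}.$$ $W^{1,p}_0(\Omega,F,\mathscr L^n)$ is the closure of $C_0^\infty(\Omega)$ (smooth compactly supported functions) in the backward topology: $u\in W^{1,p}_0$ if and only if there exist $u_k\in C_0^\infty(\Omega)$ with $\lim_{k\to\infty}\|u-u_k\|_{W^{1,p}}=0$ (here $u$ ranges over functions with a weak differential $du$). It is called nonlinear if it is not a vector space. *)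

(* Defs.v *)
From HB Require Import structures.
From mathcomp Require Import all_boot all_order all_algebra.
From mathcomp Require Import all_classical all_reals all_analysis.

Set Implicit Arguments.
Unset Strict Implicit.
Unset Printing Implicit Defensive.

Import Order.TTheory GRing.Theory Num.Theory.
Import numFieldNormedType.Exports.

Local Open Scope classical_set_scope.
Local Open Scope ring_scope.

(* As for [n.-tuple T] in the library, row vectors carry the product
   sigma-algebra, generated by the coordinates. *)
Section measurable_row.
Context {d} {T : measurableType d} (n : nat).

Let coors : 'I_n -> 'rV[T]_n -> T := fun i v => v ord0 i.

Let row_set0 : g_sigma_preimage coors set0.
Proof. exact: sigma_algebra0. Qed.

Let row_setC A : g_sigma_preimage coors A -> g_sigma_preimage coors (~` A).
Proof. exact: sigma_algebraC. Qed.

Let row_bigcup (A : (set 'rV[T]_n)^nat) :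
  (forall i, g_sigma_preimage coors (A i)) ->
  g_sigma_preimage coors (\bigcup_i A i).
Proof. exact: sigma_algebra_bigcup. Qed.

HB.instance Definition _ := @isMeasurable.Build (measure_tuple_display d)
  'rV[T]_n (g_sigma_preimage coors) row_set0 row_setC row_bigcup.

End measurable_row.

Section measurable_row_theory.
Context {d} {T : measurableType d}.

Lemma measurable_coord n (i : 'I_n) :
  measurable_fun [set: 'rV[T]_n] (fun v : 'rV[T]_n => v ord0 i).
Proof.
move=> _ Y mY; rewrite setTI; apply: sub_sigma_algebra => /=.
rewrite -bigcup_seq/=; exists i => /=; first by rewrite mem_index_enum.
by exists Y => //; rewrite setTI.
Qed.

Lemma measurable_fun_row d' (S : measurableType d') n (f : S -> 'rV[T]_n) :
  (forall i, measurable_fun [set: S] (fun x => f x ord0 i)) ->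
  measurable_fun [set: S] f.
Proof.
move=> mf _ A mA.
suff : @measurable _ 'rV[T]_n `<=` image_set_system [set: S] f measurable by exact.
apply: smallest_sub.
  by apply: sigma_algebra_image; exact: sigma_algebra_measurable.
rewrite -bigcup_seq => B [i _ [C mC <-]].
by rewrite /image_set_system /= setTI; have := mf i measurableT C mC.
Qed.

End measurable_row_theory.

Section lebesgue_row.
Context {R : realType}.
Implicit Types n : nat.

Definition row_cons n (p : measurableTypeR R * 'rV[R]_n) : 'rV[R]_n.+1 :=
  row_mx (p.1 : R)%:M p.2.

Lemma row_cons0 n (p : measurableTypeR R * 'rV[R]_n) :
  row_cons p ord0 ord0 = p.1.
Proof.
rewrite /row_cons mxE; case: splitP => [j|k //].
by rewrite [j]ord1 !mxE eqxx mulr1n.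
Qed.

Lemma row_consS n (p : measurableTypeR R * 'rV[R]_n) i :
  row_cons p ord0 (lift ord0 i) = p.2 ord0 i.
Proof.
rewrite /row_cons mxE; case: splitP => [j|k]; first by rewrite [j]ord1.
by rewrite /= /bump /= => -[ik]; congr (p.2 _ _); exact/val_inj.
Qed.

Lemma measurable_row_cons n : measurable_fun setT (@row_cons n).
Proof.
apply: measurable_fun_row => i; case: (unliftP ord0 i) => [j ->|->].
- under eq_fun do rewrite row_consS.
  exact: (measurableT_comp (measurable_coord j) measurable_snd).
- by under eq_fun do rewrite row_cons0; exact: measurable_fst.
Qed.

Definition row_uncons n (v : 'rV[R]_n.+1) : measurableTypeR R * 'rV[R]_n :=
  (v ord0 ord0, \row_i v ord0 (lift ord0 i)).

Lemma row_consK n : cancel (@row_cons n) (@row_uncons n).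
Proof.
move=> p; rewrite /row_uncons row_cons0 [RHS]surjective_pairing.
by congr pair; apply/rowP => i; rewrite mxE row_consS.
Qed.

Lemma measurable_row_uncons n : measurable_fun setT (@row_uncons n).
Proof.
apply: measurable_fun_pair; first exact: (@measurable_coord _ R n.+1 ord0).
apply: measurable_fun_row => i; under eq_fun do rewrite mxE.
exact: measurable_coord.
Qed.

Section step.
Variables (n : nat) (m : {sigma_finite_measure set 'rV[R]_n -> \bar R}).

Definition lebesgue_step : set 'rV[R]_n.+1 -> \bar R :=
  pushforward (@lebesgue_measure R \x m)%E (@row_cons n).

Let lebesgue_step0 : lebesgue_step set0 = 0%E.
Proof. by rewrite /lebesgue_step /pushforward preimage_set0 measure0. Qed.

Let lebesgue_step_ge0 A : (0 <= lebesgue_step A)%E.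
Proof. by rewrite /lebesgue_step /pushforward; exact: measure_ge0. Qed.

Let lebesgue_step_sigma_additive : semi_sigma_additive lebesgue_step.
Proof.
have mf := @measurable_row_cons n.
move=> A mA tA mUA; rewrite /lebesgue_step /pushforward preimage_bigcup.
apply: measure_semi_sigma_additive.
- by move=> k; rewrite -[X in measurable X]setTI; exact: mf.
- apply/trivIsetP => /= i j _ _ ij; rewrite -preimage_setI.
  by move/trivIsetP : tA => /(_ _ _ _ _ ij) ->//; rewrite preimage_set0.
- by rewrite -preimage_bigcup -[X in measurable X]setTI; exact: mf.
Qed.

HB.instance Definition _ := isMeasure.Build _ _ _ lebesgue_step
  lebesgue_step0 lebesgue_step_ge0 lebesgue_step_sigma_additive.

Let lebesgue_step_sigma_finite : sigma_finite setT lebesgue_step.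
Proof.
have /sigma_finiteP[A [TA ndA Aoo]] := sigma_finiteT (@lebesgue_measure R).
have /sigma_finiteP[B [TB ndB Boo]] := sigma_finiteT m.
exists (fun k => @row_uncons n @^-1` (A k `*` B k)).
  rewrite -preimage_bigcup (_ : \bigcup_k _ = setT) ?preimage_setT//.
  apply/seteqP; split=> // -[x y] _.
  have [i _ Aix] : (\bigcup_k A k) x by rewrite -TA.
  have [j _ Bjy] : (\bigcup_k B k) y by rewrite -TB.
  exists (maxn i j) => //; split => /=.
    by move: Aix; exact/subsetPset/ndA/leq_maxl.
  by move: Bjy; exact/subsetPset/ndB/leq_maxr.
move=> k; have [mA Afin] := Aoo k; have [mB Bfin] := Boo k; split.
  rewrite -[X in measurable X]setTI; apply: measurable_row_uncons => //.
  exact: measurableX.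
rewrite /lebesgue_step /pushforward -comp_preimage.
rewrite (_ : _ \o _ = id); last by apply/funext => p /=; rewrite row_consK.
rewrite preimage_id product_measure1E// lte_mul_pinfty// ge0_fin_numE//.
Qed.

HB.instance Definition _ := Measure_isSigmaFinite.Build _ _ _ lebesgue_step
  lebesgue_step_sigma_finite.
End step.

Fixpoint lebesgue n : {sigma_finite_measure set 'rV[R]_n -> \bar R} :=
  if n is k.+1 then lebesgue_step (lebesgue k) else \d_(0 : 'rV[R]_0).

Lemma lebesgue_box n (a b : 'I_n -> R) : (forall i, a i <= b i) ->
  lebesgue n [set v | forall i, v ord0 i \in `]a i, b i]] = (\prod_i (b i - a i))%:E.
Proof.
elim: n a b => [|n IH] a b ab.
  rewrite big_ord0 /= diracE mem_set//; by case.
rewrite /= big_ord_recl /lebesgue_step /pushforward.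
rewrite (_ : _ @^-1` _ = `]a ord0, b ord0]%classic `*`
  [set v : 'rV[R]_n | forall i,
    v ord0 i \in `]a (lift ord0 i), b (lift ord0 i)]]).
  rewrite product_measure1E//.
    rewrite IH// EFinM. congr (_ * _)%E.
    have := lebesgue_measure_itv `]a ord0, b ord0]. rewrite /= lte_fin => ->.
    case: ltP => // h; have /eqP -> : b ord0 == a ord0 by rewrite eq_le h ab.
    by rewrite subrr.
  rewrite (_ : [set v : 'rV[R]_n | _] = \bigcap_(i in setT)
    ((fun v : 'rV[R]_n => v ord0 i) @^-1`
      `]a (lift ord0 i), b (lift ord0 i)]%classic)); last first.
    apply/seteqP; split => v /= h i; [by move=> _; apply: h|exact: (h i I)].
  apply: fin_bigcap_measurable => [|i _]; first exact: finite_finset.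
  rewrite -[X in measurable X]setTI; apply: measurable_coord => //.
apply/seteqP; split => [[x v] h|[x v] [/= hx hv] i] /=.
  split; first by have := h ord0; rewrite row_cons0.
  by move=> i /=; have := h (lift ord0 i); rewrite row_consS.
case: (unliftP ord0 i) => [j ->|->]; rewrite ?row_cons0 ?row_consS //.
Qed.

End lebesgue_row.

Section calculus.
Context {R : realType}.

(* For finite-dimensional [V] and open [U] this is C^oo regularity on [U]:
   every iterated directional derivative exists and is differentiable. *)
Definition smooth_on (V : normedModType R) (U : set V) (f : V -> R) : Prop :=
  forall (vs : seq V) (x : V), U x ->
    differentiable (foldr (fun v (g : V -> R) => 'D_v g) f vs) x.

Context {n : nat}.
Implicit Types (f : 'rV[R]_n -> R) (i : 'I_n).

Definition partial i f : 'rV[R]_n -> R := 'D_(delta_mx ord0 i) f.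

Definition gradient f (x : 'rV[R]_n) : 'rV[R]_n := \row_i partial i f x.

Definition hessian f (x : 'rV[R]_n) : 'M[R]_n :=
  \matrix_(i, j) partial j (partial i f) x.

Definition positive_definite (A : 'M[R]_n) : Prop :=
  forall v : 'rV[R]_n, v != 0 -> 0 < (v *m A *m v^T) ord0 ord0.

Definition strictly_convex (A : set 'rV[R]_n) : Prop :=
  forall (x y : 'rV[R]_n) (t : R), closure A x -> closure A y -> x != y ->
    0 < t < 1 -> A° ((1 - t) *: x + t *: y).

End calculus.

Section finsler.
Context {R : realType} {n : nat}.
Implicit Types (Omega : set 'rV[R]_n) (F : 'rV[R]_n -> 'rV[R]_n -> R).
Implicit Types (x y : 'rV[R]_n) (gamma : R -> 'rV[R]_n).

Definition minkowski_norm (psi : 'rV[R]_n -> R) : Prop :=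
  [/\ forall y, 0 <= psi y,
      forall y, psi y = 0 <-> y = 0,
      forall (a : R) y, 0 < a -> psi (a *: y) = a * psi y,
      smooth_on [set y | y != 0] psi &
      forall y, y != 0 -> positive_definite (hessian (fun z => psi z ^+ 2) y)].

(* [F x y] is the length of the tangent vector [y] at [x]; its values at
   points [x] outside [Omega] are irrelevant. *)
Definition finsler_metric Omega F : Prop :=
  smooth_on [set z : 'rV[R]_n * 'rV[R]_n | Omega z.1 /\ z.2 != 0]
    (fun z => F z.1 z.2) /\
  (forall x, Omega x -> minkowski_norm (F x)).

Definition fundamental_tensor F x y : 'M[R]_n :=
  2^-1 *: hessian (fun z => F x z ^+ 2) y.

Definition spray F x y : 'rV[R]_n :=
  \row_i (4^-1 * \sum_j invmx (fundamental_tensor F x y) i j *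
    (\sum_k partial j (fun z => partial k (fun w => F w z ^+ 2) x) y
              * y ord0 k
     - partial j (fun w => F w y ^+ 2) x)).

(* Geodesics are non-constant: the constant speed is positive, so the spray is
   only evaluated at nonzero vectors. *)
Definition geodesic Omega F (a b : \bar R) gamma : Prop :=
  (exists2 c : R, 0 < c & forall t : R, (a < t%:E < b)%E ->
    F (gamma t) (derive1 gamma t) = c) /\
  (forall t : R, (a < t%:E < b)%E ->
    [/\ Omega (gamma t), derivable gamma t 1, derivable (derive1 gamma) t 1 &
        derive1 (derive1 gamma) t + 2 *: spray F (gamma t) (derive1 gamma t) = 0]).

Definition forward_complete Omega F : Prop :=
  forall (a b : \bar R) gamma, (a < b)%E -> geodesic Omega F a b gamma ->
    exists2 sigma, geodesic Omega F a +oo%E sigma &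
      forall t : R, (a < t%:E < b)%E -> sigma t = gamma t.

Definition backward_complete Omega F : Prop :=
  forall (a b : \bar R) gamma, (a < b)%E -> geodesic Omega F a b gamma ->
    exists2 sigma, geodesic Omega F -oo%E b sigma &
      forall t : R, (a < t%:E < b)%E -> sigma t = gamma t.

Definition projectively_flat Omega F : Prop :=
  forall (a b : \bar R) gamma, (a < b)%E -> geodesic Omega F a b gamma ->
    exists p v : 'rV[R]_n, forall t : R, (a < t%:E < b)%E ->
      exists s : R, gamma t = p + s *: v.

Definition projective_factor F x y : R :=
  (\sum_k y ord0 k * partial k (F^~ y) x) / (2 * F x y).

(* With G^i = P y^i for P the projective factor, the Riemann curvature is
   R^i_k = (P^2 - y^j P_{x^j}) delta^i_k + tau_k y^i, so that the flag curvature
   does not depend on the transverse edge of the flag.  The formula is the flag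
   curvature only for a projectively flat [F]. *)
Definition flag_curvature F x y : R :=
  (projective_factor F x y ^+ 2
   - \sum_i y ord0 i * partial i (projective_factor F ^~ y) x) / F x y ^+ 2.

Definition constant_flag_curvature Omega F : Prop :=
  exists kappa : R, forall x y, Omega x -> y != 0 ->
    flag_curvature F x y = kappa.

Definition reversibility Omega F : \bar R :=
  ereal_sup [set ereal_sup [set (F x (- y) / F x y)%:E | y in [set y | y != 0]]
            | x in Omega].

Definition cometric F x (xi : 'rV[R]_n) : \bar R :=
  ereal_sup [set ((xi *m y^T) ord0 ord0 / F x y)%:E | y in [set y | y != 0]].

End finsler.

Section sobolev.
Context {R : realType} {n : nat}.
Variables (Omega : set 'rV[R]_n) (F : 'rV[R]_n -> 'rV[R]_n -> R) (p : R).
Implicit Types (u phi : 'rV[R]_n -> R) (du : 'rV[R]_n -> 'rV[R]_n).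

Local Notation mu := (lebesgue n).

Definition test_function phi : Prop :=
  [/\ smooth_on setT phi, compact (closure [set x | phi x != 0]) &
      closure [set x | phi x != 0] `<=` Omega].

Definition locally_integrable_row u : Prop :=
  measurable_fun Omega u /\
  forall K : set 'rV[R]_n, compact K -> K `<=` Omega ->
    mu.-integrable K (EFin \o u).

Definition weak_differential u du : Prop :=
  [/\ locally_integrable_row u,
      forall i, locally_integrable_row (fun x => du x ord0 i) &
      forall phi i, test_function phi ->
        \int[mu]_(x in Omega) (u x * partial i phi x) =
        - \int[mu]_(x in Omega) (du x ord0 i * phi x)].

Definition sobolev_norm u du : \bar R :=
  ((\int[mu]_(x in Omega) (`|u x| `^ p)%:E) `^ p^-1 +
   (\int[mu]_(x in Omega) cometric F x (du x) `^ p) `^ p^-1)%E.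

(* Functions on [Omega] are represented by functions on the whole space, whose
   values outside [Omega] play no role; functions equal almost everywhere are
   not identified. *)
Definition W1p0 : set ('rV[R]_n -> R^o) :=
  [set u | exists2 du, weak_differential u du &
     exists2 u_ : nat -> 'rV[R]_n -> R, forall k, test_function (u_ k) &
       sobolev_norm (u \- u_ k) (du \- gradient (u_ k)) @[k --> \oo] --> 0%E].

Definition nonlinear_W1p0 : Prop := ~ GRing.submod_closed (mem W1p0).

End sobolev.

(* Main.v *)
(** Write [f s = F (x + s y, y)] on a line.  Since [f' = 2 f P] by the definition
    of the projective factor and [P' = P^2 - kappa f^2] by the curvature equation,
    [1 / f] is a quadratic polynomial [q] in [s], and the geodesics are
    [x + s(t) y] with [s'] proportional to [q s].  Forward completeness makes every
    ray reach a zero of [q] before leaving [Omega], or stay in [Omega] with a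
    degree of [q] at most one.  Backward completeness, and likewise a finite
    reversibility, gives the same information at the other end of the line; both
    ends together force [F] to be reversible ([kappa < 0]) or independent of [x]
    ([kappa = 0]), and each of these implies both finite reversibility and
    backward completeness.

    The curvature plays no role for the Sobolev space.  If the reversibility is
    finite then [F*(- xi)] is at most a constant times [F*(xi)], and the space is
    linear.  Otherwise there are [x], [y] with [F (x, - y) >= Lam F (x, y)] for
    [Lam] arbitrarily large and [x] outside any given compact set.  With [xi] the
    supporting covector of [F (x, .)] at [- y], let [phi = s e h (xi . z / e) chi z],
    where [h' = f - 1] is periodic, [f >= 0] has mean one, and [f] has peaks of
    height [H].  As [e] tends to [0], the [p]-energy of [phi] is of order
    [H^(p - 1)] (up to the factor [s^p]), while testing against [f chi / H] shows
    that any weak differential of [- phi] has [p]-energy at least a multiple of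
    [Lam^p H^(p - 1)].  A sum of such bumps with disjoint supports leaving every
    compact set belongs to the space, but its opposite does not. *)

From HB Require Import structures.
Require Import Defs.
From mathcomp Require Import all_boot all_order all_algebra.
From mathcomp Require Import all_classical all_reals all_analysis measurable_realfun.
From mathcomp Require Import ring lra.

Set Implicit Arguments.
Unset Strict Implicit.
Unset Printing Implicit Defensive.

Import Order.TTheory GRing.Theory Num.Theory.
Import numFieldNormedType.Exports.
Local Open Scope classical_set_scope.
Local Open Scope ring_scope.

(** * Calculus along curves and Picard iteration *)

(** Completeness only extends geodesics that are already given, so local geodesics with arbitrary
    initial velocity must be constructed first; Picard iteration and the Lipschitz estimate for the
    spray serve this purpose. The quadratics of [y] and [- y] on one line have the same discriminant
    [- 4 kappa], and information at both ends gives them the same zeros, at the boundary points of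
    the chord, which forces them to agree.

    A compactly supported function descends as much as it climbs, and here descending costs up to
    [M >= Lam] times more. The profile therefore climbs in rare peaks of slope about [H] and
    descends with slope one: the descent costs about [M^p], absorbed by [H^(p - 1)] for large [H],
    whereas for the opposite function the peaks run in the costly direction. The weak differential
    in the definition of the space is existentially quantified, so its energy is bounded below by
    duality. Approximants have compact support and ignore distant bumps; this is why the supports
    must leave every compact set. *)

Lemma mul_addC (K : comRingType) (a b c d : K) : a * b + c * d = d * c + a * b.
Proof. by rewrite addrC [c * d]mulrC. Qed.

Lemma mul_rot (K : comRingType) (a b c : K) : a * (b * c) = c * (a * b).
Proof. by rewrite mulrA mulrC. Qed.

Section calculus_basics.
Context {R : realType}.

Lemma is_derive_comp_curve (V : normedModType R) (f : V -> R) (z : R -> V) (t : R)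
    (v : V) :
  differentiable f (z t) -> is_derive t 1 z v ->
  is_derive t 1 (f \o z) ('D_v f (z t)).
Proof.
move=> df dz.
have dz' : differentiable z t by apply/derivable1_diffP; apply: ex_derive.
have dc : differentiable (f \o z) t by exact: differentiable_comp.
apply: DeriveDef; first exact/derivable1_diffP.
rewrite deriveE // diff_comp //= -(@derive_val _ _ _ _ _ _ _ dz).
by rewrite -(deriveE _ dz') -(deriveE _ df).
Qed.

Lemma is_derive_affine (V : normedModType R) (x v : V) (t : R) :
  is_derive t 1 (fun s : R => x + s *: v) v.
Proof.
have -> : (fun s : R => x + s *: v) = cst x + (fun s : R => s *: v) by [].
have h : is_derive t 1 (fun s : R => s *: v) v.
  apply: DeriveDef; first by apply/derivable1_diffP.
  by rewrite deriveE // (@diff_val _ _ _ _ _ _ _ (is_diff_scalel t v)) scale1r.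
by have := is_deriveD (is_derive_cst x t 1) h; rewrite add0r.
Qed.

Lemma is_derive_line (V : normedModType R) (f : V -> R) (x v : V) (t : R) :
  differentiable f (x + t *: v) ->
  is_derive t 1 (fun s : R => f (x + s *: v)) ('D_v f (x + t *: v)).
Proof.
by move=> df; apply: (is_derive_comp_curve df); exact: is_derive_affine.
Qed.

Lemma derive_lin (V : normedModType R) (f : V -> R) (x u v : V) (a : R) :
  differentiable f x -> 'D_(a *: u + v) f x = a * 'D_u f x + 'D_v f x.
Proof. by move=> df; rewrite !deriveE // linearP. Qed.

Lemma derive_partial n (f : 'rV[R]_n -> R) (x v : 'rV[R]_n) :
  differentiable f x -> 'D_v f x = \sum_i v ord0 i * partial i f x.
Proof.
move=> df; rewrite deriveE // [v in LHS]row_sum_delta linear_sum /=.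
by apply: eq_bigr => i _; rewrite linearZ /= /partial deriveE.
Qed.

Lemma derive_coord m (v y : 'rV[R]_m) i : 'D_v (fun z : 'rV[R]_m => z ord0 i : R) y = v ord0 i.
Proof.
have did : derivable (id : 'rV[R]_m -> 'rV[R]_m) y v by exact: derivable_id.
have := derive_mx did; rewrite derive_id => /matrixP /(_ ord0 i).
by rewrite mxE.
Qed.

Lemma is_derive_rV m (f : R -> 'rV[R]_m) (t : R) (v : 'rV[R]_m) :
  (forall i, is_derive t 1 (fun s => f s ord0 i) (v ord0 i)) -> is_derive t 1 f v.
Proof.
move=> df; have dmx : derivable f t 1.
  by apply/derivable_mxP => i j; rewrite ord1; have [] := df j.
apply: DeriveDef => //; rewrite derive_mx //; apply/matrixP => i j; rewrite mxE ord1.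
by have [_ fj] := df j; rewrite -fj.
Qed.

Lemma is_derive_rV_coord m (f : R -> 'rV[R]_m) (t : R) (v : 'rV[R]_m) i :
  is_derive t 1 f v -> is_derive t 1 (fun s => f s ord0 i) (v ord0 i).
Proof.
move=> [df <-]; have /derivable_mxP /(_ ord0 i) dfi := df.
by apply: DeriveDef => //; rewrite derive_mx // mxE.
Qed.

Lemma derive_near (V : normedModType R) (f g : V -> R) (U : set V) (x v : V) :
  open U -> U x -> {in U, f =1 g} -> 'D_v f x = 'D_v g x.
Proof.
move=> oU Ux fg; apply: near_eq_derive.
by near=> y; apply: fg; rewrite inE; near: y; apply: open_nbhs_nbhs; split.
Unshelve. all: by end_near. Qed.

Lemma sum_delta_row m (j : 'I_m) (g : 'I_m -> R) :
  \sum_i (delta_mx ord0 j : 'rV[R]_m) ord0 i * g i = g j.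
Proof.
rewrite (bigD1 j) //= big1 ?addr0 ?mxE ?eqxx ?mul1r // => i ij.
by rewrite mxE (negbTE ij) andbF mul0r.
Qed.

(** Product rule that serves to differentiate identities of Euler type in the fibre variable. *)
Lemma derive_coord_sum m (g : 'I_m -> 'rV[R]_m -> R) (j : 'I_m) (y : 'rV[R]_m) :
  (forall i, differentiable (g i) y) ->
  'D_(delta_mx ord0 j) (fun z : 'rV[R]_m => \sum_i z ord0 i * g i z) y =
  g j y + \sum_i y ord0 i * 'D_(delta_mx ord0 j) (g i) y.
Proof.
move=> dg; set ej := delta_mx ord0 j.
pose c i : 'rV[R]_m -> R := fun z => z ord0 i.
have dc i : derivable (c i) y ej by apply: diff_derivable; exact: differentiable_coord.
have dg' i : derivable (g i) y ej by exact: diff_derivable.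
have -> : (fun z : 'rV[R]_m => \sum_i z ord0 i * g i z) = \sum_i (c i * g i).
  by apply/funext => z; rewrite fct_sumE.
rewrite derive_sum; last by move=> i; exact: derivableM.
rewrite -[g j y](sum_delta_row j (fun i => g i y)) -big_split /=; apply: eq_bigr => i _.
have dcE : 'D_ej (c i) y = ej ord0 i by exact: derive_coord.
rewrite (deriveM (dc i) (dg' i)) dcE; exact: mul_addC.
Qed.

Lemma rV_norm_le m (x : 'rV[R]_m) (e : R) :
  0 <= e -> (forall i, `|x ord0 i| <= e) -> `|x| <= e.
Proof.
move=> e0 xe; rewrite /Num.norm /= mx_normrE; apply/bigmax_leP; split => // -[i j] _ /=.
by rewrite ord1.
Qed.

Lemma rV_coord_le_norm m (x : 'rV[R]_m) i : `|x ord0 i| <= `|x|.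
Proof.
rewrite [leRHS]/Num.norm /= mx_normrE; apply/bigmax_geP; right => /=.
by exists (ord0, i).
Qed.

End calculus_basics.

(** Makes row vectors a complete normed module, as the contraction argument requires of its target
    space. *)
HB.instance Definition _ (R : realType) (m n : nat) :=
  Uniform_isComplete.Build 'M[R]_(m, n) cauchy_cvg.

Section picard.
Context {R : realType}.

Lemma derive_diff_le (f df : R -> R) (M a b s t : R) :
  (forall x, a < x < b -> is_derive x 1 f (df x)) ->
  (forall x, a < x < b -> `|df x| <= M) ->
  a < s < b -> a < t < b -> `|f t - f s| <= M * `|t - s|.
Proof.
move=> fdf dfM.
wlog st : s t / s <= t.
  move=> h sab tab; have [st|/ltW ts] := leP s t; first exact: h.
  by rewrite distrC (distrC t); exact: h.
move=> /andP[as_ sb] /andP[at_ tb].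
move: st; rewrite le_eqVlt => /predU1P[->|st]; first by rewrite !subrr normr0 mulr0.
have [| |c cst ->] := @MVT _ f df s t st.
- move=> x; rewrite in_itv/= => /andP[sx xt]; apply: fdf.
  by rewrite (lt_trans as_ sx) (lt_trans xt tb).
- apply: derivable_within_continuous => x.
  rewrite in_itv/= => /andP[sx xt].
  have xab : a < x < b by rewrite (lt_le_trans as_ sx) (le_lt_trans xt tb).
  by have := fdf _ xab => -[].
- rewrite normrM ler_wpM2r //; apply: dfM.
  by move: cst; rewrite in_itv/= => /andP[sc ct]; rewrite (lt_trans as_ sc) (lt_trans ct tb).
Qed.

Lemma primitive_exists (g : R -> R) : continuous g ->
  exists G : R -> R, G 0 = 0 /\ forall t : R, `|t| < 1 -> is_derive t 1 G (g t).
Proof.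
move=> cg.
(* The base point [-2] keeps every [|t| < 1] in the interior of the interval of integration, where
   the fundamental theorem of calculus applies. *)
pose F x := (\int[lebesgue_measure]_(t in `[(-2)%R, x]) (g t))%R.
exists (fun x => F x - F 0); split; first by rewrite subrr.
move=> t; rewrite ltr_norml => /andP[t1 t2].
have t3 : t < 2 by apply: lt_trans t2 _; rewrite ltr1n.
have t4 : -2 < t by apply: lt_trans t1; rewrite ltrN2 ltr1n.
have ig : lebesgue_measure.-integrable `[(-2)%R, 2] (EFin \o g).
  apply: continuous_compact_integrable; first exact: segment_compact.
  exact: continuous_subspaceT.
have [dF Fg] := continuous_FTC1_closed t3 ig t4 (cg t).
have -> : (fun x => F x - F 0) = F \- cst (F 0) by [].
have dF' : is_derive t 1 F (g t) by apply: DeriveDef; [exact: dF|rewrite -derive1E; exact: Fg].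
have := is_deriveB dF' (is_derive_cst (F 0) t 1).
by rewrite subr0.
Qed.

(** Banach's fixed point theorem with the supremum norm replaced by pointwise bounds uniform in [t],
    so that no space of bounded continuous functions has to be formed. The last hypothesis is the
    finiteness of the first increment. *)
Lemma uniform_contraction (V : completeNormedModType R)
    (T : (R -> V) -> R -> V) (u0 : R -> V) (M : R) :
  continuous u0 -> (forall u, continuous u -> continuous (T u)) ->
  (forall u v e, continuous u -> continuous v ->
     (forall t, `|u t - v t| <= e) -> forall t, `|T u t - T v t| <= e / 2) ->
  (forall t, `|T u0 t - u0 t| <= M) ->
  exists2 u, continuous u & T u = u.
Proof.
move=> cu0 cT ctr M0.
pose u_ k := iter k T u0.
have cu k : continuous (u_ k) by elim: k => //= k; exact: cT.
have du k t : `|u_ k.+1 t - u_ k t| <= geometric M 2^-1 k.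
  change (`|T (u_ k) t - u_ k t| <= M * 2^-1 ^+ k).
  elim: k t => [|k IH] t; first by rewrite expr0 mulr1.
  by rewrite exprSr mulrA; apply: ctr => [||s]; [exact: cu|exact: cu|exact: IH].
have half : `|2^-1 : R| < 1 by rewrite ger0_norm // invf_lt1 // ltr1n.
have Mge0 : 0 <= M by exact: le_trans (M0 0).
pose v_ t k := u_ k.+1 t - u_ k t.
have seriesE t k : series (v_ t) k = u_ k t - u0 t.
  by rewrite /series /= telescope_sumr.
have cv t : cvgn (series (v_ t)).
  apply: normed_cvg.
  apply: (series_le_cvg _ _ _ (is_cvg_geometric_series (a := M) half)) => k.
  - exact: normr_ge0.
  - by rewrite geometric_ge0.
  - exact: du.
pose u t := u0 t + limn (series (v_ t)).
have cvu t : u_ k t @[k --> \oo] --> u t.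
  have -> : (fun k => u_ k t) = (fun k => u0 t + series (v_ t) k).
    by apply/funext => k; rewrite seriesE addrC subrK.
  by apply: cvgD; [exact: cvg_cst|exact: cv].
have duk j k t : `|u_ (k + j)%N t - u_ k t| <= 2 * geometric M 2^-1 k.
  have -> : 2 * geometric M 2^-1 k = 2 * (M * 2^-1 ^+ k) by [].
  (* The remainder of the geometric series is kept exactly, which makes the induction on [j]
     close. *)
  suff : `|u_ (k + j)%N t - u_ k t| <= 2 * (M * 2^-1 ^+ k) - 2 * (M * 2^-1 ^+ (k + j)).
    by move=> /le_trans; apply; rewrite gerBl mulr_ge0 // mulr_ge0 // exprn_ge0.
  elim: j => [|j IH]; first by rewrite addn0 !subrr normr0.
  rewrite addnS -(subrK (u_ (k + j)%N t) (u_ _.+1 t)) -addrA.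
  apply: le_trans (ler_normD _ _) _.
  apply: le_trans (lerD (du _ _) IH) _.
  rewrite /= exprS; lra.
have ukb k t : `|u t - u_ k t| <= 2 * geometric M 2^-1 k.
  have h : `|u_ (k + j)%N t - u_ k t| @[j --> \oo] --> `|u t - u_ k t|.
    apply: cvg_norm; apply: cvgB; last exact: cvg_cst.
    have := cvu t; rewrite -(@cvg_shiftn k).
    by under eq_fun do rewrite addnC.
  apply: (closed_cvg (fun x => x <= 2 * geometric M 2^-1 k)) h; first exact: closed_le.
  by apply: nearW => j; exact: duk.
have g0 : 2 * geometric M 2^-1 k @[k --> \oo] --> (0 : R).
  rewrite -[X in _ --> X](mulr0 2); apply: cvgM; first exact: cvg_cst.
  exact: cvg_geometric.
have cuu : continuous u.
  move=> x; apply/cvgrPdist_le => e e0.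
  have e3 : 0 < e / 3 by rewrite divr_gt0.
  have [k _ /(_ k (leqnn k)) gk] : \forall k \near \oo, 2 * geometric M 2^-1 k <= e / 3.
    have /cvgrPdist_le /(_ _ e3) := g0.
    by apply: filterS => k; rewrite sub0r normrN; apply: le_trans; exact: ler_norm.
  have /cvgrPdist_le /(_ _ e3) := cu k x.
  apply: filterS => y uky.
  have -> : u x - u y = (u x - u_ k x) + (u_ k x - u_ k y) - (u y - u_ k y).
    by rewrite opprB !addrA !subrK.
  apply: le_trans (ler_normB _ _) _; apply: le_trans (lerD (ler_normD _ _) (lexx _)) _.
  have := ukb k x; have := ukb k y; lra.
exists u => //; apply/funext => t; apply/eqP; rewrite -subr_eq0 -normr_le0.
have g00 : 2 * (2 * geometric M 2^-1 k) @[k --> \oo] --> (0 : R).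
  rewrite -[X in _ --> X](mulr0 2); apply: cvgM; first exact: cvg_cst.
  exact: g0.
apply: (closed_cvg (fun x => `|T u t - u t| <= x) _ _ _ g00); first exact: closed_ge.
apply: nearW => k.
have -> : T u t - u t = (T u t - T (u_ k) t) - (u t - u_ k.+1 t).
  by rewrite opprB !addrA !subrK.
apply: le_trans (ler_normB _ _) _.
have h1 := ctr _ _ _ cuu (cu k) (ukb k) t; have h2 := ukb k.+1 t.
apply: le_trans (lerD h1 h2) _.
have := du k t; have : 0 <= geometric M 2^-1 k by rewrite geometric_ge0.
rewrite /= exprS; lra.
Qed.

Lemma continuous_row (U : topologicalType) m (f : 'I_m -> U -> R) :
  (forall i, continuous (f i)) -> continuous (fun x => \row_i f i x).
Proof.
move=> cf x A [P MP PA]; suff : \forall y \near x, A (\row_i f i y) by [].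
have : \forall y \near x, forall i, P ord0 i (f i y).
  apply: filter_forall => i; apply: cf.
  by have := MP ord0 i; rewrite mxE.
by apply: filterS => y Py; apply: PA => j i; rewrite ord1 mxE.
Qed.

Lemma picard_lipschitz m (Phi : 'rV[R]_m -> 'rV[R]_m) (L : R) (z0 : 'rV[R]_m) :
  0 < L -> (forall x y, `|Phi x - Phi y| <= L * `|x - y|) ->
  exists2 d : R, 0 < d & exists2 z : R -> 'rV[R]_m, z 0 = z0 &
    forall t : R, `|t| < d -> is_derive t 1 z (Phi (z t)).
Proof.
move=> L0 lip.
have cPhi : continuous Phi.
  move=> x; apply/(@cvgrPdist_le _ _ _ (nbhs x) (nbhs_filter x)) => e e0.
  have : \forall y \near x, `|x - y| <= e / L.
    apply/nbhs_ballP; exists (e / L); first by rewrite /= divr_gt0.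
    by move=> y; rewrite -ball_normE /= => /ltW.
  apply: filterS => y; rewrite ler_pdivlMr // mulrC; exact: le_trans.
(* [L * d <= 1/2] makes the integral operator a contraction of ratio one half, and [d < 1] stays
   within the range of [primitive_exists]. *)
pose d := Num.min 2^-1 (2 * L)^-1.
have d0 : 0 < d by rewrite lt_min !invr_gt0 mulr_gt0 // ltr0n.
have d1 : d < 1 by rewrite gt_min invf_lt1 // ltr1n.
have dL : L * d <= 2^-1.
  have : d <= (2 * L)^-1 by rewrite ge_min lexx orbT.
  by rewrite -(ler_pM2l L0) invfM mulrCA divff ?mulr1 // gt_eqF.
(* Freezing the time outside [[- d, d]] lets the operator act on functions on the whole line, with
   estimates uniform in [t]. *)
pose c (t : R) := Num.max (- d) (Num.min d t).
have cc : continuous c.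
  move=> t; apply: (@continuous_max _ _ (cst (- d)) (cst d \min id)).
    exact: cvg_cst.
  by apply: continuous_min; [exact: cvg_cst|exact: cvg_id].
have cd t : `|c t| <= d.
  rewrite ler_norml /c le_max lexx /= ge_max; apply/andP; split.
    by rewrite (@le_trans _ _ 0) // ?oppr_le0 ltW.
  by rewrite ge_min lexx.
have cid t : `|t| < d -> c t = t.
  rewrite ltr_norml => /andP[t1 t2]; rewrite /c min_r ?max_r //; exact: ltW.
have c1 t : `|c t| < 1 by exact: le_lt_trans d1.
(* Primitives are chosen for all [u] at once; discontinuous ones get an arbitrary value, so that [T]
   is total. *)
have exT (u : R -> 'rV[R]_m) : exists G : 'I_m -> R -> R, continuous u ->
    forall i, G i 0 = 0 /\ forall t : R, `|t| < 1 -> is_derive t 1 (G i) (Phi (u t) ord0 i).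
  have [cu|ncu] := pselect (continuous u); last by exists (fun _ _ => 0).
  suff /choice[G hG] : forall i, exists G : R -> R, G 0 = 0 /\
      forall t : R, `|t| < 1 -> is_derive t 1 G (Phi (u t) ord0 i) by exists G.
  move=> i; apply: (@primitive_exists (fun t => Phi (u t) ord0 i)) => t.
  apply: (@continuous_comp _ _ _ u (fun x => Phi x ord0 i)); first exact: cu.
  apply: (@continuous_comp _ _ _ Phi (fun x : 'rV[R]_m => x ord0 i)); first exact: cPhi.
  exact: coord_continuous.
have [G hG] := choice exT.
pose T (u : R -> 'rV[R]_m) (t : R) := z0 + \row_i G u i (c t).
have cT u : continuous u -> continuous (T u).
  move=> cu t; apply: cvgD; first exact: cvg_cst.
  apply: continuous_row => i s.
  have := @continuous_comp _ _ _ c (G u i) s (cc s); apply.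
  apply: differentiable_continuous; apply/derivable1_diffP.
  by have [_ /(_ _ (c1 s))[]] := hG u cu i.
have Tdiff u v e : continuous u -> continuous v -> 0 <= e ->
    (forall t, `|Phi (u t) - Phi (v t)| <= e) -> forall t, `|T u t - T v t| <= e * d.
  move=> cu cv e0 uve t; apply: rV_norm_le; first by rewrite mulr_ge0 // ltW.
  move=> i; rewrite /T opprD addrACA subrr add0r !mxE.
  have [Gu0 dGu] := hG u cu i; have [Gv0 dGv] := hG v cv i.
  have -> : G u i (c t) - G v i (c t) = (G u i \- G v i) (c t) - (G u i \- G v i) 0.
    by rewrite /= Gu0 Gv0 !subr0.
  apply: (@le_trans _ _ (e * `|c t - 0|)); last by rewrite subr0 ler_wpM2l.
  apply: (@derive_diff_le _ (fun t => Phi (u t) ord0 i - Phi (v t) ord0 i) _ (-1) 1).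
  - move=> s; rewrite -ltr_norml => s1.
    exact: (is_deriveB (dGu s s1) (dGv s s1)).
  - move=> s _; apply: le_trans (uve s).
    have -> : Phi (u s) ord0 i - Phi (v s) ord0 i = (Phi (u s) - Phi (v s)) ord0 i.
      by rewrite !mxE.
    exact: rV_coord_le_norm.
  - by rewrite ltrN10 ltr01.
  - by rewrite -ltr_norml.
have [||||u cu Tu] := @uniform_contraction 'rV[R]_m T (cst z0) (`|Phi z0| * d).
- exact: cst_continuous.
- exact: cT.
- move=> u v e cu cv uve t.
  have e0 : 0 <= e by exact: le_trans (uve 0).
  apply: (@le_trans _ _ (L * e * d)).
    apply: Tdiff => //; first by rewrite mulr_ge0 // ltW.
    by move=> s; apply: le_trans (lip _ _) _; rewrite ler_pM2l.
  by rewrite -mulrA mulrCA ler_wpM2l.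
- move=> t; apply: rV_norm_le; first by rewrite mulr_ge0 // ltW.
  move=> i; rewrite /T /= addrC addKr mxE.
  have cz : continuous (cst z0 : R -> 'rV[R]_m) by exact: cst_continuous.
  have [Gu0 dGu] := hG _ cz i.
  rewrite -[X in `|X|]subr0 -Gu0.
  apply: (@le_trans _ _ (`|Phi z0| * `|c t - 0|)); last by rewrite subr0 ler_wpM2l.
  apply: (@derive_diff_le _ (fun t => Phi z0 ord0 i) _ (-1) 1).
  - by move=> s; rewrite -ltr_norml => s1; exact: dGu.
  - move=> s _; exact: rV_coord_le_norm.
  - by rewrite ltrN10 ltr01.
  - by rewrite -ltr_norml.
exists d => //; exists u.
  rewrite -Tu /T; apply/rowP => i; rewrite !mxE.
  have [Gu0 _] := hG u cu i.
  by rewrite cid ?normr0 // Gu0 addr0.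
move=> t td.
have nt : \forall s \near t, `|s| < d.
  apply/nbhs_ballP; exists (d - `|t|); first by rewrite /= subr_gt0.
  move=> s; rewrite -ball_normE /= => ts.
  by rewrite -(subKr t s) (le_lt_trans (ler_normB _ _)) // -ltrBrDl.
rewrite -[X in is_derive _ _ X _]Tu.
apply: (@near_eq_is_derive _ _ _ (fun s => z0 + \row_i G u i s)).
  by apply: filterS nt => s sd; rewrite /T cid.
have dM : is_derive t 1 (fun s => \row_i G u i s : 'rV[R]_m) (Phi (u t)).
  have dmx : derivable (fun s => \row_i G u i s : 'rV[R]_m) t 1.
    apply/derivable_mxP => i j; under eq_fun do rewrite mxE.
    by have [_ /(_ _ (lt_trans td d1))[]] := hG u cu j.
  apply: DeriveDef => //; rewrite derive_mx //; apply/matrixP => i j; rewrite mxE.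
  under eq_fun do rewrite mxE.
  by have [_ /(_ _ (lt_trans td d1))[_ Gj]] := hG u cu j; rewrite ord1 -Gj.
rewrite -[X in is_derive _ _ _ X]add0r.
exact: is_deriveD.
Qed.

End picard.

(** * Locally Lipschitz fields and functions *)

Section local_lipschitz.
Context {R : realType}.

(** Clamping each coordinate around [z0] is a 1-Lipschitz retraction onto the closed ball, so the
    field composed with it is globally Lipschitz. By continuity the solution stays in the ball for a
    short time, and there the retraction is the identity. *)
Lemma picard_local m (Phi : 'rV[R]_m -> 'rV[R]_m) (L r : R) (z0 : 'rV[R]_m) :
  0 < r ->
  (forall x y, `|x - z0| <= r -> `|y - z0| <= r -> `|Phi x - Phi y| <= L * `|x - y|) ->
  exists2 d : R, 0 < d & exists2 z : R -> 'rV[R]_m, z 0 = z0 &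
    forall t : R, `|t| < d -> `|z t - z0| <= r /\ is_derive t 1 z (Phi (z t)).
Proof.
move=> r0 lip.
pose c (a : R) := Num.max (- r) (Num.min r a).
have cr a : `|c a| <= r.
  rewrite ler_norml /c le_max lexx /= ge_max ge_min lexx andbT.
  by rewrite (@le_trans _ _ 0) // ?oppr_le0 ltW.
have cid a : `|a| <= r -> c a = a.
  by rewrite ler_norml => /andP[t1 t2]; rewrite /c min_r ?max_r.
have c1 a b : `|c a - c b| <= `|a - b|.
  rewrite /c /Num.max /Num.min.
  have := ler_norm (a - b); have := ler_norm (b - a); rewrite (distrC b) => h1 h2.
  by rewrite ler_norml; repeat case: ifPn => //; rewrite -?leNgt; lra.
pose C (x : 'rV[R]_m) : 'rV[R]_m := z0 + \row_i c ((x - z0) ord0 i).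
have Cr x : `|C x - z0| <= r.
  rewrite /C addrC addKr; apply: rV_norm_le; first exact: ltW.
  by move=> i; rewrite mxE.
have C1 x y : `|C x - C y| <= `|x - y|.
  rewrite /C opprD addrACA subrr add0r; apply: rV_norm_le => // i.
  rewrite !mxE; apply: le_trans (c1 _ _) _.
  rewrite opprD addrACA subrr addr0.
  by have := rV_coord_le_norm (x - y) i; rewrite !mxE.
have Cid x : `|x - z0| <= r -> C x = x.
  move=> xr; rewrite /C; apply/rowP => i; rewrite !mxE cid; first by rewrite addrC subrK.
  by have := rV_coord_le_norm (x - z0) i; rewrite !mxE => /le_trans; apply.
have [||d d0 [z z00 dz]] := @picard_lipschitz R m (Phi \o C) (`|L| + 1) z0.
- by rewrite ltr_wpDl.
- move=> x y /=; apply: le_trans (lip _ _ (Cr _) (Cr _)) _.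
  apply: (@le_trans _ _ (`|L| * `|C x - C y|)); first by rewrite ler_wpM2r // ler_norm.
  by apply: ler_pM => //; rewrite lerDl.
have z0c : {for 0, continuous z}.
  apply: differentiable_continuous; apply/derivable1_diffP.
  by have [] : is_derive (0 : R) 1 z ((Phi \o C) (z 0)) by apply: dz; rewrite normr0.
have /nbhs_ballP[e /= e0 ze] : nbhs (0 : R) (fun t => `|z 0 - z t| <= r).
  by move/cvgrPdist_le: z0c => /(_ _ r0).
exists (Num.min d e); first by rewrite lt_min d0.
exists z => // t; rewrite lt_min => /andP[td te].
have zt : `|z t - z0| <= r.
  rewrite distrC -z00; apply: ze; by rewrite -ball_normE /= sub0r normrN.
by split=> //; have := dz t td; rewrite /= Cid.
Qed.

(** The form in which [picard_local] consumes regularity. Closure under sums, products, inverses and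
    determinants lets it pass from the derivatives of the metric to the spray. *)
Definition lipschitz_near (V : normedModType R) (f : V -> R) (x : V) : Prop :=
  exists r L : R, 0 < r /\ forall y z, `|y - x| <= r -> `|z - x| <= r ->
    `|f y - f z| <= L * `|y - z|.

Section closure.
Variable V : normedModType R.
Implicit Types (f g : V -> R) (x : V).

Lemma lipschitz_nearW f x : lipschitz_near f x ->
  exists r L M : R, [/\ 0 < r, 0 <= L, 0 <= M,
    forall y, `|y - x| <= r -> `|f y| <= M &
    forall y z, `|y - x| <= r -> `|z - x| <= r -> `|f y - f z| <= L * `|y - z|].
Proof.
move=> [r [L [r0 Lf]]]; exists r, `|L|, (`|f x| + `|L| * r).
have Lf' y z : `|y - x| <= r -> `|z - x| <= r -> `|f y - f z| <= `|L| * `|y - z|.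
  by move=> yr zr; apply: le_trans (Lf _ _ yr zr) _; rewrite ler_wpM2r // ler_norm.
split=> //; first by rewrite addr_ge0 // mulr_ge0 // ltW.
move=> y yr; rewrite -(subrK (f x) (f y)) addrC.
apply: le_trans (ler_normD _ _) _; rewrite lerD2l.
apply: le_trans (Lf' _ _ yr _) _; first by rewrite subrr normr0 ltW.
by rewrite ler_wpM2l.
Qed.

Lemma lipschitz_near_cst (k : R) x : lipschitz_near (cst k) x.
Proof. by exists 1, 0; split=> // y z _ _; rewrite subrr normr0 mul0r. Qed.

Lemma lipschitz_nearD f g x : lipschitz_near f x -> lipschitz_near g x ->
  lipschitz_near (fun y => f y + g y) x.
Proof.
move=> [r [L [r0 Lf]]] [s [K [s0 Kg]]].
exists (Num.min r s), (L + K); split; first by rewrite lt_min r0.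
move=> y z; rewrite !le_min => /andP[yr ys] /andP[zr zs].
rewrite opprD addrACA mulrDl; apply: le_trans (ler_normD _ _) _.
by rewrite lerD // ?Lf // Kg.
Qed.

Lemma lipschitz_nearM f g x : lipschitz_near f x -> lipschitz_near g x ->
  lipschitz_near (fun y => f y * g y) x.
Proof.
move=> /lipschitz_nearW[r [L [M [r0 L0 M0 fM Lf]]]].
move=> /lipschitz_nearW[s [K [N [s0 K0 N0 gN Kg]]]].
exists (Num.min r s), (M * K + L * N); split; first by rewrite lt_min r0.
move=> y z; rewrite !le_min => /andP[yr ys] /andP[zr zs].
have -> : f y * g y - f z * g z = f y * (g y - g z) + (f y - f z) * g z by ring.
apply: le_trans (ler_normD _ _) _; rewrite !normrM mulrDl -mulrA lerD //.
  by apply: ler_pM => //; [exact: fM|exact: Kg].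
by rewrite mulrAC; apply: ler_pM => //; [exact: Lf|exact: gN].
Qed.

Lemma lipschitz_nearZ (k : R) f x : lipschitz_near f x ->
  lipschitz_near (fun y => k * f y) x.
Proof. by apply: lipschitz_nearM; exact: lipschitz_near_cst. Qed.

Lemma lipschitz_nearB f g x : lipschitz_near f x -> lipschitz_near g x ->
  lipschitz_near (fun y => f y - g y) x.
Proof.
move=> hf /(lipschitz_nearZ (-1)) hg; have := lipschitz_nearD hf hg.
by under eq_fun do rewrite mulN1r.
Qed.

Lemma lipschitz_nearV f x : f x != 0 -> lipschitz_near f x ->
  lipschitz_near (fun y => (f y)^-1) x.
Proof.
move=> fx0 /lipschitz_nearW[r [L [M [r0 L0 _ _ Lf]]]].
have fx1 : 0 < `|f x| / 2 by rewrite divr_gt0 // normr_gt0.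
(* On this radius [f] varies by at most half of [|f x|], hence stays away from zero. *)
pose s := Num.min r (`|f x| / 2 / (L + 1)).
have L1 : 0 < L + 1 by rewrite ltr_wpDl.
have fge y : `|y - x| <= s -> `|f x| / 2 <= `|f y|.
  rewrite le_min => /andP[yr]; rewrite ler_pdivlMr // => ys.
  have := Lf _ _ yr (_ : `|x - x| <= r); rewrite subrr normr0 ltW // => /(_ isT) h.
  have : `|f x| - `|f y| <= `|f y - f x| by rewrite distrC lerB_dist.
  have : L * `|y - x| <= `|y - x| * (L + 1).
    by rewrite mulrC ler_wpM2l // lerDl.
  lra.
exists s, (4 * L / `|f x| ^+ 2); split.
  by rewrite lt_min r0 divr_gt0.
move=> y z ys zs; have fy := fge _ ys; have fz := fge _ zs.
have fy0 : f y != 0 by rewrite -normr_gt0; exact: lt_le_trans fy.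
have fz0 : f z != 0 by rewrite -normr_gt0; exact: lt_le_trans fz.
have -> : (f y)^-1 - (f z)^-1 = (f z - f y) * ((f y)^-1 * (f z)^-1) by field; apply/andP.
have yr : `|y - x| <= r by move: ys; rewrite le_min => /andP[].
have zr : `|z - x| <= r by move: zs; rewrite le_min => /andP[].
rewrite normrM (distrC (f z)).
have -> : 4 * L / `|f x| ^+ 2 * `|y - z| = L * `|y - z| * ((`|f x| / 2)^-1 * (`|f x| / 2)^-1).
  by field; rewrite normr_eq0.
apply: ler_pM => //; first exact: Lf.
rewrite normrM !normfV; apply: ler_pM; rewrite ?invr_ge0 //.
  by rewrite lef_pV2 // posrE // (lt_le_trans fx1).
by rewrite lef_pV2 // posrE // (lt_le_trans fx1).
Qed.

Lemma lipschitz_near_sum (I : Type) (s : seq I) (P : pred I) (f : I -> V -> R) x :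
  (forall i, lipschitz_near (f i) x) ->
  lipschitz_near (fun y => \sum_(i <- s | P i) f i y) x.
Proof.
move=> hf; elim: s => [|i s IH].
  by under eq_fun do rewrite big_nil; exact: lipschitz_near_cst.
under eq_fun do rewrite big_cons.
by case: (P i) => //; exact: lipschitz_nearD.
Qed.

Lemma lipschitz_near_prod (I : Type) (s : seq I) (P : pred I) (f : I -> V -> R) x :
  (forall i, lipschitz_near (f i) x) ->
  lipschitz_near (fun y => \prod_(i <- s | P i) f i y) x.
Proof.
move=> hf; elim: s => [|i s IH].
  by under eq_fun do rewrite big_nil; exact: lipschitz_near_cst.
under eq_fun do rewrite big_cons.
by case: (P i) => //; exact: lipschitz_nearM.
Qed.

Lemma lipschitz_near_det k (A : V -> 'M[R]_k) x :
  (forall i j, lipschitz_near (fun y => A y i j) x) ->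
  lipschitz_near (fun y => \det (A y)) x.
Proof.
move=> hA; apply: lipschitz_near_sum => s.
apply: lipschitz_nearM; first exact: lipschitz_near_cst.
exact: lipschitz_near_prod.
Qed.

Lemma lipschitz_near_eq (f g : V -> R) x : (\near x, f x = g x) ->
  lipschitz_near f x -> lipschitz_near g x.
Proof.
move=> /nbhs_ballP[e /= e0 fg] [r [L [r0 Lf]]].
exists (Num.min r (e / 2)), L; split; first by rewrite lt_min r0 divr_gt0.
move=> y z; rewrite !le_min => /andP[yr ye] /andP[zr ze].
rewrite -fg; last by rewrite -ball_normE /= distrC; lra.
rewrite -fg; last by rewrite -ball_normE /= distrC; lra.
exact: Lf.
Qed.

(** Mean value theorem on the segment, with the increment expanded in the family [e]; continuity at
    [x] alone bounds the derivatives along [e] nearby. The family is abstract so as to cover a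
    product of two spaces of row vectors. *)
Lemma lipschitz_near_C1 (I : finType) (e : I -> V) (c : I -> V -> R) f x :
  (forall v, v = \sum_i c i v *: e i) -> (forall i v, `|c i v| <= `|v|) ->
  (\near x, differentiable f x) -> (forall i, {for x, continuous ('D_(e i) f)}) ->
  lipschitz_near f x.
Proof.
move=> ec cn df cd.
have : \forall y \near x, forall i, `|'D_(e i) f x - 'D_(e i) f y| <= 1.
  apply: filter_forall => i.
  by have /cvgrPdist_le := cd i; apply.
move=> /(filterI df) /nbhs_ballP[r /= r0 hr].
have r2 : 0 < r / 2 by rewrite divr_gt0.
exists (r / 2), (\sum_i (`|'D_(e i) f x| + 1)); split=> // y z yr zr.
have seg (t : R) : 0 <= t <= 1 -> ball x r (z + t *: (y - z)).
  move=> /andP[t0 t1]; rewrite -ball_normE /= distrC.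
  have -> : z + t *: (y - z) - x = t *: (y - x) + (1 - t) *: (z - x).
    have -> : y - z = (y - x) - (z - x) by rewrite opprB addrA subrK.
    by rewrite scalerBr scalerBl scale1r addrAC [RHS]addrCA.
  apply: le_lt_trans (ler_normD _ _) _.
  rewrite !normrZ (ger0_norm t0) ger0_norm ?subr_ge0 //.
  have h1 : t * `|y - x| <= t * (r / 2) by rewrite ler_wpM2l.
  have h2 : (1 - t) * `|z - x| <= (1 - t) * (r / 2) by rewrite ler_wpM2l // subr_ge0.
  lra.
have dseg (t : R) : 0 <= t <= 1 ->
    is_derive t 1 (fun s : R => f (z + s *: (y - z))) ('D_(y - z) f (z + t *: (y - z))).
  by move=> t01; apply: is_derive_line; have [] := hr _ (seg t t01).
have [||t t01] := @MVT R (fun s => f (z + s *: (y - z)))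
    (fun s => 'D_(y - z) f (z + s *: (y - z))) 0 1 ltr01.
- by move=> t; rewrite in_itv /= => /andP[/ltW t0 /ltW t1]; apply: dseg; rewrite t0.
- apply: derivable_within_continuous => t; rewrite in_itv /= => t01.
  by have [] := dseg t t01.
move: t01; rewrite in_itv /= => /andP[/ltW t0 /ltW t1].
rewrite scale0r addr0 scale1r [z + _]addrC subrK subr0 mulr1 => ->.
have t01 : 0 <= t <= 1 by rewrite t0.
have [dft hft] := hr _ (seg t t01).
rewrite [X in 'D_X f _]ec deriveE // linear_sum /= mulr_suml.
apply: le_trans (ler_norm_sum _ _ _) _; apply: ler_sum => i _.
rewrite linearZ normrM mulrC; apply: ler_pM => //.
rewrite -deriveE // -(subrK ('D_(e i) f x) ('D_(e i) f _)) addrC.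
apply: le_trans (ler_normD _ _) _; rewrite lerD2l distrC; exact: hft.
Qed.

End closure.

Lemma lipschitz_near_comp (U V : normedModType R) (g : U -> V) (f : V -> R) (x : U) :
  (forall y z, `|g y - g z| <= `|y - z|) -> lipschitz_near f (g x) ->
  lipschitz_near (f \o g) x.
Proof.
move=> g1 [r [L [r0 Lf]]]; exists r, `|L|; split=> // y z yr zr /=.
apply: le_trans (Lf _ _ (le_trans (g1 _ _) yr) (le_trans (g1 _ _) zr)) _.
apply: (@le_trans _ _ (`|L| * `|g y - g z|)); first by rewrite ler_wpM2r // ler_norm.
by rewrite ler_wpM2l.
Qed.

Lemma lipschitz_near_row (V : normedModType R) m (Phi : V -> 'rV[R]_m) (x : V) :
  (forall i, lipschitz_near (fun y => Phi y ord0 i) x) ->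
  exists r L : R, 0 < r /\ forall y z, `|y - x| <= r -> `|z - x| <= r ->
    `|Phi y - Phi z| <= L * `|y - z|.
Proof.
move=> hPhi.
have /choice[r /choice[L hrL]] : forall i, exists r, exists L : R, 0 < r /\ 0 <= L /\ forall y z,
    `|y - x| <= r -> `|z - x| <= r -> `|Phi y ord0 i - Phi z ord0 i| <= L * `|y - z|.
  by move=> i; have /lipschitz_nearW[r [L [M [r0 L0 _ _ h]]]] := hPhi i; exists r, L.
exists (\big[Num.min/1]_i r i), (\sum_i L i); split.
  by apply/bigmin_gtP; split=> // i _; have [] := hrL i.
move=> y z yr zr.
have yri i : `|y - x| <= r i by apply: le_trans yr _; exact: bigmin_le_cond.
have zri i : `|z - x| <= r i by apply: le_trans zr _; exact: bigmin_le_cond.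
apply: rV_norm_le => [|i].
  by rewrite mulr_ge0 // sumr_ge0 // => i _; have [_ []] := hrL i.
rewrite !mxE; have [_ [Li h]] := hrL i; apply: le_trans (h _ _ (yri i) (zri i)) _.
rewrite ler_wpM2r // (bigD1 i) //= lerDl sumr_ge0 // => j _.
by have [_ []] := hrL j.
Qed.

End local_lipschitz.

(** * The energy and the geodesic spray *)

Section slices.
Context {R : realType} (V W : normedModType R).
Implicit Types (H : V * W -> R).

(** Smoothness of a metric is joint, while the spray is written with derivatives in one argument at
    a time; this lemma and the next one translate between the two. *)
Lemma derive_slice1 H (x v : V) (y : W) :
  'D_v (fun w => H (w, y)) x = 'D_(v, 0) H (x, y).
Proof.
rewrite /derive; under eq_fun => h.
  have -> : ((fun w => H (w, y)) \o shift x) (h *: v) =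
            (H \o shift (x, y)) (h *: (v, 0)).
    by rewrite /= /shift; congr (H _); apply: injective_projections; rewrite /= ?scaler0 ?add0r.
  over.
by [].
Qed.

Lemma derive_slice2 H (x : V) (y w : W) :
  'D_w (fun z => H (x, z)) y = 'D_(0, w) H (x, y).
Proof.
rewrite /derive; under eq_fun => h.
  have -> : ((fun z => H (x, z)) \o shift y) (h *: w) =
            (H \o shift (x, y)) (h *: (0, w)).
    by rewrite /= /shift; congr (H _); apply: injective_projections; rewrite /= ?scaler0 ?add0r.
  over.
by [].
Qed.

Lemma differentiable_slice1 H (x : V) (y : W) :
  differentiable H (x, y) -> differentiable (fun w => H (w, y)) x.
Proof.
by move=> dH; apply: (@differentiable_comp _ _ _ _ (fun w => (w, y)) H).
Qed.

Lemma differentiable_slice2 H (x : V) (y : W) :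
  differentiable H (x, y) -> differentiable (fun w => H (x, w)) y.
Proof.
by move=> dH; apply: (@differentiable_comp _ _ _ _ (fun w => (x, w)) H).
Qed.

End slices.

Lemma near_eq_differentiable (R : numFieldType) (V W : normedModType R) (f g : V -> W) (x : V) :
  {near x, f =1 g} -> differentiable f x -> differentiable g x.
Proof.
move=> fg df; have fgx := nbhs_singleton fg.
have gE : g \o shift x = cst (g x) + 'd f x +o_ 0 id.
  apply/eqaddoP => eps eps0.
  have /eqaddoP /(_ _ eps0) := diff_locally df.
  have fg0 : \forall h \near (0 : V), f (h + x) = g (h + x).
    by move: fg; rewrite [\forall y \near x, _](near_shift 0) /=; apply: filterS => h; rewrite subr0.
  apply: filter_app; apply: filterS fg0 => h fgh.
  by rewrite /= !fctE /= -fgx -fgh.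
have dc : continuous ('d f x) by exact: diff_continuous.
have dE := diff_unique dc gE.
by apply/diff_locallyP; rewrite dE.
Qed.

Section homogeneous.
Context {R : realType} (V : normedModType R).

(** Differentiate [a -> f (a y)] at [a = 1], written as [1 + s] to fall back on the derivative along
    a line. *)
Lemma euler_homogeneous (f : V -> R) (k : nat) (y : V) : differentiable f y ->
  (forall a : R, 0 < a -> f (a *: y) = a ^+ k * f y) -> 'D_y f y = k%:R * f y.
Proof.
move=> df hf.
have dl : is_derive (0 : R) 1 (fun s : R => f (y + s *: y)) ('D_y f y).
  by have := @is_derive_line R V f y y 0; rewrite scale0r addr0; apply.
rewrite -(@derive_val _ _ _ _ _ _ _ dl).
have -> : 'D_1 (fun s : R => f (y + s *: y)) 0 = 'D_1 (fun s : R => (1 + s) ^+ k * f y) 0.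
  apply: near_eq_derive; apply/nbhs_ballP; exists 1; first exact: ltr01.
  move=> s; rewrite -ball_normE /= sub0r normrN => s1.
  rewrite -[X in X + _]scale1r -scalerDl hf //.
  by move: s1; rewrite ltr_norml => /andP[]; lra.
have -> : (fun s : R => (1 + s) ^+ k * f y) = f y \*: ((cst 1 + id : R -> R) ^+ k).
  by apply/funext => s; rewrite mulrC /GRing.scale /= exprfctE.
have d1 : is_derive (0 : R) 1 (cst 1 + id : R -> R) 1.
  have := is_deriveD (is_derive_cst (1 : R) (0 : R) 1) (is_derive_id (0 : R) 1).
  by rewrite add0r.
rewrite (@derive_val _ _ _ _ _ _ _ (is_deriveZ _ (is_deriveX k d1))).
have -> : (cst 1 + id : R -> R) 0 = 1 by exact: addr0.
by rewrite expr1n mulr1 /GRing.scale /= mulr1 mulrC.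
Qed.

End homogeneous.

Section spray.
Context {R : realType} {n : nat}.
Context (Omega : set 'rV[R]_n) (F : 'rV[R]_n -> 'rV[R]_n -> R).
Context (Omega_open : open Omega) (finslerF : finsler_metric Omega F).

Definition slit_tangent := [set z : 'rV[R]_n * 'rV[R]_n | Omega z.1 /\ z.2 != 0].

Definition metric_fun (z : 'rV[R]_n * 'rV[R]_n) : R := F z.1 z.2.

Definition energy (z : 'rV[R]_n * 'rV[R]_n) : R := F z.1 z.2 ^+ 2.

Lemma open_slit_tangent : open slit_tangent.
Proof.
have -> : slit_tangent = (fst @^-1` Omega) `&` (snd @^-1` (~` [set 0])).
  by apply/seteqP; split => -[x y] [] /= h1 /eqP h2.
apply: openI; apply: open_comp => //.
- by move=> z _; exact: cvg_fst.
- by move=> z _; exact: cvg_snd.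
- exact/closed_openC/accessible_closed_set1/hausdorff_accessible/norm_hausdorff.
Qed.

Lemma near_slit_tangent z : slit_tangent z -> \near z, slit_tangent z.
Proof. by move=> Uz; apply: open_nbhs_nbhs; split => //; exact: open_slit_tangent. Qed.

Lemma smooth_metric : smooth_on slit_tangent metric_fun.
Proof. by case: finslerF. Qed.

Lemma metric_differentiable z : slit_tangent z -> differentiable metric_fun z.
Proof. by move=> Uz; have := smooth_metric [::] Uz. Qed.

Lemma derive_metric_differentiable v z : slit_tangent z ->
  differentiable ('D_v metric_fun) z.
Proof. by move=> Uz; have := smooth_metric [:: v] Uz. Qed.

Lemma energyE : energy = metric_fun * metric_fun.
Proof. by apply/funext => z; rewrite /energy expr2. Qed.

Lemma energy_differentiable z : slit_tangent z -> differentiable energy z.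
Proof. by move=> Uz; rewrite energyE; apply: differentiableM; exact: metric_differentiable. Qed.

Lemma derive_energy v z : slit_tangent z ->
  'D_v energy z = 2 * (metric_fun z * 'D_v metric_fun z).
Proof.
move=> Uz; have dm := @diff_derivable _ _ _ _ _ v (metric_differentiable Uz).
by rewrite energyE (deriveM dm dm) /GRing.scale /=; ring.
Qed.

Lemma derive_energy_near v z : slit_tangent z ->
  \near z, 'D_v energy z = (2 \*: (metric_fun * 'D_v metric_fun)) z.
Proof. by move=> /near_slit_tangent; apply: filterS => z' /(derive_energy v). Qed.

Lemma derive_energy_differentiable v z : slit_tangent z -> differentiable ('D_v energy) z.
Proof.
move=> Uz; apply: (near_eq_differentiable (f := 2 \*: (metric_fun * 'D_v metric_fun))).
  by apply: filterS (derive_energy_near v Uz) => z' ->.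
apply: differentiableZ; apply: differentiableM; first exact: metric_differentiable.
exact: derive_metric_differentiable.
Qed.

Lemma derive2_energy u v z : slit_tangent z ->
  'D_u ('D_v energy) z = 2 * ('D_u metric_fun z * 'D_v metric_fun z +
                             metric_fun z * 'D_u ('D_v metric_fun) z).
Proof.
move=> Uz; rewrite (near_eq_derive _ (derive_energy_near v Uz)).
have d1 := @diff_derivable _ _ _ _ _ u (metric_differentiable Uz).
have d2 := @diff_derivable _ _ _ _ _ u (derive_metric_differentiable v Uz).
rewrite (deriveZ _ (derivableM d1 d2)) (deriveM d1 d2) /GRing.scale /=.
exact: (f_equal (fun t => 2 * t) (mul_addC _ _ _ _)).
Qed.

Lemma metric_ge0 x y : Omega x -> 0 <= F x y.
Proof. by case: finslerF => _ h /h[]. Qed.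

Lemma metric_gt0 x y : Omega x -> y != 0 -> 0 < F x y.
Proof.
move=> Ox y0; rewrite lt_neqAle metric_ge0 // andbT eq_sym.
case: finslerF => _ /(_ _ Ox)[_ h0 _ _ _].
by apply/eqP => /h0 /eqP; apply/negP.
Qed.

Lemma metricZ x y (a : R) : Omega x -> 0 < a -> F x (a *: y) = a * F x y.
Proof. by case: finslerF => _ h /h[_ _ h1 _ _]; exact: h1. Qed.

Lemma energyZ x y (a : R) : Omega x -> 0 < a -> energy (x, a *: y) = a ^+ 2 * energy (x, y).
Proof. by move=> Ox a0; rewrite /energy /= metricZ // exprMn. Qed.

End spray.

Section spray_identities.
Context {R : realType} {n : nat}.
Context (Omega : set 'rV[R]_n) (F : 'rV[R]_n -> 'rV[R]_n -> R).
Context (Omega_open : open Omega) (finslerF : finsler_metric Omega F).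

Notation e := (delta_mx ord0 : 'I_n -> 'rV[R]_n).
Notation E := (energy F).
Notation U := (slit_tangent Omega).

Lemma partial_energy1 i x y : partial i (fun w => F w y ^+ 2) x = 'D_(e i, 0) E (x, y).
Proof. exact: (@derive_slice1 R _ _ E). Qed.

Lemma partial_energy2 i x y : partial i (fun z => F x z ^+ 2) y = 'D_(0, e i) E (x, y).
Proof. exact: (@derive_slice2 R _ _ E). Qed.

Lemma hessian_energy x y i j :
  hessian (fun z => F x z ^+ 2) y i j = 'D_(0, e j) ('D_(0, e i) E) (x, y).
Proof.
rewrite mxE; have -> : partial i (fun z => F x z ^+ 2) = (fun z => 'D_(0, e i) E (x, z)).
  by apply/funext => z; exact: partial_energy2.
exact: (@derive_slice2 R _ _ ('D_(0, e i) E)).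
Qed.

(** The covector [4 g_ij G^j], that is, the spray before the inverse metric raises its index. *)
Definition spray_force x y : 'rV[R]_n :=
  \row_j (\sum_k 'D_(0, e j) ('D_(e k, 0) E) (x, y) * y ord0 k - 'D_(e j, 0) E (x, y)).

Lemma spray_forceE x y j :
  \sum_k partial j (fun z => partial k (fun w => F w z ^+ 2) x) y * y ord0 k
    - partial j (fun w => F w y ^+ 2) x = spray_force x y ord0 j.
Proof.
have h k : partial j (fun z => partial k (fun w => F w z ^+ 2) x) y =
    'D_(0, e j) ('D_(e k, 0) E) (x, y).
  have -> : (fun z => partial k (fun w => F w z ^+ 2) x) = (fun z => 'D_(e k, 0) E (x, z)).
    by apply/funext => z; exact: partial_energy1.
  exact: (@derive_slice2 R _ _ ('D_(e k, 0) E)).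
rewrite [RHS]mxE; apply: (f_equal2 (fun a b => a - b)) (partial_energy1 j x y).
by apply: eq_bigr => k _; exact: (f_equal (fun t => t * y ord0 k) (h k)).
Qed.

Lemma sprayE x y : spray F x y =
  \row_i (4^-1 * \sum_j invmx (fundamental_tensor F x y) i j * spray_force x y ord0 j).
Proof.
apply/rowP => i; rewrite [LHS]mxE [RHS]mxE; apply: (f_equal (fun a => 4^-1 * a)).
apply: eq_bigr => j _; exact: (f_equal (fun a => _ * a) (spray_forceE x y j)).
Qed.

Lemma positive_definite_unitmx m (A : 'M[R]_m) : positive_definite A -> A \in unitmx.
Proof.
move=> pA; rewrite unitmxE unitfE; apply/negP => /det0P[v v0 vA].
by have := pA v v0; rewrite vA mul0mx mxE ltxx.
Qed.

Lemma fundamental_tensor_unit x y : U (x, y) -> fundamental_tensor F x y \in unitmx.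
Proof.
move=> [/= Ox y0]; apply: positive_definite_unitmx => v v0.
case: finslerF => _ /(_ _ Ox)[_ _ _ _ /(_ _ y0) /(_ _ v0) h].
by rewrite -scalemxAr -scalemxAl mxE mulr_gt0 // invr_gt0.
Qed.

(** The Hessian is [2 g] and the spray is [g^-1] applied to a quarter of the force: the inverse
    matrix disappears. The spray enters the energy computations in this form. *)
Lemma hessian_mul_spray x y : U (x, y) ->
  hessian (fun z => F x z ^+ 2) y *m (spray F x y)^T = 2^-1 *: (spray_force x y)^T.
Proof.
move=> Uxy; have gu := fundamental_tensor_unit Uxy.
have -> : hessian (fun z => F x z ^+ 2) y = 2 *: fundamental_tensor F x y.
  by rewrite scalerA divff ?scale1r // pnatr_eq0.
have -> : (spray F x y)^T = 4^-1 *: (invmx (fundamental_tensor F x y) *m (spray_force x y)^T).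
  apply/matrixP => i j; rewrite sprayE [LHS]mxE [LHS]mxE [RHS]mxE [X in _ = _ * X]mxE.
  congr (_ * _); apply: eq_bigr => k _.
  by rewrite [X in _ = _ * X]mxE (ord1 j).
rewrite -scalemxAl -scalemxAr mulKVmx // scalerA; congr (_ *: _); lra.
Qed.

Lemma derive_energy_diff2 v x y : U (x, y) -> differentiable (fun z => 'D_v E (x, z)) y.
Proof.
move=> Uxy; apply: (@differentiable_slice2 _ _ _ ('D_v E)).
exact: (derive_energy_differentiable Omega_open finslerF).
Qed.

Lemma derive_energy1Z i x y (a : R) : U (x, y) -> 0 < a ->
  'D_(e i, 0) E (x, a *: y) = a ^+ 2 * 'D_(e i, 0) E (x, y).
Proof.
move=> Uxy a0; have [/= Ox y0] := Uxy.
rewrite -!(@derive_slice1 R _ _ E).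
rewrite (@derive_near _ _ _ (a ^+ 2 \*: (fun w => E (w, y))) Omega) //.
  rewrite deriveZ //; apply: diff_derivable; apply: (@differentiable_slice1 _ _ _ E).
  exact: (energy_differentiable finslerF).
by move=> w; rewrite inE => Ow; exact: (energyZ finslerF).
Qed.

Lemma euler_energy x y : U (x, y) -> \sum_i y ord0 i * 'D_(0, e i) E (x, y) = 2 * E (x, y).
Proof.
move=> Uxy; have [/= Ox y0] := Uxy.
have dE : differentiable (fun z => E (x, z)) y.
  by apply: (@differentiable_slice2 _ _ _ E); exact: (energy_differentiable finslerF).
rewrite -(@euler_homogeneous R _ (fun z => E (x, z)) 2) //; last first.
  by move=> a a0; exact: (energyZ finslerF).
have h i : partial i (fun z => E (x, z)) y = 'D_(0, e i) E (x, y).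
  exact: (@derive_slice2 R _ _ E).
by rewrite (derive_partial _ dE); apply: eq_bigr => i _; rewrite h.
Qed.

Lemma near_slit2 x y : U (x, y) -> \near y, U (x, y).
Proof.
move=> Uxy; have c : {for y, continuous (fun z => (x, z))}.
  by apply: differentiable_continuous; apply: differentiable_pair.
exact: c (near_slit_tangent Omega_open Uxy).
Qed.

(* Differentiating Euler's identity [y^i E_{y^i} = 2 E] makes the symmetry of
   second derivatives unnecessary here. *)
Lemma y_mul_hessian x y j : U (x, y) ->
  \sum_i y ord0 i * hessian (fun z => F x z ^+ 2) y i j = 'D_(0, e j) E (x, y).
Proof.
move=> Uxy; have [/= Ox y0] := Uxy.
have dE2 i := derive_energy_diff2 (0, e i) Uxy.
have h := derive_coord_sum j dE2.
have lhs : 'D_(e j) (fun z : 'rV[R]_n => \sum_i z ord0 i * 'D_(0, e i) E (x, z)) y = 2 * 'D_(0, e j) E (x, y).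
  rewrite -(@derive_slice2 R _ _ E).
  transitivity ('D_(e j) (2 \*: (fun z => E (x, z))) y).
    by apply: near_eq_derive; apply: filterS (near_slit2 Uxy) => z; exact: euler_energy.
  rewrite deriveZ //; apply: diff_derivable; apply: (@differentiable_slice2 _ _ _ E).
  exact: (energy_differentiable finslerF).
have -> : \sum_i y ord0 i * hessian (fun z => F x z ^+ 2) y i j =
    \sum_i y ord0 i * 'D_(e j) (fun z => 'D_(0, e i) E (x, z)) y.
  apply: eq_bigr => i _; rewrite (hessian_energy x y i j).
  exact: (f_equal (fun a => _ * a) (esym (@derive_slice2 R _ _ ('D_(0, e i) E) x y (e j)))).
by move: h; rewrite lhs; lra.
Qed.

End spray_identities.

Section spray_lipschitz.
Context {R : realType} {n : nat}.
Context (Omega : set 'rV[R]_n) (F : 'rV[R]_n -> 'rV[R]_n -> R).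
Context (Omega_open : open Omega) (finslerF : finsler_metric Omega F).

Notation e := (delta_mx ord0 : 'I_n -> 'rV[R]_n).
Notation E := (energy F).
Notation M := (metric_fun F).
Notation U := (slit_tangent Omega).
Notation V := ('rV[R]_n * 'rV[R]_n)%type.

(** Every iterated derivative of the metric is differentiable, and its derivatives along a basis are
    differentiable, hence continuous. The basis of the product is indexed by a sum type. *)
Lemma iter_derive_lipschitz_near vs z : U z ->
  lipschitz_near (foldr (fun v (g : V -> R) => 'D_v g) M vs) z.
Proof.
move=> Uz.
pose b (i : 'I_n + 'I_n) : V := match i with inl i => (e i, 0) | inr i => (0, e i) end.
pose c (i : 'I_n + 'I_n) (v : V) : R := match i with inl i => v.1 ord0 i | inr i => v.2 ord0 i end.
apply: (@lipschitz_near_C1 _ _ _ b c).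
- move=> v; rewrite big_sumType /=.
  have -> : \sum_(i < n) v.1 ord0 i *: ((e i, 0) : V) = (v.1, 0).
    rewrite [in RHS](row_sum_delta v.1) (@big_morph _ _ (fun x => (x, 0) : V) 0 +%R) //.
      by apply: eq_bigr => i _; apply: injective_projections; rewrite /= ?scaler0.
    by move=> x y; apply: injective_projections; rewrite /= ?addr0.
  have -> : \sum_(i < n) v.2 ord0 i *: ((0, e i) : V) = (0, v.2).
    rewrite [in RHS](row_sum_delta v.2) (@big_morph _ _ (fun x => (0, x) : V) 0 +%R) //.
      by apply: eq_bigr => i _; apply: injective_projections; rewrite /= ?scaler0.
    by move=> x y; apply: injective_projections; rewrite /= ?addr0.
  by apply: injective_projections; rewrite /= ?addr0 ?add0r.
- by move=> [i|i] v; rewrite prod_normE le_max rV_coord_le_norm ?orbT.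
- apply: filterS (near_slit_tangent Omega_open Uz) => z' Uz'.
  exact: (smooth_metric finslerF vs Uz').
- move=> i; apply: differentiable_continuous.
  exact: (smooth_metric finslerF (b i :: vs) Uz).
Qed.

Lemma derive2_energy_lipschitz_near u v z : U z -> lipschitz_near ('D_u ('D_v E)) z.
Proof.
move=> Uz; apply: (@lipschitz_near_eq _ _ (fun z : V => 2 * ('D_u M z * 'D_v M z +
                             M z * 'D_u ('D_v M) z))).
  apply: filterS (near_slit_tangent Omega_open Uz) => z' Uz'.
  exact/esym/(derive2_energy Omega_open finslerF).
apply: lipschitz_nearZ; apply: lipschitz_nearD; apply: lipschitz_nearM.
- exact: (iter_derive_lipschitz_near [:: u]).
- exact: (iter_derive_lipschitz_near [:: v]).
- exact: (iter_derive_lipschitz_near [::]).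
- exact: (iter_derive_lipschitz_near [:: u; v]).
Qed.

Lemma derive_energy_lipschitz_near v z : U z -> lipschitz_near ('D_v E) z.
Proof.
move=> Uz; apply: (@lipschitz_near_eq _ _ (fun z : V => 2 * (M z * 'D_v M z))).
  apply: filterS (near_slit_tangent Omega_open Uz) => z' Uz'.
  exact/esym/(derive_energy finslerF).
apply: lipschitz_nearZ; apply: lipschitz_nearM.
- exact: (iter_derive_lipschitz_near [::]).
- exact: (iter_derive_lipschitz_near [:: v]).
Qed.

Lemma coord_lipschitz_near (i : 'I_n) (z : V) : lipschitz_near (fun z : V => z.2 ord0 i) z.
Proof.
exists 1, 1; split=> // y y' _ _; rewrite mul1r.
apply: le_trans (_ : `|(y - y').2| <= _); last by rewrite prod_normE le_max lexx orbT.
by have := rV_coord_le_norm (y - y').2 i; rewrite !mxE.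
Qed.

Lemma spray_lipschitz_near i z : U z -> lipschitz_near (fun z => spray F z.1 z.2 ord0 i) z.
Proof.
move=> Uz; pose g (z : V) := fundamental_tensor F z.1 z.2.
have lg j k z' : U z' -> lipschitz_near (fun z => g z j k) z'.
  move=> Uz'; have -> : (fun z => g z j k) = (fun z => 2^-1 * 'D_(0, e k) ('D_(0, e j) E) z).
    by apply/funext => -[x y]; rewrite /g mxE hessian_energy.
  by apply: lipschitz_nearZ; exact: derive2_energy_lipschitz_near.
have detg z' : U z' -> \det (g z') != 0.
  case: z' => x y Uz'; have := fundamental_tensor_unit finslerF Uz'.
  by rewrite unitmxE unitfE.
(* Cramer's formula for the inverse matrix: cofactors over the determinant, so that only polynomial
   operations and one inversion are involved. *)
pose h (z : V) := 4^-1 * \sum_(j < n) (\det (g z))^-1 *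
    ((-1) ^+ (j + i) * \det (row' j (col' i (g z)))) * spray_force F z.1 z.2 ord0 j.
suff lh : lipschitz_near h z.
  apply: lipschitz_near_eq lh.
  apply: filterS (near_slit_tangent Omega_open Uz) => z' Uz'.
  rewrite /h (sprayE F z'.1 z'.2) [RHS]mxE; apply: (f_equal (fun a => 4^-1 * a)).
  apply: eq_bigr => j _; apply: (f_equal (fun a => a * _)).
  by rewrite /invmx unitmxE unitfE detg // mxE mxE.
apply: lipschitz_nearZ; apply: lipschitz_near_sum => j; apply: lipschitz_nearM.
  apply: lipschitz_nearM.
    apply: lipschitz_nearV; first exact: detg.
    by apply: lipschitz_near_det => k l; exact: lg.
  apply: lipschitz_nearZ; apply: lipschitz_near_det => k l.
  by under eq_fun do rewrite mxE mxE; exact: lg.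
under eq_fun do rewrite mxE.
apply: lipschitz_nearB.
  apply: lipschitz_near_sum => k; apply: lipschitz_nearM.
    have -> : (fun z : V => 'D_(0, e j) ('D_(e k, 0) E) (z.1, z.2)) = 'D_(0, e j) ('D_(e k, 0) E).
      by apply/funext => -[].
    exact: derive2_energy_lipschitz_near.
  exact: coord_lipschitz_near.
have -> : (fun z : V => 'D_(e j, 0) E (z.1, z.2)) = 'D_(e j, 0) E by apply/funext => -[].
exact: derive_energy_lipschitz_near.
Qed.

End spray_lipschitz.

(** * Conservation of energy and local existence of geodesics *)

Section geodesic_existence.
Context {R : realType} {n : nat}.
Context (Omega : set 'rV[R]_n) (F : 'rV[R]_n -> 'rV[R]_n -> R).
Context (Omega_open : open Omega) (finslerF : finsler_metric Omega F).

Notation e := (delta_mx ord0 : 'I_n -> 'rV[R]_n).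
Notation E := (energy F).
Notation U := (slit_tangent Omega).
Notation V := ('rV[R]_n * 'rV[R]_n)%type.

Lemma derive_energy1 v x y : U (x, y) ->
  'D_(v, 0) E (x, y) = \sum_k v ord0 k * 'D_(e k, 0) E (x, y).
Proof.
move=> Uxy; have dE := differentiable_slice1 (energy_differentiable finslerF Uxy).
rewrite -(@derive_slice1 R _ _ E) (derive_partial v dE); apply: eq_bigr => k _.
exact: (f_equal (fun a => _ * a) (@derive_slice1 R _ _ E x (e k) y)).
Qed.

Lemma derive_energy2 v x y : U (x, y) ->
  'D_(0, v) E (x, y) = \sum_k v ord0 k * 'D_(0, e k) E (x, y).
Proof.
move=> Uxy; have dE := differentiable_slice2 (energy_differentiable finslerF Uxy).
rewrite -(@derive_slice2 R _ _ E) (derive_partial v dE); apply: eq_bigr => k _.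
exact: (f_equal (fun a => _ * a) (@derive_slice2 R _ _ E x y (e k))).
Qed.

(** [[F^2]_{x^k}] is homogeneous of degree two in [y]: Euler's identity makes the first part of the
    force contribute twice the right-hand side, and the second part removes it once. *)
Lemma y_mul_spray_force x y : U (x, y) ->
  \sum_j y ord0 j * spray_force F x y ord0 j = \sum_k y ord0 k * 'D_(e k, 0) E (x, y).
Proof.
move=> Uxy.
have h k : \sum_j 'D_(0, e j) ('D_(e k, 0) E) (x, y) * y ord0 j = 2 * 'D_(e k, 0) E (x, y).
  have dk := derive_energy_diff2 Omega_open finslerF (e k, 0) Uxy.
  have hk (a : R) : 0 < a -> 'D_(e k, 0) E (x, a *: y) = a ^+ 2 * 'D_(e k, 0) E (x, y).
    by move=> a0; exact: (derive_energy1Z Omega_open finslerF).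
  rewrite -(euler_homogeneous dk hk) (derive_partial y dk).
  apply: eq_bigr => j _; rewrite mulrC.
  exact: (f_equal (fun a => _ * a) (esym (@derive_slice2 R _ _ ('D_(e k, 0) E) x y (e j)))).
have -> : \sum_j y ord0 j * spray_force F x y ord0 j =
    \sum_j \sum_k y ord0 k * (y ord0 j * 'D_(0, e j) ('D_(e k, 0) E) (x, y)) -
    \sum_j y ord0 j * 'D_(e j, 0) E (x, y).
  rewrite -sumrB; apply: eq_bigr => j _; rewrite mxE mulrBr mulr_sumr.
  apply: (f_equal (fun a => a - _)); apply: eq_bigr => k _.
  exact: mul_rot.
rewrite exchange_big /=.
have -> : \sum_k \sum_j y ord0 k * (y ord0 j * 'D_(0, e j) ('D_(e k, 0) E) (x, y)) =
    2 * \sum_k y ord0 k * 'D_(e k, 0) E (x, y).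
  rewrite mulr_sumr; apply: eq_bigr => k _; rewrite -mulr_sumr [RHS]mulrCA -h.
  by apply: (f_equal (fun a => _ * a)); apply: eq_bigr => j _; rewrite mulrC.
set S := \sum_k _; lra.
Qed.

(** Conservation of energy: the geodesic vector field annihilates [F^2]. Euler's identities turn the
    horizontal and the vertical contributions into opposite values of the same sum. *)
Lemma derive_energy_spray x y : U (x, y) ->
  'D_(y, -2 *: spray F x y) E (x, y) = 0.
Proof.
move=> Uxy; have dE := energy_differentiable finslerF Uxy.
have -> : ((y, -2 *: spray F x y) : V) = 1 *: (y, 0) + (0, -2 *: spray F x y).
  by rewrite scale1r; apply: injective_projections; rewrite /= ?addr0 ?add0r.
rewrite (derive_lin _ _ _ dE) mul1r (derive_energy1 _ Uxy) (derive_energy2 _ Uxy).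
have hB : \sum_k (-2 *: spray F x y) ord0 k * 'D_(0, e k) E (x, y) =
    -2 * \sum_k spray F x y ord0 k * \sum_i y ord0 i * hessian (fun z => F x z ^+ 2) y i k.
  rewrite mulr_sumr; apply: eq_bigr => k _.
  by rewrite (y_mul_hessian Omega_open finslerF k Uxy) mxE mulrA.
rewrite [X in _ + X]hB.
have -> : \sum_k spray F x y ord0 k * (\sum_i y ord0 i * hessian (fun z => F x z ^+ 2) y i k) =
    \sum_i y ord0 i * (2^-1 * spray_force F x y ord0 i).
  under eq_bigr do rewrite mulr_sumr.
  rewrite exchange_big /=; apply: eq_bigr => i _.
  have /matrixP /(_ i ord0) := hessian_mul_spray finslerF Uxy.
  rewrite mxE [in RHS]mxE [X in _ = _ * X]mxE => <-.
  rewrite mulr_sumr; apply: eq_bigr => k _.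
  by rewrite mulrCA [X in _ = _ * (_ * X)]mxE; apply: (f_equal (fun a => _ * a)); rewrite mulrC.
rewrite -(y_mul_spray_force Uxy).
have -> : \sum_i y ord0 i * (2^-1 * spray_force F x y ord0 i) =
    2^-1 * \sum_i y ord0 i * spray_force F x y ord0 i.
  by rewrite mulr_sumr; apply: eq_bigr => i _; rewrite mulrCA.
set S := \sum_j _; lra.
Qed.

Lemma is_derive_pair (V1 V2 : normedModType R) (f : R -> V1) (g : R -> V2) (t : R) a b :
  is_derive t 1 f a -> is_derive t 1 g b -> is_derive t 1 (fun s => (f s, g s)) (a, b).
Proof.
move=> [df fa] [dg gb].
have df' : differentiable f t by exact/derivable1_diffP.
have dg' : differentiable g t by exact/derivable1_diffP.
have dfg : differentiable (fun s => (f s, g s)) t by exact: differentiable_pair.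
apply: DeriveDef; first exact/derivable1_diffP.
by rewrite (deriveE _ dfg) diff_pair //= -(deriveE _ df') -(deriveE _ dg') fa gb.
Qed.

Lemma geodesic_local_existence x y : Omega x -> y != 0 ->
  exists2 d : R, 0 < d & exists gamma : R -> 'rV[R]_n,
    [/\ geodesic Omega F (- d)%:E d%:E gamma, gamma 0 = x & derive1 gamma 0 = y].
Proof.
move=> Ox y0.
(* Position and velocity are packed in a single row of length [n + n], which turns the geodesic
   equation into a first-order system. *)
pose spl (w : 'rV[R]_(n + n)) : V := (lsubmx w, rsubmx w).
pose Phi (w : 'rV[R]_(n + n)) : 'rV[R]_(n + n) :=
  row_mx (rsubmx w) (-2 *: spray F (lsubmx w) (rsubmx w)).
have splw : spl (row_mx x y) = (x, y) by rewrite /spl row_mxKl row_mxKr.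
have Uxy : U (spl (row_mx x y)) by rewrite splw.
have spl1 w w' : `|spl w - spl w'| <= `|w - w'|.
  rewrite prod_normE ge_max /=; apply/andP; split; apply: rV_norm_le => // i; rewrite !mxE.
    by have := rV_coord_le_norm (w - w') (lshift n i); rewrite !mxE.
  by have := rV_coord_le_norm (w - w') (rshift n i); rewrite !mxE.
have [r [L [r0 lip]]] : exists r L : R, 0 < r /\ forall w w',
    `|w - row_mx x y| <= r -> `|w' - row_mx x y| <= r -> `|Phi w - Phi w'| <= L * `|w - w'|.
  apply: lipschitz_near_row => i; case: (split_ordP i) => j ->.
    have -> : (fun w => Phi w ord0 (lshift n j)) = (fun w => w ord0 (rshift n j)).
      by apply/funext => w; rewrite row_mxEl mxE.
    exists 1, 1; split=> // w w' _ _; rewrite mul1r.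
    by have := rV_coord_le_norm (w - w') (rshift n j); rewrite !mxE.
  have -> : (fun w => Phi w ord0 (rshift n j)) =
      (fun z : V => -2 * spray F z.1 z.2 ord0 j) \o spl.
    by apply/funext => w; rewrite row_mxEr mxE.
  apply: lipschitz_near_comp => //; apply: lipschitz_nearZ.
  exact: (spray_lipschitz_near Omega_open finslerF).
have [e0 e00 Ue] : exists2 e0 : R, 0 < e0 & forall w, `|w - row_mx x y| < e0 -> U (spl w).
  have /nbhs_ballP[e0 /= e00 he] := near_slit_tangent Omega_open Uxy.
  exists e0 => // w we; apply: he; rewrite -ball_normE /= distrC.
  exact: le_lt_trans we.
(* This radius keeps the solution within the slit tangent bundle, where the velocity is nonzero. *)
have r'0 : 0 < Num.min r (e0 / 2) by rewrite lt_min r0 divr_gt0.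
have [|d d0 [w w0 dw]] := @picard_local R _ Phi L (Num.min r (e0 / 2)) (row_mx x y) r'0.
  move=> z z'; rewrite !le_min => /andP[zr _] /andP[zr' _]; exact: lip.
have Uw (t : R) : `|t| < d -> U (spl (w t)).
  move=> /dw[+ _]; rewrite le_min => /andP[_ h]; apply: Ue.
  by apply: le_lt_trans h _; lra.
pose gamma t := lsubmx (w t).
have dl (t : R) : `|t| < d -> is_derive t 1 gamma (rsubmx (w t)).
  move=> /dw[_ h]; apply: is_derive_rV => i.
  have := is_derive_rV_coord (lshift n i) h; rewrite row_mxEl.
  by under [X in is_derive _ _ X _ -> _]eq_fun do rewrite -[w _](hsubmxK) row_mxEl.
have dr (t : R) : `|t| < d -> is_derive t 1 (fun t => rsubmx (w t))
    (-2 *: spray F (gamma t) (rsubmx (w t))).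
  move=> /dw[_ h]; apply: is_derive_rV => i.
  have := is_derive_rV_coord (rshift n i) h; rewrite row_mxEr.
  by under [X in is_derive _ _ X _ -> _]eq_fun do rewrite -[w _](hsubmxK) row_mxEr.
have d1 (t : R) : `|t| < d -> derive1 gamma t = rsubmx (w t).
  by move=> /dl[_ <-]; rewrite derive1E.
have d1' (t : R) : `|t| < d -> is_derive t 1 (derive1 gamma)
    (-2 *: spray F (gamma t) (rsubmx (w t))).
  move=> td; apply: (near_eq_is_derive _ (dr t td)).
  apply/nbhs_ballP; exists (d - `|t|); first by rewrite /= subr_gt0.
  move=> s; rewrite -ball_normE /= => ts; rewrite d1 //.
  by rewrite -(subKr t s) (le_lt_trans (ler_normB _ _)) // -ltrBrDl.
have tE (t : R) : ((- d)%:E < t%:E < d%:E)%E = (`|t| < d) by rewrite !lte_fin ltr_norml.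
exists d => //; exists gamma; split; last 2 first.
- by rewrite /gamma w0 row_mxKl.
- by rewrite d1 ?normr0 // w0 row_mxKr.
split; last first.
  move=> t; rewrite tE => td; have [/= Ot _] := Uw t td; split => //.
  - by have [] := dl t td.
  - by have [] := d1' t td.
  - by have [_ h] := d1' t td; rewrite derive1E h d1 // scaleNr addNr.
exists (F x y); first exact: (metric_gt0 finslerF).
move=> t; rewrite tE => td; rewrite d1 //.
have dE (s : R) : - d < s < d -> is_derive s 1 (E \o (fun t => spl (w t))) 0.
  rewrite -ltr_norml => sd.
  rewrite -(derive_energy_spray (Uw s sd)).
  apply: is_derive_comp_curve; first exact: (energy_differentiable finslerF (Uw s sd)).
  exact: is_derive_pair (dl s sd) (dr s sd).
(* The energy has zero derivative along the solution; as [F] is nonnegative, its square determines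
   the speed. *)
have : `|(E \o (fun t => spl (w t))) t - (E \o (fun t => spl (w t))) 0| <= 0 * `|t - 0|.
  apply: (derive_diff_le dE) => [s _||]; rewrite ?normr0 //; first by rewrite oppr_lt0 d0.
  by rewrite -ltr_norml.
rewrite mul0r normr_le0 subr_eq0.
rewrite /= w0 splw /energy /= eqrXn2 //.
- by move=> /eqP.
- by apply: (metric_ge0 finslerF); have [] := Uw t td.
- exact: (metric_ge0 finslerF).
Qed.

End geodesic_existence.

(** * Geodesics of a projectively flat metric *)

Lemma derive0_const {R : realType} (g : R -> R) (a b : R) : a <= b ->
  (forall t : R, a <= t <= b -> is_derive t 1 g 0) -> g a = g b.
Proof.
rewrite le_eqVlt => /predU1P[->//|ab] dg.
have [||c _ /eqP] := @MVT R g (cst 0) a b ab.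
- by move=> t; rewrite in_itv /= => /andP[/ltW ? /ltW ?]; apply: dg; apply/andP.
- by apply: derivable_within_continuous => t; rewrite in_itv /= => tab; have [] := dg t tab.
- by rewrite mul0r subr_eq0 => /eqP.
Qed.

Section metric_on_lines.
Context {R : realType} {n : nat}.
Context (Omega : set 'rV[R]_n) (F : 'rV[R]_n -> 'rV[R]_n -> R).
Context (Omega_open : open Omega) (finslerF : finsler_metric Omega F).
Context (Omega_strictly_convex : strictly_convex Omega).

Notation M := (metric_fun F).
Notation U := (slit_tangent Omega).

(** The traces of [Omega] on lines are intervals, so a function whose derivative vanishes on such a
    trace is constant there. *)
Lemma strictly_convex_line x y (s t : R) : Omega x -> Omega (x + s *: y) ->
  (0 <= t <= s \/ s <= t <= 0) -> Omega (x + t *: y).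
Proof.
move=> Ox Os ts.
have [->|t0] := eqVneq t 0; first by rewrite scale0r addr0.
have [->//|tns] := eqVneq t s.
have [->|y0] := eqVneq y 0; first by rewrite scaler0 addr0.
have s0 : s != 0.
  by apply: contraNneq t0 => s0; rewrite s0 in ts; case: ts => /le_anti ->.
have -> : x + t *: y = (1 - t / s) *: x + (t / s) *: (x + s *: y).
  by rewrite scalerDr scalerA divfK // addrA -scalerDl subrK scale1r.
have [HO _] := interior_id Omega; rewrite -(HO Omega_open).
apply: Omega_strictly_convex; [exact: subset_closure|exact: subset_closure| |].
  by rewrite eq_sym -subr_eq0 addrC addKr scaler_eq0 negb_or s0.
case: ts => /andP[h1 h2].
  have spos : 0 < s by rewrite lt_neqAle eq_sym s0 (le_trans h1).
  rewrite divr_gt0 ?ltr_pdivrMr ?mul1r //= ?lt_neqAle ?tns //.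
  by rewrite eq_sym t0.
have sneg : s < 0 by rewrite lt_neqAle s0 (le_trans h1).
have tneg : t < 0 by rewrite lt_neqAle t0.
rewrite -mulrNN -invrN divr_gt0 ?oppr_gt0 //= ltr_pdivrMr ?oppr_gt0 // mul1r ltrN2.
by rewrite lt_neqAle eq_sym tns.
Qed.

Lemma projective_factorE x y : U (x, y) ->
  projective_factor F x y = 'D_(y, 0) M (x, y) / (2 * F x y).
Proof.
move=> Uxy; have dM := differentiable_slice1 (metric_differentiable finslerF Uxy).
rewrite /projective_factor; apply: (f_equal (fun a => a / _)).
by rewrite -(@derive_slice1 R _ _ M) (derive_partial y dM).
Qed.

Lemma metric_line_derive x y (s : R) : Omega (x + s *: y) -> y != 0 ->
  is_derive s 1 (fun s => F (x + s *: y) y)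
    (2 * F (x + s *: y) y * projective_factor F (x + s *: y) y).
Proof.
move=> Os y0; have Uxy : U (x + s *: y, y) by [].
have dM := differentiable_slice1 (metric_differentiable finslerF Uxy).
have Fpos := metric_gt0 finslerF Os y0.
have -> : 2 * F (x + s *: y) y * projective_factor F (x + s *: y) y =
    'D_y (fun w => M (w, y)) (x + s *: y).
  rewrite projective_factorE // -(@derive_slice1 R _ _ M).
  by rewrite mulrC divfK // mulf_neq0 ?pnatr_eq0 // gt_eqF.
exact: (is_derive_line dM).
Qed.

Lemma projective_factor_line_derive x y (s kappa : R) : Omega (x + s *: y) -> y != 0 ->
  flag_curvature F (x + s *: y) y = kappa ->
  is_derive s 1 (fun s => projective_factor F (x + s *: y) y)
    (projective_factor F (x + s *: y) y ^+ 2 - kappa * F (x + s *: y) y ^+ 2).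
Proof.
move=> Os y0 fk; have Uxy : U (x + s *: y, y) by [].
have Fpos := metric_gt0 finslerF Os y0.
have dP : differentiable (fun w => projective_factor F w y) (x + s *: y).
  apply: (@near_eq_differentiable _ _ _ (fun w => 'D_(y, 0) M (w, y) * (2 * M (w, y))^-1)).
    have : \forall w \near x + s *: y, Omega w by apply: open_nbhs_nbhs; split.
    by apply: filterS => w Ow; rewrite projective_factorE.
  apply: (@differentiableM _ _ (fun w => 'D_(y, 0) M (w, y))).
    exact: (differentiable_slice1 (derive_metric_differentiable finslerF (y, 0) Uxy)).
  apply: (@differentiableV _ _ (fun w => 2 * M (w, y))); last first.
    by rewrite mulf_neq0 ?pnatr_eq0 // gt_eqF.
  apply: (@differentiableZ _ _ _ (fun w => M (w, y))).
  exact: (differentiable_slice1 (metric_differentiable finslerF Uxy)).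
have <- : 'D_y (fun w => projective_factor F w y) (x + s *: y) =
    projective_factor F (x + s *: y) y ^+ 2 - kappa * F (x + s *: y) y ^+ 2.
  rewrite -fk /flag_curvature divfK ?sqrf_eq0 ?gt_eqF //.
  by rewrite subKr (derive_partial y dP).
exact: (is_derive_line dP).
Qed.

(** The discriminant depends on the curvature alone, hence is common to all points and directions;
    this is what later relates the two orientations of a line. *)
Lemma metric_line_quadratic (kappa : R) x y : Omega x -> y != 0 ->
  (forall x y, Omega x -> y != 0 -> flag_curvature F x y = kappa) ->
  exists B C : R, B ^+ 2 - 4 * (F x y)^-1 * C = - 4 * kappa /\
    forall s, Omega (x + s *: y) -> F (x + s *: y) y * ((F x y)^-1 + B * s + C * s ^+ 2) = 1.
Proof.
move=> Ox y0 curv.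
pose f s := F (x + s *: y) y; pose p s := projective_factor F (x + s *: y) y.
have f0 s : Omega (x + s *: y) -> f s != 0 by move=> Os; rewrite gt_eqF // (metric_gt0 finslerF).
have df s : Omega (x + s *: y) -> is_derive (s : R) 1 f (2 * f s * p s).
  by move=> Os; exact: metric_line_derive.
have dp s : Omega (x + s *: y) -> is_derive (s : R) 1 p (p s ^+ 2 - kappa * f s ^+ 2).
  by move=> Os; apply: projective_factor_line_derive => //; exact: curv.
have dV s : Omega (x + s *: y) -> is_derive (s : R) 1 (fun s => (f s)^-1) (- 2 * p s / f s).
  move=> Os; have [d1 e1] := df s Os.
  apply: DeriveDef; first exact: (derivableV (f0 s Os)).
  rewrite (deriveV (f0 s Os) d1) e1 /GRing.scale /=.
  by have := f0 s Os; set a := f s; set b := p s => a0; field.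
have const (g : R -> R) : (forall s, Omega (x + s *: y) -> is_derive (s : R) 1 g 0) ->
    forall s, Omega (x + s *: y) -> g s = g 0.
  move=> dg s Os; have [s0|/ltW s0] := leP 0 s.
    apply/esym; apply: (derive0_const s0) => t ts; apply: dg.
    by apply: (strictly_convex_line Ox Os); left.
  apply: (derive0_const s0) => t ts; apply: dg.
  by apply: (strictly_convex_line Ox Os); right.
(* With [q = 1 / f] one has [q' = - 2 p / f] and [q'' = 2 C]. Thus [C], then [B = q' - 2 c s], then
   [A = q - b s - c s^2] are shown to be constant. *)
pose C (s : R) := (p s ^+ 2 + kappa * f s ^+ 2) / f s.
have dC s : Omega (x + s *: y) -> is_derive (s : R) 1 C 0.
  move=> Os; have h := is_deriveM (is_deriveD (is_deriveX 2 (dp s Os))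
     (is_deriveZ kappa (is_deriveX 2 (df s Os)))) (dV s Os).
  apply: (is_derive_eq h); rewrite /GRing.scale /= !fctE.
  rewrite -[(kappa \*: _) s]/(kappa * f s ^+ 2) !expr1.
  by have := f0 s Os; set a := f s; set b := p s => a0; field.
pose c := C 0.
have Cc s : Omega (x + s *: y) -> C s = c by apply: const.
pose B (s : R) := -2 * (p s * (f s)^-1) - 2 * c * s.
have dB s : Omega (x + s *: y) -> is_derive (s : R) 1 B 0.
  move=> Os; have h := is_deriveB (is_deriveZ (-2) (is_deriveM (dp s Os) (dV s Os)))
     (is_deriveZ (2 * c) (is_derive_id s 1)).
  apply: (is_derive_eq h); rewrite -(Cc s Os) /C /GRing.scale /=.
  by have := f0 s Os; set a := f s; set b := p s => a0; field.
pose b := B 0.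
have Bb s : Omega (x + s *: y) -> B s = b by apply: const.
pose A (s : R) := (f s)^-1 - b * s - c * (s * s).
have dA s : Omega (x + s *: y) -> is_derive (s : R) 1 A 0.
  move=> Os; have h := is_deriveB (is_deriveB (dV s Os) (is_deriveZ b (is_derive_id s 1)))
     (is_deriveZ c (is_deriveM (is_derive_id s 1) (is_derive_id s 1))).
  apply: (is_derive_eq h); rewrite -(Bb s Os) /B /GRing.scale /=.
  by have := f0 s Os; set a := f s; set b' := p s => a0; field.
have O0 : Omega (x + 0 *: y) by rewrite scale0r addr0.
have fx : f 0 = F x y by rewrite /f scale0r addr0.
exists b, c; split.
  rewrite /b /B /c /C -fx mulr0 subr0.
  by have := f0 0 O0; set a := f 0; set b' := p 0 => a0; field.
move=> s Os; have := const A dA s Os; rewrite /A !mulr0 !subr0 fx => hA.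
have -> : (F x y)^-1 + b * s + c * s ^+ 2 = (f s)^-1 by rewrite -hA; ring.
by rewrite divff // f0.
Qed.

End metric_on_lines.

Section geodesics_on_lines.
Context {R : realType} {n : nat}.
Context (Omega : set 'rV[R]_n) (F : 'rV[R]_n -> 'rV[R]_n -> R).
Context (finslerF : finsler_metric Omega F) (flat : projectively_flat Omega F).

Lemma ereal_itv_ball (a b : \bar R) (t0 : R) : (a < t0%:E < b)%E ->
  exists2 d : R, 0 < d & forall t, `|t - t0| < d -> (a < t%:E < b)%E.
Proof.
move=> /andP[at0 t0b].
have [d1 d10 h1] : exists2 d : R, 0 < d & forall t, `|t - t0| < d -> (a < t%:E)%E.
  case: a at0 => [a|//|_]; last by exists 1 => // t _; rewrite ltNyr.
  rewrite lte_fin => at0; exists (t0 - a); first by rewrite subr_gt0.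
  by move=> t; rewrite lte_fin ltr_norml => /andP[]; lra.
have [d2 d20 h2] : exists2 d : R, 0 < d & forall t, `|t - t0| < d -> (t%:E < b)%E.
  case: b t0b => [b|_|//]; last by exists 1 => // t _; rewrite ltry.
  rewrite lte_fin => t0b; exists (b - t0); first by rewrite subr_gt0.
  by move=> t; rewrite lte_fin ltr_norml => /andP[]; lra.
exists (Num.min d1 d2); first by rewrite lt_min d10.
by move=> t; rewrite lt_min => /andP[/h1 -> /h2 ->].
Qed.

Lemma ereal_itv_near (a b : \bar R) (t0 : R) : (a < t0%:E < b)%E ->
  nbhs t0 (fun t => (a < t%:E < b)%E).
Proof.
move=> /ereal_itv_ball[d d0 h]; apply/nbhs_ballP; exists d => // t.
by rewrite -ball_normE /= distrC; exact: h.
Qed.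

Lemma ereal_itv_between (a b : \bar R) (s t u : R) : (a < s%:E < b)%E -> (a < t%:E < b)%E ->
  s <= u <= t -> (a < u%:E < b)%E.
Proof.
move=> /andP[as_ _] /andP[_ tb] /andP[su ut].
by rewrite (lt_le_trans as_) ?lee_fin //= (le_lt_trans _ tb) ?lee_fin.
Qed.

(** Flatness only puts the image on some line, with no regularity of the parameter. Dividing by a
    nonzero coordinate of the velocity yields a differentiable parameter, and constancy of the speed
    then determines its derivative. *)
Lemma geodesic_line (a b : \bar R) gamma (t0 : R) : geodesic Omega F a b gamma ->
  (a < t0%:E < b)%E ->
  derive1 gamma t0 != 0 /\
  exists sigma : R -> R, [/\ sigma t0 = 0,
    forall t, (a < t%:E < b)%E -> gamma t = gamma t0 + sigma t *: derive1 gamma t0 &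
    forall t, (a < t%:E < b)%E -> is_derive t 1 sigma
      (F (gamma t0) (derive1 gamma t0) / F (gamma t) (derive1 gamma t0))].
Proof.
move=> geo t0ab; have [[c c0 speed] geo2] := geo.
set x := gamma t0; set y := derive1 gamma t0.
have Ogam t : (a < t%:E < b)%E -> Omega (gamma t) by move=> /geo2[].
have F0 z : Omega z -> F z 0 = 0.
  by case: finslerF => _ /[apply] -[_ /(_ 0)[_ +] _ _ _]; apply.
have nz t : (a < t%:E < b)%E -> derive1 gamma t != 0.
  move=> tab; apply/eqP => g0; have := speed t tab; rewrite g0 F0; last exact: Ogam.
  by move=> c00; rewrite -c00 ltxx in c0.
have y0 : y != 0 by exact: nz.
split=> //.
have ab : (a < b)%E by case/andP: t0ab; exact: lt_trans.
have [p [v hv]] := flat ab geo.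
have [s hs] : exists s : R -> R, forall t, (a < t%:E < b)%E -> gamma t = p + s t *: v.
  suff /choice[s hs] : forall t, exists s, (a < t%:E < b)%E -> gamma t = p + s *: v by exists s.
  move=> t; have [tab|ntab] := boolP (a < t%:E < b)%E; last by exists 0.
  by have [s hs] := hv t tab; exists s.
have gx t : (a < t%:E < b)%E -> gamma t - x = (s t - s t0) *: v.
  by move=> tab; rewrite /x !hs // opprD addrACA subrr add0r scalerBl.
have dg t i : (a < t%:E < b)%E ->
    is_derive t 1 (fun t => gamma t ord0 i) (derive1 gamma t ord0 i).
  move=> tab; apply: is_derive_rV_coord; have [_ dgt _ _] := geo2 t tab.
  by apply: DeriveDef; [exact: dgt|rewrite derive1E].
(* The velocity at [t0] is parallel to [v]: the combinations of two coordinates of [gamma] that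
   cancel the direction [v] are constant, and their derivatives are the minors of [y] and [v]. *)
have yv i j : y ord0 i * v ord0 j = y ord0 j * v ord0 i.
  have h := is_deriveB (is_deriveZ (v ord0 j) (dg t0 i t0ab)) (is_deriveZ (v ord0 i) (dg t0 j t0ab)).
  have h0 : is_derive t0 1 ((v ord0 j \*: (fun t => gamma t ord0 i)) -
      (v ord0 i \*: (fun t => gamma t ord0 j))) 0.
    apply: (near_eq_is_derive _
      (is_derive_cst (v ord0 j * x ord0 i - v ord0 i * x ord0 j) t0 1)).
    apply: filterS (ereal_itv_near t0ab) => t tab.
    have gE : gamma t = x + (s t - s t0) *: v by rewrite -gx // addrC subrK.
    rewrite !fctE /= gE !mxE /GRing.scale /=; ring.
  move: h h0 => [_ h1] [_ h2]; rewrite h1 in h2.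
  by move/subr0_eq: h2; rewrite /GRing.scale /= mulrC => ->; rewrite mulrC.
have /rV0Pn[i yi] := y0.
pose sg t := (gamma t ord0 i - x ord0 i) / y ord0 i.
pose ds t := derive1 gamma t ord0 i / y ord0 i.
have sgE t : (a < t%:E < b)%E -> gamma t = x + sg t *: y.
  move=> tab; apply/rowP => j; rewrite /sg.
  have /rowP := gx t tab => h; have := h i; have := h j; rewrite !mxE => hj ->.
  rewrite -(subrK (x ord0 j) (gamma t ord0 j)) hj addrC; congr (_ + _).
  have -> : v ord0 j = y ord0 j * v ord0 i / y ord0 i by rewrite -yv mulrAC divff // mul1r.
  ring.
have dsg t : (a < t%:E < b)%E -> is_derive t 1 sg (ds t).
  move=> tab; have h := is_deriveZ (y ord0 i)^-1 (is_deriveB (dg t i tab) (is_derive_cst (x ord0 i) t 1)).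
  have -> : sg = (y ord0 i)^-1 \*: ((fun t => gamma t ord0 i) - cst (x ord0 i)).
    by apply/funext => u; rewrite /sg mulrC.
  by apply: (is_derive_eq h); rewrite subr0 /ds mulrC.
have dgE t : (a < t%:E < b)%E -> derive1 gamma t = ds t *: y.
  move=> tab; apply/rowP => j; have [_ <-] := dg t j tab; rewrite mxE.
  have h := is_deriveD (is_derive_cst (x ord0 j) t 1) (is_deriveZ (y ord0 j) (dsg t tab)).
  have h1 : is_derive t 1 (fun t => gamma t ord0 j) (0 + y ord0 j *: ds t).
    apply: (near_eq_is_derive _ h); apply: filterS (ereal_itv_near tab) => u uab.
    by rewrite sgE // !mxE !fctE /GRing.scale /= mulrC.
  by have [_ ->] := h1; rewrite add0r mulrC.
have ds0 t : (a < t%:E < b)%E -> ds t != 0.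
  by move=> tab; apply: contraNneq (nz t tab) => d0; rewrite dgE // d0 scale0r.
have cds t : (a < t%:E < b)%E -> {for t, continuous ds}.
  move=> tab; apply: cvgM; last exact: cvg_cst.
  have [_ _ d2 _] := geo2 t tab.
  have d2' : is_derive t 1 (derive1 gamma) ('D_1 (derive1 gamma) t) by apply: DeriveDef.
  have [d3 _] := is_derive_rV_coord i d2'.
  by apply: differentiable_continuous; apply/derivable1_diffP.
have ds1 : ds t0 = 1 by rewrite /ds divff.
(* The metric is only positively homogeneous, so the sign matters: [ds] is continuous, never zero,
   and equals one at [t0]. *)
have dspos t : (a < t%:E < b)%E -> 0 < ds t.
  move=> tab; rewrite ltNge; apply/negP => dst.
  have seg u w : (a < u%:E < b)%E -> (a < w%:E < b)%E -> {within `[u, w], continuous ds}.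
    move=> uab wab; apply: continuous_in_subspaceT => z; rewrite inE /= in_itv /= => zuw.
    by apply: cds; exact: ereal_itv_between uab wab zuw.
  have [tt0|/ltW tt0] := leP t t0.
    have [|z] := @IVT _ ds t t0 0 tt0 (seg _ _ tab t0ab).
      by rewrite ds1 ge_min dst le_max ler01 orbT.
    rewrite in_itv /= => zt /eqP; apply/negP; apply: ds0.
    exact: ereal_itv_between tab t0ab zt.
  have [|z] := @IVT _ ds t0 t 0 tt0 (seg _ _ t0ab tab).
    by rewrite ds1 ge_min dst orbT le_max ler01.
  rewrite in_itv /= => zt /eqP; apply/negP; apply: ds0.
  exact: ereal_itv_between t0ab tab zt.
exists sg; split.
- by rewrite /sg subrr mul0r.
- exact: sgE.
move=> t tab; apply: (is_derive_eq (dsg t tab)).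
have := speed t tab; rewrite dgE // (metricZ finslerF _ (Ogam t tab) (dspos t tab)).
rewrite (speed t0 t0ab) => <-; rewrite mulfK // gt_eqF //.
exact: (metric_gt0 finslerF (Ogam t tab)).
Qed.

End geodesics_on_lines.

(** * Global solutions of an autonomous equation with quadratic right-hand side *)

Section quadratic_flow.
Context {R : realType}.
Implicit Types A B C : R.

Lemma derive_ge_growth (f df : R -> R) (m a b : R) : a <= b ->
  (forall t : R, a <= t <= b -> is_derive t 1 f (df t)) ->
  (forall t, a <= t <= b -> m <= df t) -> m * (b - a) <= f b - f a.
Proof.
rewrite le_eqVlt => /predU1P[->|ab] dg hm; first by rewrite !subrr mulr0.
have [||t tab ->] := @MVT R f df a b ab.
- by move=> t; rewrite in_itv /= => /andP[/ltW ? /ltW ?]; apply: dg; apply/andP.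
- by apply: derivable_within_continuous => t; rewrite in_itv /= => tab; have [] := dg t tab.
- rewrite ler_wpM2r ?subr_ge0 ?(ltW ab) // hm //.
  by move: tab; rewrite in_itv /= => /andP[/ltW -> /ltW ->].
Qed.

Lemma quadratic_pos_near A B C s : 0 < A + B * s + C * s ^+ 2 ->
  exists d m : R, [/\ 0 < d, 0 < m &
    forall u, `|u - s| < d -> m <= A + B * u + C * u ^+ 2].
Proof.
move=> q0.
have : {for s, continuous (fun u => A + B * u + C * u ^+ 2)}.
  apply: cvgD; first by apply: cvgD; [exact: cvg_cst|apply: cvgM; [exact: cvg_cst|exact: cvg_id]].
  by apply: cvgM; [exact: cvg_cst|exact: exprn_continuous].
move=> /cvgrPdist_lt /(_ _ (divr_gt0 q0 (ltr0Sn _ 1))) /nbhs_ballP[d /= d0 hd].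
exists d, ((A + B * s + C * s ^+ 2) / 2); split=> //; first by rewrite divr_gt0.
move=> u us; have := hd u; rewrite -ball_normE /= distrC => /(_ us).
rewrite ltr_norml; lra.
Qed.

(** The supremum of a bounded orbit must be a zero of the polynomial: a positive value there would
    give a speed bounded below and push the orbit past it, a negative value would contradict
    positivity along the orbit. For an unbounded orbit, [C > 0] would cause blow-up in finite time
    and [C < 0] would make the polynomial negative far away. *)
Lemma quadratic_flow_end A B C (c : R) (sigma : R -> R) :
  0 < c -> sigma 0 = 0 ->
  (forall t : R, 0 <= t ->
     is_derive t 1 sigma (c * (A + B * sigma t + C * sigma t ^+ 2)) /\
     0 < A + B * sigma t + C * sigma t ^+ 2) ->
  (exists s1, [/\ 0 < s1, A + B * s1 + C * s1 ^+ 2 = 0 &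
     forall s, 0 <= s < s1 -> exists2 t, 0 <= t & sigma t = s]) \/
  (C = 0 /\ forall s, 0 <= s -> exists2 t, 0 <= t & sigma t = s).
Proof.
move=> c0 sig0 dsig.
pose q s := A + B * s + C * s ^+ 2.
have A0 : 0 < A by have [_] := dsig 0 (lexx _); rewrite sig0 mulr0 expr0n mulr0 !addr0.
have incr s t : 0 <= s -> s <= t -> sigma s <= sigma t.
  move=> s0 st; rewrite -subr_ge0 -(mul0r (t - s)).
  apply: (derive_ge_growth st) => u /andP[su _].
    by have [h _] := dsig u (le_trans s0 su); exact: h.
  by have [_ h] := dsig u (le_trans s0 su); rewrite mulr_ge0 // ltW.
have surj t s : 0 <= t -> 0 <= s <= sigma t -> exists2 u, 0 <= u & sigma u = s.
  move=> t0 /andP[s0 st].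
  have cw : {within `[0, t], continuous sigma}.
    apply: derivable_within_continuous => u; rewrite in_itv /= => /andP[u0 _].
    by have [[]] := dsig u u0.
  have [|u] := @IVT _ sigma 0 t s t0 cw.
    by rewrite sig0 ge_min s0 le_max st orbT.
  by rewrite in_itv /= => /andP[u0 _] us; exists u.
have [bnd|unb] := pselect (exists K, forall t, 0 <= t -> sigma t <= K).
- left; case: bnd => K sK.
  pose S := [set sigma t | t in [set t | 0 <= t]].
  have supS : has_sup S.
    split; first by exists (sigma 0); exists 0 => //=.
    by exists K => _ [t t0 <-]; exact: sK.
  pose s1 := sup S.
  have les1 t : 0 <= t -> sigma t <= s1 by move=> t0; apply: sup_upper_bound => //; exists t.
  have lts1 s : s < s1 -> exists2 t, 0 <= t & s < sigma t.
    move=> ss1; have ss0 : 0 < s1 - s by rewrite subr_gt0.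
    have [_ [t t0 <-] h] := sup_adherent ss0 supS.
    by exists t => //; move: h; rewrite -/s1 subKr.
  have near_s1 d t : (forall u, t <= u -> 0 <= u) -> s1 - d < sigma t ->
      forall u, t <= u -> `|sigma u - s1| < d.
    move=> t0 st u tu; have u0 := t0 u tu; have := incr t u (t0 t (lexx _)) tu.
    have h2 := les1 u u0; rewrite ler0_norm ?subr_le0 //; lra.
  have s10 : 0 < s1.
    rewrite ltNge; apply/negP => s1le.
    have sig00 t : 0 <= t -> sigma t = 0.
      move=> t0; apply/eqP; rewrite eq_le (le_trans (les1 t t0) s1le) -sig0.
      exact: incr.
    have : c * A * (1 - 0) <= sigma 1 - sigma 0.
      apply: (derive_ge_growth ler01) => t /andP[t0 _].
        by have [h _] := dsig t t0; exact: h.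
      by rewrite /= sig00 // mulr0 expr0n mulr0 !addr0.
    rewrite !sig00 // !subr0 mulr1 leNgt mulr_gt0 //.
  have qs1 : q s1 = 0.
    apply/eqP; rewrite eq_le !leNgt; apply/andP; split; apply/negP => qs1.
      have [d [m [d0 m0 qm]]] := quadratic_pos_near qs1.
      have [T T0 sT] := lts1 (s1 - d) (ltac:(rewrite ltrBlDr ltrDl //)).
      have T0' u : T <= u -> 0 <= u by exact: le_trans.
      have cm : 0 < c * m by rewrite mulr_gt0.
      have TT' : T <= T + 2 * d / (c * m) by rewrite lerDl divr_ge0 ?mulr_ge0 // ltW.
      have : (c * m) * (T + 2 * d / (c * m) - T) <= sigma (T + 2 * d / (c * m)) - sigma T.
        apply: (derive_ge_growth TT') => t /andP[Tt _].
          by have [h _] := dsig t (T0' t Tt); exact: h.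
        by rewrite ler_pM2l //; apply: qm; exact: (near_s1 _ _ T0' sT).
      rewrite addrAC subrr add0r mulrC divfK ?gt_eqF // => h.
      have := les1 _ (T0' _ TT'); lra.
    have nqs1 : 0 < - A + (- B) * s1 + (- C) * s1 ^+ 2.
      by move: qs1; rewrite /q; lra.
    have [d [m [d0 m0 qm]]] := quadratic_pos_near nqs1.
    have [T T0 sT] := lts1 (s1 - d) (ltac:(rewrite ltrBlDr ltrDl //)).
    have T0' u : T <= u -> 0 <= u by exact: le_trans.
    have := qm _ (near_s1 _ _ T0' sT T (lexx _)).
    have [_] := dsig T T0; lra.
  exists s1; split=> // s /andP[s0 ss1]; have [t t0 st] := lts1 s ss1.
  by apply: (surj t) => //; rewrite s0 ltW.
- right.
  have lrg K : exists2 t, 0 <= t & K < sigma t.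
    apply: contrapT => nK; apply: unb; exists K => t t0.
    by rewrite leNgt; apply/negP => h; apply: nK; exists t.
  split; last first.
    by move=> s s0; have [t t0 st] := lrg s; apply: (surj t) => //; rewrite s0 ltW.
  apply/eqP; rewrite eq_le !leNgt; apply/andP; split; apply/negP => C0.
    (* Beyond this threshold the polynomial exceeds [C / 2] times [sigma^2], so [- 1 / sigma] grows
       at a rate of at least [c C / 2]. *)
    have [T T0 sT] := lrg (2 * `|B| / C + 1).
    have T0' u : T <= u -> 0 <= u by exact: le_trans.
    have sT0 u : T <= u -> 2 * `|B| / C + 1 < sigma u.
      by move=> Tu; apply: lt_le_trans sT _; exact: incr.
    have B0 : 0 <= 2 * `|B| / C by rewrite divr_ge0 ?mulr_ge0 // ltW.
    have su0 u : T <= u -> 0 < sigma u.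
      by move=> /sT0; apply: le_lt_trans; rewrite addr_ge0.
    pose g (u : R) := - (sigma u)^-1.
    have dg (u : R) : T <= u -> is_derive u 1 g
        (c * (A + B * sigma u + C * sigma u ^+ 2) / sigma u ^+ 2).
      move=> Tu; have [[d1 e1] _] := dsig u (T0' u Tu).
      have s0 : sigma u != 0 by rewrite gt_eqF // su0.
      have dv : is_derive u 1 (fun t => (sigma t)^-1)
          (- (sigma u) ^- 2 *: (c * (A + B * sigma u + C * sigma u ^+ 2))).
        by apply: DeriveDef; [exact: derivableV|rewrite (deriveV s0 d1) e1].
      apply: (is_derive_eq (is_deriveN dv)).
      by rewrite /GRing.scale /= mulNr opprK mulrC.
    have cC : 0 < c * C / 2 by rewrite divr_gt0 // mulr_gt0.
    have gT u : T <= u -> c * C / 2 <= c * (A + B * sigma u + C * sigma u ^+ 2) / sigma u ^+ 2.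
      move=> Tu; rewrite ler_pdivlMr ?exprn_gt0 ?su0 // -!mulrA ler_pM2l //.
      have s0 := su0 u Tu; have := sT0 u Tu; rewrite -ltrBrDr ltr_pdivrMr // => h.
      have h2 : `|B| <= (sigma u - 1) * C / 2 by lra.
      have h3 : - (`|B| * sigma u) <= B * sigma u.
        by rewrite -mulNr ler_wpM2r ?(ltW s0) // lerNl -normrN ler_norm.
      have h4 : `|B| * sigma u <= (sigma u - 1) * C / 2 * sigma u by rewrite ler_wpM2r // ltW.
      have h5 : 0 < C * sigma u by rewrite mulr_gt0.
      rewrite expr2; nra.
    (* The time after which this growth would have raised [- 1 / sigma] to zero. *)
    pose tau := (sigma T)^-1 / (c * C / 2).
    have tau0 : 0 < tau by rewrite divr_gt0 // invr_gt0 su0.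
    have TT' : T <= T + tau by rewrite lerDl ltW.
    have : (c * C / 2) * (T + tau - T) <= g (T + tau) - g T.
      apply: (derive_ge_growth TT') => t /andP[Tt _]; first exact: (dg t Tt).
      exact: gT.
    rewrite addrAC subrr add0r /tau mulrC divfK ?gt_eqF // /g opprK lerDr oppr_ge0.
    by rewrite invr_le0 leNgt su0.
  have [t t0 st] := lrg (`|B| / - C + A / - C + 1).
  have [_] := dsig t t0; apply/negP; rewrite -leNgt.
  have nC : 0 < - C by rewrite oppr_gt0.
  have B0 : 0 <= `|B| / - C by rewrite divr_ge0 // ltW.
  have A0' : 0 < A / - C by rewrite divr_gt0.
  have st1 : 1 < sigma t by lra.
  have h1 : (`|B| + A - C) < sigma t * (- C).
    rewrite -ltr_pdivrMr // !mulrDl divff; lra.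
  have h2 : B * sigma t <= `|B| * sigma t by rewrite ler_wpM2r ?ler_norm //; lra.
  have h3 : (`|B| + A - C) * sigma t <= sigma t * (- C) * sigma t.
    by rewrite ler_wpM2r // ltW //; lra.
  rewrite expr2; nra.
Qed.

End quadratic_flow.

(** Both bounds are used: positivity excludes a negative leading coefficient and the affine majorant
    a positive one. *)
Lemma quadratic_le_affine {R : realType} (a b c d e : R) :
  (forall s, 0 <= s -> 0 < a + b * s + c * s ^+ 2 <= d + e * s) -> c = 0.
Proof.
move=> h; apply/eqP; apply: contraT => c0.
pose K := `|a| + `|b| + `|d| + `|e|.
have K0 : 0 <= K by rewrite !addr_ge0.
have c1 : 0 < `|c| by rewrite normr_gt0.
pose s := K / `|c| + 1.
have s1 : 1 <= s by rewrite lerDr divr_ge0.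
have /andP[h1 h2] := h s (le_trans ler01 s1).
have cs : `|c| * s = K + `|c| by rewrite mulrDr mulr1 mulrC divfK // gt_eqF.
have ha := ler_norm a; have ha' := ler_norm (- a); have hb := ler_norm b; have hb' := ler_norm (- b).
have hd := ler_norm d; have he := ler_norm e.
have hd' := normr_ge0 d; have ha0 := normr_ge0 a; have hb0 := normr_ge0 b; have he0 := normr_ge0 e.
rewrite normrN in ha'; rewrite normrN in hb'.
have s0 : 0 < s by apply: lt_le_trans s1.
have s0' := ltW s0.
have e1 : `|d| <= `|d| * s by rewrite ler_peMr.
have e2 : `|a| <= `|a| * s by rewrite ler_peMr.
have e3 : e * s <= `|e| * s by apply: ler_wpM2r.
have e4 : - b * s <= `|b| * s by apply: ler_wpM2r.
have e5 : b * s <= `|b| * s by apply: ler_wpM2r.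
have cs2 : `|c| * s ^+ 2 = K * s + `|c| * s by rewrite expr2 mulrA {1}cs mulrDl.
have csp : 0 < `|c| * s by rewrite mulr_gt0.
rewrite /K !mulrDl in cs2.
have [cp|cn] := leP 0 c.
  by rewrite (ger0_norm cp) in cs2 csp; lra.
by rewrite (ltr0_norm cn) in cs2 csp; lra.
Qed.

(** * Behaviour at the two ends of a line *)

Section ray_ends.
Context {R : realType} {n : nat}.
Context (Omega : set 'rV[R]_n) (F : 'rV[R]_n -> 'rV[R]_n -> R).
Context (Omega_open : open Omega) (finslerF : finsler_metric Omega F).
Context (flat : projectively_flat Omega F).

(* The two ways in which the ray from [x] in the direction [y] can have infinite
   length when [1 / F (x + s y, y) = A + B s + C s^2]. *)
Definition ray_end (x y : 'rV[R]_n) (A B C : R) : Prop :=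
  (exists s1, [/\ 0 < s1, A + B * s1 + C * s1 ^+ 2 = 0 &
     forall s, 0 <= s < s1 -> Omega (x + s *: y)]) \/
  (C = 0 /\ forall s, 0 <= s -> Omega (x + s *: y)).

Definition quadratic_on_line (x y : 'rV[R]_n) (B C : R) : Prop :=
  forall s, Omega (x + s *: y) -> F (x + s *: y) y * ((F x y)^-1 + B * s + C * s ^+ 2) = 1.

Lemma quadratic_on_line_gt0 x y B C s : y != 0 -> quadratic_on_line x y B C ->
  Omega (x + s *: y) -> 0 < (F x y)^-1 + B * s + C * s ^+ 2.
Proof.
move=> y0 q Os; rewrite -(pmulr_rgt0 _ (metric_gt0 finslerF Os y0)).
by rewrite q // ltr01.
Qed.

Lemma forward_ray_end x y B C : forward_complete Omega F -> Omega x -> y != 0 ->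
  quadratic_on_line x y B C -> ray_end x y (F x y)^-1 B C.
Proof.
move=> fc Ox y0 q.
have [d d0 [gamma [geo g0 g1]]] := geodesic_local_existence Omega_open finslerF Ox y0.
have [|G geoG Gg] := fc _ _ gamma _ geo; first by rewrite lte_fin; lra.
have t00 : (((- d)%:E < 0%:E < d%:E)%E) by rewrite !lte_fin oppr_lt0 d0.
have t0y : (((- d)%:E < 0%:E < (+oo : \bar R))%E).  by apply/andP; split; [rewrite lte_fin oppr_lt0|exact: ltry].
have G0 : G 0 = x by rewrite Gg.
have G1 : derive1 G 0 = y.
  rewrite -g1 !derive1E; apply: near_eq_derive.
  by apply: filterS (ereal_itv_near t00) => t; exact: Gg.
have [_ [sg [sg0 sgE dsg]]] := geodesic_line finslerF flat geoG t0y.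
rewrite G0 G1 in sgE dsg.
have ty (t : R) : 0 <= t -> ((- d)%:E < t%:E < (+oo : \bar R))%E.
  by move=> t0; apply/andP; split; [rewrite lte_fin (lt_le_trans _ t0) // oppr_lt0|exact: ltry].
have OG t : 0 <= t -> Omega (x + sg t *: y).
  by move=> t0; rewrite -sgE ?ty //; have [_ /(_ t (ty t t0))[]] := geoG.
have [||t t0|[s1 [s10 qs1 hs]]|[C0 hs]] := @quadratic_flow_end R (F x y)^-1 B C (F x y) sg.
- exact: (metric_gt0 finslerF).
- exact: sg0.
- split; last exact: quadratic_on_line_gt0 (OG t t0).
  (* The parameter moves at speed [F (x, y) / F (., y)], and the reciprocal of the denominator is
     the value of the quadratic. *)
  apply: (is_derive_eq (dsg t (ty t t0))).
  rewrite (sgE t (ty t t0)); congr (_ * _).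
  have F0 : F (x + sg t *: y) y != 0 by rewrite gt_eqF // (metric_gt0 finslerF (OG t t0) y0).
  by apply: (mulfI F0); rewrite divff // (q _ (OG t t0)).
- left; exists s1; split=> // s ss1; have [t t0 <-] := hs s ss1; exact: OG.
- by right; split=> // s s0; have [t t0 <-] := hs s s0; exact: OG.
Qed.

(** A geodesic in the direction [y] run backwards moves along [- y], but its speed is still governed
    by [1 / F (., y)]: hence the quadratic of [y] with [B] negated, not the quadratic of [- y]. *)
Lemma backward_ray_end x y B C : backward_complete Omega F -> Omega x -> y != 0 ->
  quadratic_on_line x y B C -> ray_end x (- y) (F x y)^-1 (- B) C.
Proof.
move=> bc Ox y0 q.
have [d d0 [gamma [geo g0 g1]]] := geodesic_local_existence Omega_open finslerF Ox y0.
have [|G geoG Gg] := bc _ _ gamma _ geo; first by rewrite lte_fin; lra.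
have t00 : (((- d)%:E < 0%:E < d%:E)%E) by rewrite !lte_fin oppr_lt0 d0.
have t0y : (((-oo : \bar R) < 0%:E < d%:E)%E) by apply/andP; split; [exact: ltNyr|rewrite lte_fin].
have G0 : G 0 = x by rewrite Gg.
have G1 : derive1 G 0 = y.
  rewrite -g1 !derive1E; apply: near_eq_derive.
  by apply: filterS (ereal_itv_near t00) => t; exact: Gg.
have [_ [sg [sg0 sgE dsg]]] := geodesic_line finslerF flat geoG t0y.
rewrite G0 G1 in sgE dsg.
have ty (t : R) : 0 <= t -> (((-oo : \bar R) < (- t)%:E < d%:E)%E).
  by move=> t0; apply/andP; split; [exact: ltNyr|rewrite lte_fin (le_lt_trans _ d0) // oppr_le0].
have OG t : 0 <= t -> Omega (x + sg (- t) *: y).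
  by move=> t0; rewrite -sgE ?ty //; have [_ /(_ (- t) (ty t t0))[]] := geoG.
have rev t : x + - sg (- t) *: - y = x + sg (- t) *: y by rewrite scalerN scaleNr opprK.
have qrev t : (F x y)^-1 + - B * - sg (- t) + C * (- sg (- t)) ^+ 2 =
    (F x y)^-1 + B * sg (- t) + C * sg (- t) ^+ 2 by rewrite mulrNN sqrrN.
have [||t t0|[s1 [s10 qs1 hs]]|[C0 hs]] :=
    @quadratic_flow_end R (F x y)^-1 (- B) C (F x y) (fun t => - sg (- t)).
- exact: (metric_gt0 finslerF).
- by rewrite oppr0 sg0 oppr0.
- rewrite qrev; split; last exact: quadratic_on_line_gt0 (OG t t0).
  have h := is_deriveN (is_derive1_comp (dsg (- t) (ty t t0)) (is_deriveNid t 1)).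
  apply: (is_derive_eq h).
  rewrite (sgE (- t) (ty t t0)) mulrN1 opprK; congr (_ * _).
  have F0 : F (x + sg (- t) *: y) y != 0 by rewrite gt_eqF // (metric_gt0 finslerF (OG t t0) y0).
  by apply: (mulfI F0); rewrite divff // (q _ (OG t t0)).
- left; exists s1; split=> // s ss1; have [t t0 <-] := hs s ss1; rewrite rev; exact: OG.
- by right; split=> // s s0; have [t t0 <-] := hs s s0; rewrite rev; exact: OG.
Qed.

(** Finite reversibility bounds the quadratic of [y] by [L] times that of [- y] on the chord. A zero
    of the latter at the end of the ray is then a zero of the former, and if the latter is affine on
    a full ray, so is the former. *)
Lemma reversible_ray_end x y (L B C B' C' : R) : Omega x -> y != 0 ->
  (forall z w, Omega z -> w != 0 -> F z (- w) <= L * F z w) ->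
  quadratic_on_line x y B C -> quadratic_on_line x (- y) B' C' ->
  ray_end x (- y) (F x (- y))^-1 B' C' -> ray_end x (- y) (F x y)^-1 (- B) C.
Proof.
move=> Ox y0 hL q q'.
have ny0 : - y != 0 by rewrite oppr_eq0.
pose p s := (F x (- y))^-1 + B' * s + C' * s ^+ 2.
pose r s := (F x y)^-1 + - B * s + C * s ^+ 2.
have cmp s : Omega (x + s *: - y) -> [/\ 0 < r s & r s <= L * p s].
  move=> Os; have Os' : Omega (x + - s *: y) by rewrite scaleNr -scalerN.
  have rE : r s = (F x y)^-1 + B * - s + C * (- s) ^+ 2 by rewrite /r sqrrN mulrN mulNr.
  have r0 : 0 < r s by rewrite rE; exact: quadratic_on_line_gt0 Os'.
  have p0 : 0 < p s by exact: quadratic_on_line_gt0 Os.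
  split=> //.
  have h1 := q _ Os'; rewrite -rE in h1; have h2 := q' _ Os; rewrite -/(p s) in h2.
  have h : F (x + s *: - y) (- y) <= L * F (x + - s *: y) y.
    by rewrite scalerN -scaleNr; exact: hL.
  have h3 := ler_wpM2r (ltW (mulr_gt0 p0 r0)) h.
  rewrite mulrA h2 mul1r in h3.
  suff <- : L * F (x + - s *: y) y * (p s * r s) = L * p s by [].
  by rewrite mulrACA h1 mulr1.
move=> [[s1 [s10 ps1 hs]]|[C0 hs]].
  left; exists s1; split=> //.
  (* A strict sign at [s1] persists slightly before [s1], at a point [u] whose image is still in
     [Omega]; there it contradicts one of the two bounds in [cmp]. *)
  apply/eqP; rewrite eq_le !leNgt; apply/andP; split; apply/negP => rs1.
    have : 0 < ((F x y)^-1 - L * (F x (- y))^-1) + (- B - L * B') * s1 + (C - L * C') * s1 ^+ 2.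
      have : L * p s1 = 0 by rewrite /p ps1 mulr0.
      by rewrite /p; move: rs1; rewrite -/(r s1) /r; lra.
    move=> /quadratic_pos_near[d [m [d0 m0 hm]]].
    pose u := Num.max (s1 / 2) (s1 - d / 2).
    have us : 0 <= u < s1.
      by rewrite /u le_max gt_max divr_ge0 ?(ltW s10) //=; apply/andP; split; lra.
    have ud : `|u - s1| < d.
      case/andP: us => _ us; rewrite ltr0_norm ?subr_lt0 // opprB.
      have : s1 - d / 2 <= u by rewrite le_max lexx orbT.
      lra.
    have [_] := cmp u (hs u us); have := hm u ud; rewrite /r /p; lra.
  have : 0 < - (F x y)^-1 + B * s1 + (- C) * s1 ^+ 2.
    by move: rs1; rewrite -/(r s1) /r; lra.
  move=> /quadratic_pos_near[d [m [d0 m0 hm]]].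
  pose u := Num.max (s1 / 2) (s1 - d / 2).
  have us : 0 <= u < s1.
    by rewrite /u le_max gt_max divr_ge0 ?(ltW s10) //=; apply/andP; split; lra.
  have ud : `|u - s1| < d.
    case/andP: us => _ us; rewrite ltr0_norm ?subr_lt0 // opprB.
    have : s1 - d / 2 <= u by rewrite le_max lexx orbT.
    lra.
  have [+ _] := cmp u (hs u us); have := hm u ud; rewrite /r; lra.
right; split=> //; apply: (@quadratic_le_affine _ (F x y)^-1 (- B) C (L * (F x (- y))^-1) (L * B')).
move=> s s0; have [r0 rp] := cmp s (hs s s0); rewrite -/(r s) r0 /=.
by move: rp; rewrite /p C0; lra.
Qed.

(** Each polynomial is positive as long as the ray is in [Omega], and the ray is in [Omega] before a
    zero given by [ray_end]; so neither zero can precede the other. *)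
Lemma ray_end_agree x y A1 B1 C1 A2 B2 C2 :
  (forall s, Omega (x + s *: y) -> 0 < A1 + B1 * s + C1 * s ^+ 2) ->
  (forall s, Omega (x + s *: y) -> 0 < A2 + B2 * s + C2 * s ^+ 2) ->
  ray_end x y A1 B1 C1 -> ray_end x y A2 B2 C2 ->
  (exists s1, [/\ 0 < s1, A1 + B1 * s1 + C1 * s1 ^+ 2 = 0 & A2 + B2 * s1 + C2 * s1 ^+ 2 = 0]) \/
  [/\ C1 = 0, C2 = 0 & forall s, 0 <= s -> Omega (x + s *: y)].
Proof.
move=> q1 q2 [[s1 [s10 qs1 h1]]|[C10 h1]] [[s2 [s20 qs2 h2]]|[C20 h2]].
- left; exists s1; split=> //.
  have [s12|s21|->//] := ltgtP s1 s2.
    have := q1 s1 (h2 s1 _); rewrite qs1 ltxx (ltW s10) s12; by move/(_ erefl).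
  have := q2 s2 (h1 s2 _); rewrite qs2 ltxx (ltW s20) s21; by move/(_ erefl).
- by have := q1 s1 (h2 s1 (ltW s10)); rewrite qs1 ltxx.
- by have := q2 s2 (h1 s2 (ltW s20)); rewrite qs2 ltxx.
- by right.
Qed.

Lemma line_dichotomy (kappa : R) x y B C B' C' : Omega x -> y != 0 ->
  B ^+ 2 - 4 * (F x y)^-1 * C = - 4 * kappa ->
  B' ^+ 2 - 4 * (F x (- y))^-1 * C' = - 4 * kappa ->
  quadratic_on_line x y B C -> quadratic_on_line x (- y) B' C' ->
  ray_end x y (F x y)^-1 B C -> ray_end x (- y) (F x y)^-1 (- B) C ->
  ray_end x (- y) (F x (- y))^-1 B' C' -> ray_end x y (F x (- y))^-1 (- B') C' ->
  kappa < 0 /\ F x (- y) = F x y \/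
  kappa = 0 /\ forall s, Omega (x + s *: y) /\ F (x + s *: y) y = F x y.
Proof.
move=> Ox y0 disc disc' q q' R1 R2 R3 R4.
have ny0 : - y != 0 by rewrite oppr_eq0.
have A0 : 0 < (F x y)^-1 by rewrite invr_gt0 (metric_gt0 finslerF).
have A0' : 0 < (F x (- y))^-1 by rewrite invr_gt0 (metric_gt0 finslerF).
have q1 s : Omega (x + s *: y) -> 0 < (F x y)^-1 + B * s + C * s ^+ 2.
  exact: quadratic_on_line_gt0.
have q3 s : Omega (x + s *: - y) -> 0 < (F x (- y))^-1 + B' * s + C' * s ^+ 2.
  exact: quadratic_on_line_gt0.
have q2 s : Omega (x + s *: - y) -> 0 < (F x y)^-1 + - B * s + C * s ^+ 2.
  move=> Os; have /q1 : Omega (x + - s *: y) by rewrite scaleNr -scalerN.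
  by rewrite sqrrN mulrN mulNr.
have q4 s : Omega (x + s *: y) -> 0 < (F x (- y))^-1 + - B' * s + C' * s ^+ 2.
  move=> Os; have /q3 : Omega (x + - s *: - y) by rewrite scaleNr scalerN opprK.
  by rewrite sqrrN mulrN mulNr.
have symm : kappa < 0 -> (F x y)^-1 = (F x (- y))^-1 ->
    kappa < 0 /\ F x (- y) = F x y \/
    kappa = 0 /\ forall s, Omega (x + s *: y) /\ F (x + s *: y) y = F x y.
  by move=> k0 /invr_inj ->; left.
(* [R1] and [R4] describe the same end as seen by the polynomials of [y] and of [- y]; so do [R2]
   and [R3] for the other end. *)
move: (ray_end_agree q1 q4 R1 R4) (ray_end_agree q2 q3 R2 R3).
move: symm q A0 A0' disc disc'; rewrite /quadratic_on_line.
set A := (F x y)^-1; set A' := (F x (- y))^-1 => symm q A0 A0' disc disc'.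
case=> [[s1 [s10 e1 e4]]|[C0 C0' O1]] [[s2 [s20 e2 e3]]|[D0 D0' O2]].
(* Two finite ends: both polynomials vanish at [s1] and at [- s2], hence are proportional, and equal
   discriminants together with negative leading coefficients make them equal. *)
- have s12 : 0 < s1 + s2 by rewrite addr_gt0.
  have AC : A = - C * s1 * s2.
    apply: (mulIf (lt0r_neq0 s12)); move: e1 e2; rewrite !expr2 => e1 e2.
    have : (A + B * s1 + C * (s1 * s1)) * s2 + (A + - B * s2 + C * (s2 * s2)) * s1 = 0.
      by rewrite e1 e2 !mul0r addr0.
    lra.
  have AC' : A' = - C' * s1 * s2.
    apply: (mulIf (lt0r_neq0 s12)); move: e3 e4; rewrite !expr2 => e3 e4.
    have : (A' + - B' * s1 + C' * (s1 * s1)) * s2 + (A' + B' * s2 + C' * (s2 * s2)) * s1 = 0.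
      by rewrite e3 e4 !mul0r addr0.
    lra.
  have BC : B = - C * (s1 - s2).
    apply: (mulIf (lt0r_neq0 s12)); move: e1 e2; rewrite !expr2; lra.
  have BC' : B' = C' * (s1 - s2).
    apply: (mulIf (lt0r_neq0 s12)); move: e3 e4; rewrite !expr2; lra.
  have dC : C ^+ 2 * (s1 + s2) ^+ 2 = - 4 * kappa by rewrite -disc AC BC; ring.
  have dC' : C' ^+ 2 * (s1 + s2) ^+ 2 = - 4 * kappa by rewrite -disc' AC' BC'; ring.
  have ss : 0 < s1 * s2 by rewrite mulr_gt0.
  have Cn : C < 0 by rewrite -oppr_gt0 -(pmulr_lgt0 _ ss) mulrA -AC.
  have Cn' : C' < 0 by rewrite -oppr_gt0 -(pmulr_lgt0 _ ss) mulrA -AC'.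
  have /eqP : C ^+ 2 == C' ^+ 2.
    rewrite -(inj_eq (mulIf (lt0r_neq0 (exprn_gt0 2 s12)))) dC dC'; exact: eqxx.
  rewrite -sqrrN -[RHS]sqrrN => /eqP; rewrite eqrXn2 ?oppr_ge0 ?(ltW Cn) ?(ltW Cn') //.
  move=> /eqP /oppr_inj CC; apply: symm; last by rewrite AC AC' CC.
  have C2 : 0 < C ^+ 2 by rewrite -sqrrN exprn_gt0 // oppr_gt0.
  have : 0 < C ^+ 2 * (s1 + s2) ^+ 2 by rewrite mulr_gt0 // exprn_gt0.
  rewrite dC; lra.
(* One finite end: both polynomials are affine with the same zero, and their slopes have the same
   square [- 4 kappa]. *)
- rewrite D0 D0' !mul0r !addr0 !mulr0 !subr0 in e1 e4 disc disc'.
  have BA : B * s1 = - A by lra.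
  have BA' : B' * s1 = A' by lra.
  have Bn : B < 0 by rewrite -(pmulr_llt0 _ s10) BA oppr_lt0.
  have Bp : 0 < B' by rewrite -(pmulr_lgt0 _ s10) BA'.
  have /eqP : (- B) ^+ 2 == B' ^+ 2 by rewrite sqrrN disc disc'.
  move=> /eqP; rewrite eqrXn2 ?oppr_ge0 ?(ltW Bn) ?(ltW Bp) // => /eqP BB.
  apply: symm; last by rewrite -BA' -BB mulNr BA opprK.
  have : 0 < B' ^+ 2 by rewrite exprn_gt0.
  rewrite disc'; lra.
- rewrite C0 C0' !mul0r !addr0 !mulr0 !subr0 in e2 e3 disc disc'.
  have BA : B * s2 = A by lra.
  have BA' : B' * s2 = - A' by lra.
  have Bp : 0 < B by rewrite -(pmulr_lgt0 _ s20) BA.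
  have Bn : B' < 0 by rewrite -(pmulr_llt0 _ s20) BA' oppr_lt0.
  have /eqP : B ^+ 2 == (- B') ^+ 2 by rewrite sqrrN disc disc'.
  move=> /eqP; rewrite eqrXn2 ?oppr_ge0 ?(ltW Bn) ?(ltW Bp) // => /eqP BB.
  apply: symm; last by rewrite -BA BB mulNr BA' opprK.
  have : 0 < B ^+ 2 by rewrite exprn_gt0.
  rewrite disc; lra.
(* No finite end: the whole line lies in [Omega], and an affine function that is positive everywhere
   is constant. *)
- have Oall s : Omega (x + s *: y).
    have [/O1//|/ltW s0] := leP 0 s.
    by have := O2 (- s); rewrite oppr_ge0 scaleNr scalerN opprK; apply.
  have B0 : B = 0.
    apply/eqP; apply: contraT => B0.
    have := q1 (- 2 * A / B) (Oall _); rewrite C0 mul0r addr0 -/A mulrC divfK //; lra.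
  right; split; first by move: disc; rewrite B0 C0 expr0n /=; lra.
  move=> s; split=> //; have := q s (Oall s); rewrite B0 C0 !mul0r !addr0 => FA.
  by rewrite -[RHS]mul1r -FA -mulrA mulVf ?mulr1 // gt_eqF // (metric_gt0 finslerF).
Qed.

End ray_ends.

(** * Reversible metrics: reversal of geodesics *)

Section energy_parity.
Context {R : realType} {n : nat}.
Context (Omega : set 'rV[R]_n) (F : 'rV[R]_n -> 'rV[R]_n -> R).
Context (Omega_open : open Omega) (finslerF : finsler_metric Omega F).

Notation e := (delta_mx ord0 : 'I_n -> 'rV[R]_n).
Notation E := (energy F).
Notation U := (slit_tangent Omega).

Lemma derive_comp_opp (V : normedModType R) (f : V -> R) (v y : V) : differentiable f (- y) ->
  'D_v (fun z => f (- z)) y = - 'D_v f (- y).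
Proof.
move=> df; have dl : is_derive (0 : R) 1 (fun s : R => f (- y + s *: - v)) ('D_(- v) f (- y)).
  by have := @is_derive_line R V f (- y) (- v) 0; rewrite scale0r addr0; apply.
rewrite -[RHS]/(- _) -(_ : 'D_(- v) f (- y) = - 'D_v f (- y)); last by rewrite !deriveE // linearN.
rewrite -(@derive_val _ _ _ _ _ _ _ dl) /derive.
have -> : (fun h : R => h^-1 *: (((fun s : R => f (- y + s *: - v)) \o shift 0) (h *: 1) -
    f (- y + 0 *: - v))) = (fun h : R => h^-1 *: (((fun z => f (- z)) \o shift y) (h *: v) - f (- y))).
  apply/funext => h; rewrite /= /shift /= addr0 scale0r addr0 opprD scalerN [h%:A]mulr1.
  by rewrite [- y - _]addrC.
by [].
Qed.

Context (sym : forall x y, Omega x -> y != 0 -> F x (- y) = F x y).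

Lemma energy_even x y : Omega x -> E (x, - y) = E (x, y).
Proof.
move=> Ox; rewrite /energy /=; have [->|y0] := eqVneq y 0; first by rewrite oppr0.
by rewrite sym.
Qed.

Lemma slit_tangent_opp x y : U (x, y) -> U (x, - y).
Proof. by move=> [/= Ox y0]; split => //=; rewrite oppr_eq0. Qed.

Lemma derive_energy1_even v x y : U (x, y) -> 'D_(v, 0) E (x, - y) = 'D_(v, 0) E (x, y).
Proof.
move=> [/= Ox _]; rewrite -!(@derive_slice1 R _ _ E).
by apply: (derive_near (U := Omega)) => // w; rewrite inE; exact: energy_even.
Qed.

Lemma derive_energy2_odd v x y : U (x, y) -> 'D_(0, v) E (x, - y) = - 'D_(0, v) E (x, y).
Proof.
move=> Uxy; have [/= Ox _] := Uxy.
have dE := differentiable_slice2 (energy_differentiable finslerF (slit_tangent_opp Uxy)).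
rewrite -!(@derive_slice2 R _ _ E) -(opprK ('D_v _ (- y))) -(derive_comp_opp v dE).
by congr (- _); congr ('D_v _ y); apply/funext => z; exact: energy_even.
Qed.

Lemma derive_energy21_odd u v x y : U (x, y) ->
  'D_(0, u) ('D_(v, 0) E) (x, - y) = - 'D_(0, u) ('D_(v, 0) E) (x, y).
Proof.
move=> Uxy; have Uxy' := slit_tangent_opp Uxy.
have dE := derive_energy_diff2 Omega_open finslerF (v, 0) Uxy'.
have h1 := @derive_slice2 R _ _ ('D_(v, 0) E) x (- y) u.
have h2 := @derive_slice2 R _ _ ('D_(v, 0) E) x y u.
have h3 := derive_comp_opp u dE.
have h4 : 'D_u (fun z => 'D_(v, 0) E (x, - z)) y = 'D_u (fun z => 'D_(v, 0) E (x, z)) y.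
  apply: near_eq_derive.
  by apply: filterS (near_slit2 Omega_open Uxy) => z Uxz; exact: derive_energy1_even.
exact: etrans (esym h1) (etrans (esym (opprK _)) (f_equal (fun a => - a)
  (etrans (esym h3) (etrans h4 h2)))).
Qed.

Lemma derive_energy22_even u v x y : U (x, y) ->
  'D_(0, u) ('D_(0, v) E) (x, - y) = 'D_(0, u) ('D_(0, v) E) (x, y).
Proof.
move=> Uxy; have Uxy' := slit_tangent_opp Uxy.
have dE := derive_energy_diff2 Omega_open finslerF (0, v) Uxy'.
have dE' := derive_energy_diff2 Omega_open finslerF (0, v) Uxy.
have h1 := @derive_slice2 R _ _ ('D_(0, v) E) x (- y) u.
have h2 := @derive_slice2 R _ _ ('D_(0, v) E) x y u.
have h3 := derive_comp_opp u dE.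
have h4 : 'D_u (fun z => 'D_(0, v) E (x, - z)) y = 'D_u (- (fun z => 'D_(0, v) E (x, z))) y.
  apply: near_eq_derive.
  by apply: filterS (near_slit2 Omega_open Uxy) => z Uxz; exact: derive_energy2_odd.
have h5 := deriveN (@diff_derivable _ _ _ _ _ u dE').
have h3' : 'D_u (fun z => 'D_(0, v) E (x, - z)) y = - 'D_u (fun z => 'D_(0, v) E (x, z)) (- y).
  exact: h3.
have h5' : 'D_u (- (fun z => 'D_(0, v) E (x, z))) y = - 'D_u (fun z => 'D_(0, v) E (x, z)) y.
  exact: h5.
have aux (a1 a2 b1 b2 c d : R) : b1 = a1 -> b2 = a2 -> c = - b1 -> c = d -> d = - b2 -> a1 = a2.
  by move=> <- <- cb cd db; apply: oppr_inj; rewrite -cb -db.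
exact: aux h1 h2 h3' h4 h5'.
Qed.

(** Derivatives of the even energy have a parity in [y] given by the number of fibre derivatives.
    The Hessian is even, and in the force the odd mixed derivatives are multiplied by the odd factor
    [y]. *)
Lemma spray_even x y : U (x, y) -> spray F x (- y) = spray F x y.
Proof.
move=> Uxy; rewrite !sprayE.
have -> : fundamental_tensor F x (- y) = fundamental_tensor F x y.
  apply: (f_equal (fun A => 2^-1 *: A)); apply/matrixP => i j.
  exact: etrans (hessian_energy F x (- y) i j)
    (etrans (derive_energy22_even (e j) (e i) Uxy) (esym (hessian_energy F x y i j))).
have -> : spray_force F x (- y) = spray_force F x y.
  apply/rowP => j; rewrite [LHS]mxE [RHS]mxE (derive_energy1_even (e j) Uxy).
  apply: (f_equal (fun a => a - _)); apply: eq_bigr => k _.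
  by rewrite (derive_energy21_odd (e j) (e k) Uxy) mxE mulrNN.
by [].
Qed.

Lemma is_derive_reverse m (g : R -> 'rV[R]_m) (t : R) (v : 'rV[R]_m) :
  is_derive (- t) 1 g v -> is_derive t 1 (fun t => g (- t)) (- v).
Proof.
move=> dg; apply: is_derive_rV => i.
have := is_derive1_comp (is_derive_rV_coord i dg) (is_deriveNid t 1).
by rewrite mulrN1 mxE.
Qed.

(** The acceleration is unchanged under reversal of time and the spray is even, so the equation is
    preserved; so is the speed. *)
Lemma geodesic_reverse (a b : \bar R) gamma : geodesic Omega F a b gamma ->
  geodesic Omega F (- b)%E (- a)%E (fun t => gamma (- t)).
Proof.
move=> [[c c0 speed] geo].
have tab t : (- b < t%:E < - a)%E -> (a < (- t)%:E < b)%E.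
  by rewrite EFinN lteNl lteNr andbC.
have d1 t : (- b < t%:E < - a)%E ->
    is_derive t 1 (fun t => gamma (- t)) (- derive1 gamma (- t)).
  move=> /tab /geo[_ dg _ _]; apply: is_derive_reverse.
  by apply: DeriveDef; [exact: dg|rewrite derive1E].
have d1E t : (- b < t%:E < - a)%E -> derive1 (fun t => gamma (- t)) t = - derive1 gamma (- t).
  by move=> /d1[_ <-]; rewrite derive1E.
have nz t : (- b < t%:E < - a)%E -> derive1 gamma (- t) != 0.
  move=> /tab tb; apply/eqP => g0; have := speed _ tb; rewrite g0.
  have [Og _ _ _] := geo _ tb.
  have -> : F (gamma (- t)) 0 = 0.
    by case: finslerF => _ /(_ _ Og)[_ /(_ 0)[_ +] _ _ _]; apply.
  by move=> c00; rewrite -c00 ltxx in c0.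
have d2 t : (- b < t%:E < - a)%E ->
    is_derive t 1 (derive1 (fun t => gamma (- t))) (derive1 (derive1 gamma) (- t)).
  move=> tb; apply: (@near_eq_is_derive _ _ _ (fun t => - derive1 gamma (- t))).
    by apply: filterS (ereal_itv_near tb) => s /d1E.
  have [_ _ dg _] := geo _ (tab _ tb).
  have := is_deriveN (is_derive_reverse (t := t) (DeriveDef dg erefl)).
  by rewrite opprK derive1E.
split.
  exists c => // t tb; rewrite d1E // sym; first exact/speed/tab.
    by have [] := geo _ (tab _ tb).
  exact: nz.
move=> t tb; have [Og dg1 dg2 eq] := geo _ (tab _ tb); split.
- exact: Og.
- by have [] := d1 t tb.
- by have [] := d2 t tb.
- have Ut : U (gamma (- t), derive1 gamma (- t)) by split => //; exact: nz.
  by have [_ h] := d2 t tb; rewrite derive1E h (d1E t tb) (spray_even Ut).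
Qed.

Lemma symmetric_backward_complete : forward_complete Omega F -> backward_complete Omega F.
Proof.
move=> fc a b gamma ab /geodesic_reverse geo.
have [|G geoG Gg] := fc _ _ _ _ geo; first by rewrite lteN2.
exists (fun t => G (- t)); first by have := geodesic_reverse geoG; rewrite /= oppeK.
by move=> t tab; rewrite Gg ?opprK // EFinN !lteN2 andbC.
Qed.

End energy_parity.

(** * Metrics that are constant along lines *)

Section flat_case.
Context {R : realType} {n : nat}.
Context (Omega : set 'rV[R]_n) (F : 'rV[R]_n -> 'rV[R]_n -> R).
Context (Omega_open : open Omega) (finslerF : finsler_metric Omega F).
Context (flat : projectively_flat Omega F).
Context (line : forall x y s, Omega x -> y != 0 -> Omega (x + s *: y) /\ F (x + s *: y) y = F x y).

Notation e := (delta_mx ord0 : 'I_n -> 'rV[R]_n).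
Notation E := (energy F).
Notation U := (slit_tangent Omega).

Lemma flat_geodesic (a b : \bar R) gamma (t0 t : R) : geodesic Omega F a b gamma ->
  (a < t0%:E < b)%E -> (a < t%:E < b)%E ->
  gamma t = gamma t0 + (t - t0) *: derive1 gamma t0.
Proof.
move=> geo t0ab tab.
have [y0 [sg [sg0 sgE dsg]]] := geodesic_line finslerF flat geo t0ab.
have Ot0 : Omega (gamma t0) by have [_ /(_ _ t0ab)[]] := geo.
have dsg1 u : (a < u%:E < b)%E -> is_derive u 1 (sg - id) 0.
  move=> uab; have h := is_deriveB (dsg u uab) (is_derive_id u 1).
  apply: (is_derive_eq h); have [_ FE] := line (sg u) Ot0 y0.
  by rewrite (sgE u uab) FE divff ?subrr // gt_eqF // (metric_gt0 finslerF Ot0 y0).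
have sgt : sg t = t - t0.
  have : (sg - id) t = (sg - id) t0.
    have [tt0|/ltW tt0] := leP t t0.
      apply: (derive0_const tt0) => u ut; apply: dsg1.
      exact: (ereal_itv_between tab t0ab).
    apply/esym; apply: (derive0_const tt0) => u ut; apply: dsg1.
    exact: (ereal_itv_between t0ab tab).
  by rewrite !fctE sg0 sub0r => /eqP; rewrite subr_eq addrC => /eqP.
by rewrite (sgE t tab) sgt.
Qed.

Lemma derive1_affine (x v : 'rV[R]_n) (t0 t : R) :
  derive1 (fun t => x + (t - t0) *: v) t = v.
Proof.
rewrite derive1E; apply: (@derive_val _ _ _ _ _ _ _ _).
have -> : (fun t => x + (t - t0) *: v) = (fun t => (x - t0 *: v) + t *: v).
  by apply/funext => u; rewrite scalerBl addrAC addrA.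
exact: is_derive_affine.
Qed.

(** Read off from the local geodesics, which are affine, rather than computed from the metric. *)
Lemma flat_spray0 x y : U (x, y) -> spray F x y = 0.
Proof.
move=> [/= Ox y0].
have [d d0 [g [geo g0 g1]]] := geodesic_local_existence Omega_open finslerF Ox y0.
have t00 : (((- d)%:E < 0%:E < d%:E)%E) by rewrite !lte_fin oppr_lt0 d0.
have gE t : ((- d)%:E < t%:E < d%:E)%E -> g t = x + (t - 0) *: y.
  by move=> tab; rewrite (flat_geodesic geo t00 tab) g0 g1.
have g1E t : ((- d)%:E < t%:E < d%:E)%E -> derive1 g t = y.
  move=> tab; rewrite -[RHS](derive1_affine x y 0 t) !derive1E.
  by apply: near_eq_derive; apply: filterS (ereal_itv_near tab) => u; exact: gE.
have g2E : derive1 (derive1 g) 0 = 0.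
  rewrite derive1E -(@derive_cst R R _ y 0 1).
  by apply: near_eq_derive; apply: filterS (ereal_itv_near t00) => u; exact: g1E.
have [_ /(_ 0 t00)[_ _ _]] := geo; rewrite g2E g0 g1 add0r => /eqP.
by rewrite scaler_eq0 pnatr_eq0 /= => /eqP.
Qed.

(** Differentiating [\sum_k y^k E_{x^k} = 0] in [y^j] gives [E_{x^j} + \sum_k y^k E_{x^k y^j} = 0],
    while a vanishing spray force says [\sum_k y^k E_{x^k y^j} = E_{x^j}]. *)
Lemma flat_derive_energy0 j x y : U (x, y) -> 'D_(e j, 0) E (x, y) = 0.
Proof.
move=> Uxy; have [/= Ox y0] := Uxy.
have along z : U (x, z) -> \sum_k z ord0 k * 'D_(e k, 0) E (x, z) = 0.
  move=> Uxz; have [/= _ z0] := Uxz.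
  rewrite -(derive_energy1 finslerF z Uxz) -(@derive_slice1 R _ _ E).
  have dE := differentiable_slice1 (energy_differentiable finslerF Uxz).
  have dl : is_derive (0 : R) 1 (fun s : R => E (x + s *: z, z)) ('D_z (fun w => E (w, z)) x).
    have := @is_derive_line R _ (fun w => E (w, z)) x z 0.
    by rewrite scale0r addr0; apply.
  rewrite -(@derive_val _ _ _ _ _ _ _ dl).
  have -> : (fun s : R => E (x + s *: z, z)) = cst (E (x, z)).
    by apply/funext => s; rewrite /energy /= (proj2 (line s Ox z0)).
  exact: derive_cst.
have force0 : spray_force F x y ord0 j = 0.
  have := hessian_mul_spray finslerF Uxy; rewrite flat_spray0 // trmx0 mulmx0.
  move=> /matrixP /(_ j ord0); rewrite mxE [in RHS]mxE [X in _ = _ * X]mxE => /esym /eqP.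
  by rewrite mulf_eq0 invr_eq0 pnatr_eq0 /= => /eqP.
have dE2 i := derive_energy_diff2 Omega_open finslerF (e i, 0) Uxy.
have h := derive_coord_sum j dE2.
have lhs : 'D_(e j) (fun z : 'rV[R]_n => \sum_i z ord0 i * 'D_(e i, 0) E (x, z)) y = 0.
  transitivity ('D_(e j) (cst (0 : R)) y); last exact: derive_cst.
  by apply: near_eq_derive; apply: filterS (near_slit2 Omega_open Uxy) => z /along ->.
have hs : \sum_i y ord0 i * 'D_(e j) (fun z => 'D_(e i, 0) E (x, z)) y =
    \sum_k 'D_(0, e j) ('D_(e k, 0) E) (x, y) * y ord0 k.
  apply: eq_bigr => i _; rewrite mulrC.
  exact: (f_equal (fun a => a * _) (@derive_slice2 R _ _ ('D_(e i, 0) E) x y (e j))).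
move: force0; rewrite mxE -hs; move: h; rewrite lhs; lra.
Qed.

Lemma flat_metric_cst x y : Omega 0 -> y != 0 -> F x y = F 0 y.
Proof.
move=> O0 y0.
have [->//|x0] := eqVneq x 0.
have O s : Omega (0 + s *: x) by have [] := line s O0 x0.
have dE s : is_derive (s : R) 1 (fun s : R => E (0 + s *: x, y)) 0.
  have Us : U (0 + s *: x, y) by split=> //=; exact: O.
  have dE := differentiable_slice1 (energy_differentiable finslerF Us).
  apply: (is_derive_eq (is_derive_line dE)).
  rewrite (@derive_slice1 R _ _ E) (derive_energy1 finslerF x Us) big1 // => k _.
  by rewrite flat_derive_energy0 // mulr0.
have := derive0_const (@ler01 R) (fun s _ => dE s).
rewrite scale0r scale1r !add0r /energy /= => /eqP; rewrite eqrXn2 //.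
- by move=> /eqP.
- exact: (metric_ge0 finslerF).
- by apply: (metric_ge0 finslerF); have := O 1; rewrite scale1r add0r.
Qed.

Lemma flat_backward_complete : backward_complete Omega F.
Proof.
move=> a b gamma ab geo.
have [t0 t0ab] : exists t0 : R, (a < t0%:E < b)%E.
  case: a b ab {geo} => [a| |] [b| |] //.
  - rewrite lte_fin => ab; exists ((a + b) / 2); rewrite !lte_fin.
    by apply/andP; split; lra.
  - by move=> _; exists (a + 1); rewrite lte_fin ltrDl ltr01 ltry.
  - by move=> _; exists (b - 1); rewrite lte_fin ltrBlDr ltrDl ltr01 ltNyr.
  - by move=> _; exists 0; rewrite ltNyr ltry.
have [y0 _] := geodesic_line finslerF flat geo t0ab.
have Ot0 : Omega (gamma t0) by have [_ /(_ _ t0ab)[]] := geo.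
set x := gamma t0; set y := derive1 gamma t0.
pose sg (t : R) := x + (t - t0) *: y.
have sg1 : derive1 sg = cst y by apply/funext => t; exact: derive1_affine.
have dsg t : derivable sg t 1.
  have -> : sg = (fun t => (x - t0 *: y) + t *: y).
    by apply/funext => u; rewrite /sg scalerBl addrAC addrA.
  by have [] := is_derive_affine (x - t0 *: y) y t.
exists sg.
  split.
    exists (F x y); first exact: (metric_gt0 finslerF).
    by move=> t _; rewrite sg1 /sg /=; have [] := line (t - t0) Ot0 y0.
  move=> t _; have [Ot _] := line (t - t0) Ot0 y0; split.
  - exact: Ot.
  - exact: dsg.
  - by rewrite sg1; exact: derivable_cst.
  - by rewrite sg1 derive1_cst add0r /= flat_spray0 ?scaler0.
by move=> t tab; rewrite (flat_geodesic geo t0ab tab).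
Qed.

(** The ratio may be taken at the origin, where it is continuous on the compact unit sphere and
    invariant under positive scaling. *)
Lemma flat_reversible : Omega 0 ->
  exists L, forall z w, Omega z -> w != 0 -> F z (- w) <= L * F z w.
Proof.
move=> O0.
have [[w0 w00]|nw] := pselect (exists w : 'rV[R]_n, w != 0); last first.
  by exists 0 => z w _ w0; exfalso; apply: nw; exists w.
pose S := [set w : 'rV[R]_n | `|w| = 1].
have S0 w : S w -> w != 0 by move=> Sw; rewrite -normr_gt0 Sw.
have nS w : w != 0 -> S (`|w|^-1 *: w).
  by move=> w0'; rewrite /S /= normrZ normfV normr_id mulVf // normr_eq0.
have cS : compact S.
  apply: bounded_closed_compact.
    by exists 1; split; [exact: num_real|move=> M M1 w /= ->; exact: ltW].
  rewrite (_ : S = (fun w : 'rV[R]_n => `|w|) @^-1` [set 1]) //.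
  apply: closed_comp; last exact: closed_eq.
  by move=> w _; exact: norm_continuous.
have dF w : w != 0 -> {for w, continuous (F 0)}.
  move=> w0'; apply: differentiable_continuous.
  exact: (differentiable_slice2 (metric_differentiable finslerF (conj O0 w0' : U (0, w)))).
have cf : {within S, continuous (fun w => F 0 (- w) / F 0 w)}.
  apply: continuous_in_subspaceT => w; rewrite inE => /S0 w0'.
  have c1 : {for w, continuous (F 0 \o -%R)}.
    by apply: continuous_comp; [exact: opp_continuous|apply: dF; rewrite oppr_eq0].
  apply: cvgM; [exact: nbhs_filter|exact: c1|].
  by apply: cvgV; [exact: nbhs_filter|rewrite gt_eqF // (metric_gt0 finslerF O0 w0')|exact: dF].
have [|w1 _ hw1] := EVT_max_rV _ cS cf; first by exists (`|w0|^-1 *: w0); exact: nS.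
exists (F 0 (- w1) / F 0 w1) => z w _ wn0.
have nwn0 : - w != 0 by rewrite oppr_eq0.
rewrite (flat_metric_cst z O0 nwn0) (flat_metric_cst z O0 wn0).
have k0 : 0 < `|w|^-1 by rewrite invr_gt0 normr_gt0.
have := hw1 _ (mem_set (nS w wn0)); rewrite -scalerN !(metricZ finslerF _ O0 k0).
by rewrite invfM mulrACA divff ?gt_eqF // mul1r ler_pdivrMr // (metric_gt0 finslerF O0 wn0).
Qed.

End flat_case.

(** * Finite reversibility and backward completeness *)

Section reversibility_completeness.
Context {R : realType} {n : nat}.
Context (Omega : set 'rV[R]_n) (F : 'rV[R]_n -> 'rV[R]_n -> R).

Lemma reversibility_finP : finsler_metric Omega F ->
  (reversibility Omega F != +oo)%E <->
  exists L, forall z w, Omega z -> w != 0 -> F z (- w) <= L * F z w.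
Proof.
move=> finslerF; split.
  move=> fin; exists (fine (reversibility Omega F)) => z w Oz w0.
  have Fpos := metric_gt0 finslerF Oz w0.
  rewrite -ler_pdivrMr // -lee_fin.
  have h : ((F z (- w) / F z w)%:E <= reversibility Omega F)%E.
    apply: (@le_trans _ _ (ereal_sup [set (F z (- y) / F z y)%:E | y in [set y | y != 0]])).
      by apply: ereal_sup_ubound; exists w.
    by apply: ereal_sup_ubound; exists z.
  by rewrite fineK // fin_numE fin andbT -ltNye (lt_le_trans _ h) // ltNyr.
move=> [L hL]; rewrite -ltey; apply: (@le_lt_trans _ _ L%:E); last exact: ltry.
apply: ge_ereal_sup => _ [z Oz <-]; apply: ge_ereal_sup => _ [w w0 <-].
by rewrite lee_fin ler_pdivrMr ?hL // (metric_gt0 finslerF).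
Qed.

Theorem reversibility_backward_complete : open Omega -> strictly_convex Omega -> Omega 0 ->
  finsler_metric Omega F -> forward_complete Omega F -> projectively_flat Omega F ->
  constant_flag_curvature Omega F ->
  (reversibility Omega F != +oo)%E <-> backward_complete Omega F.
Proof.
move=> oO scO O0 finslerF fc flat [kappa curv].
have dich : (forall x y B C, Omega x -> y != 0 -> quadratic_on_line Omega F x y B C ->
      ray_end Omega x (- y) (F x y)^-1 (- B) C) ->
    (forall x y, Omega x -> y != 0 -> F x (- y) = F x y) \/
    (forall x y s, Omega x -> y != 0 -> Omega (x + s *: y) /\ F (x + s *: y) y = F x y).
  move=> back.
  have main x y : Omega x -> y != 0 -> kappa < 0 /\ F x (- y) = F x y \/
      kappa = 0 /\ forall s, Omega (x + s *: y) /\ F (x + s *: y) y = F x y.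
    move=> Ox y0; have ny0 : - y != 0 by rewrite oppr_eq0.
    have [B [C [disc q]]] := metric_line_quadratic oO finslerF scO Ox y0 curv.
    have [B' [C' [disc' q']]] := metric_line_quadratic oO finslerF scO Ox ny0 curv.
    apply: (line_dichotomy finslerF Ox y0 disc disc' q q').
    - exact: forward_ray_end q.
    - exact: back.
    - exact: forward_ray_end q'.
    - by rewrite -[X in ray_end _ _ X](opprK y); apply: back.
  (* The alternative in [main] is decided by the sign of [kappa], hence is the same for all points
     and directions. *)
  have [k0|k0] := ltP kappa 0.
    left=> x y Ox y0; have [[]//|[k00]] := main x y Ox y0.
    by rewrite k00 ltxx in k0.
  right=> x y s Ox y0; have [[k00]|[_ h]] := main x y Ox y0; last exact: h.
  by move: k00; rewrite ltNge k0.
rewrite (reversibility_finP finslerF); split.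
  move=> [L hL]; case: dich => [x y B C Ox y0 q|sym|line].
  - have ny0 : - y != 0 by rewrite oppr_eq0.
    have [B' [C' [disc' q']]] := metric_line_quadratic oO finslerF scO Ox ny0 curv.
    exact: (reversible_ray_end finslerF Ox y0 hL q q' (forward_ray_end oO finslerF flat fc Ox ny0 q')).
  - exact: symmetric_backward_complete.
  - exact: flat_backward_complete.
move=> bc; case: dich => [x y B C Ox y0 q|sym|line].
- exact: backward_ray_end.
- by exists 1 => z w Oz w0; rewrite mul1r sym.
- exact: flat_reversible.
Qed.

End reversibility_completeness.

(** * Lebesgue measure on row vectors *)

Section rational_boxes.
Context {R : realType} {n : nat}.

(** Countably many compact cubes, which link the topology of row vectors to the sigma-algebra
    generated by the coordinates and provide compact exhaustions of open sets. *)
Definition rat_box (p : 'rV[rat]_n * nat) : set 'rV[R]_n :=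
  [set v | forall i, `|v ord0 i - ratr (p.1 ord0 i)| <= p.2.+1%:R^-1].

Definition open_rat_box (p : 'rV[rat]_n * nat) : set 'rV[R]_n :=
  [set v | forall i, `|v ord0 i - ratr (p.1 ord0 i)| < p.2.+1%:R^-1].

Lemma coord_ball (x v : 'rV[R]_n) (e : R) : 0 < e ->
  (forall i, `|v ord0 i - x ord0 i| < e) -> `|x - v| < e.
Proof.
move=> e0 h; rewrite distrC.
suff : `|v - x| <= \big[Num.max/0]_i `|v ord0 i - x ord0 i|.
  by move=> /le_lt_trans; apply; apply/bigmax_ltP; split.
apply: rV_norm_le => [|i]; first exact: bigmax_ge_id.
by rewrite !mxE; apply: (le_bigmax_cond _ (fun i => `|v ord0 i - x ord0 i|)).
Qed.

Lemma open_rat_boxP (A : set 'rV[R]_n) x : open A -> A x ->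
  exists2 p, open_rat_box p x & rat_box p `<=` A.
Proof.
move=> oA Ax; have /nbhs_ballP[e /= e0 eA] : nbhs x A by apply: open_nbhs_nbhs.
have [k hk] : exists k : nat, k.+1%:R^-1 < e / 2.
  have e2 : 0 < e / 2 by rewrite divr_gt0.
  have [k _ /(_ k (leqnn k)) h] := near_infty_natSinv_lt (PosNum e2).
  by exists k.
have k0 : 0 < (k.+1%:R^-1 : R) by rewrite invr_gt0.
have /choice[q hq] : forall i : 'I_n, exists q : rat, `|x ord0 i - ratr q| < k.+1%:R^-1.
  move=> i; have /rat_in_itvoo[q] : x ord0 i < x ord0 i + k.+1%:R^-1 by rewrite ltrDl.
  rewrite in_itv /= => /andP[q1 q2]; exists q.
  by rewrite distrC ger0_norm ?subr_ge0 ?(ltW q1) // ltrBlDl.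
exists (\row_i q i, k).
  by move=> i; rewrite /= mxE.
move=> v hv; apply: eA; rewrite -ball_normE /=; apply: coord_ball => // i.
have := hv i; rewrite /= mxE => hv1; have hx1 := hq i.
rewrite -(subrK (ratr (q i)) (v ord0 i)) -addrA.
apply: le_lt_trans (ler_normD _ _) _; rewrite (distrC (ratr _)).
by rewrite [e]splitr; apply: ltrD => //; [exact: le_lt_trans hk|exact: lt_trans hk].
Qed.

Lemma rat_boxW p : open_rat_box p `<=` rat_box p.
Proof. by move=> v hv i; apply/ltW/hv. Qed.

Lemma nbhs_open_rat_box p x : open_rat_box p x -> nbhs x (open_rat_box p).
Proof.
move=> hx.
suff : nbhs x (fun v : 'rV[R]_n => forall i, `|v ord0 i - ratr (p.1 ord0 i)| < p.2.+1%:R^-1) by [].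
apply: (@filter_forall _ _ (fun i (v : 'rV[R]_n) => `|v ord0 i - ratr (p.1 ord0 i)| < p.2.+1%:R^-1)
  (nbhs x) (nbhs_filter x)) => i.
have c : {for x, continuous (fun v : 'rV[R]_n => `|v ord0 i - ratr (p.1 ord0 i)|)}.
  apply: (@continuous_comp _ _ _ (fun v : 'rV[R]_n => v ord0 i) (fun t : R => `|t - ratr (p.1 ord0 i)|)).
    exact: coord_continuous.
  apply: (@continuous_comp _ _ _ (fun t : R => t - ratr (p.1 ord0 i)) Num.norm).
    by apply: cvgB; [exact: cvg_id|exact: cvg_cst].
  exact: norm_continuous.
exact: (c _ (lt_nbhsl (hx i))).
Qed.

Lemma rat_box_measurable p : measurable (rat_box p).
Proof.
have -> : rat_box p = \bigcap_(i in [set: 'I_n])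
    ((fun v : 'rV[R]_n => v ord0 i) @^-1`
      `[ratr (p.1 ord0 i) - p.2.+1%:R^-1, ratr (p.1 ord0 i) + p.2.+1%:R^-1]%classic).
  apply/seteqP; split=> v h i; [move=> _|]; have := h i; rewrite /= in_itv /= ler_distl //.
  by apply.
apply: fin_bigcap_measurable => [|i _]; first exact: finite_finset.
rewrite -[X in measurable X]setTI; apply: measurable_coord => //.
Qed.

Lemma rat_box_compact p : compact (rat_box p).
Proof.
have -> : rat_box p = [set v : 'rV[R]_n | forall i,
    `[ratr (p.1 ord0 i) - p.2.+1%:R^-1, ratr (p.1 ord0 i) + p.2.+1%:R^-1]%classic (v ord0 i)].
  by apply/seteqP; split=> v h i; have := h i; rewrite /= in_itv /= ler_distl.
apply: (@rV_compact R _ (fun i =>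
  `[ratr (p.1 ord0 i) - p.2.+1%:R^-1, ratr (p.1 ord0 i) + p.2.+1%:R^-1]%classic)) => i.
exact: segment_compact.
Qed.

Lemma open_bigcup_rat_box (A : set 'rV[R]_n) : open A ->
  A = \bigcup_p (if `[< rat_box p `<=` A >] then rat_box p else set0).
Proof.
move=> oA; apply/seteqP; split=> [x Ax|x [p _]]; last first.
  by case: asboolP => // pA /pA.
by have [p px pA] := open_rat_boxP oA Ax; exists p => //; case: asboolP => // _; exact: rat_boxW.
Qed.

Lemma open_rV_measurable (A : set 'rV[R]_n) : open A -> measurable A.
Proof.
move=> /open_bigcup_rat_box ->; apply: countable_bigcupT_measurable; first exact: countableP.
by move=> p; case: asboolP => // _; exact: rat_box_measurable.
Qed.

Lemma closed_rV_measurable (A : set 'rV[R]_n) : closed A -> measurable A.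
Proof. by move/closed_openC/open_rV_measurable/measurableC; rewrite setCK. Qed.

Lemma compact_rV_closed (A : set 'rV[R]_n) : compact A -> closed A.
Proof. by apply: compact_closed; exact: norm_hausdorff. Qed.

Lemma compact_rV_measurable (A : set 'rV[R]_n) : compact A -> measurable A.
Proof. by move/compact_rV_closed; exact: closed_rV_measurable. Qed.

Lemma continuous_rV_measurable (D : set 'rV[R]_n) (f : 'rV[R]_n -> R) :
  open D -> {in D, continuous f} -> measurable_fun D f.
Proof.
move=> oD cf; apply: (measurability _ (RGenOpens.measurableE R)).
move=> _ [_ [a [b ->] <-]]; apply: open_rV_measurable.
rewrite openE => x [Dx fx]; apply: filterI; first exact: open_nbhs_nbhs.
by apply: (cf x (mem_set Dx)); apply: open_nbhs_nbhs; split => //; exact: interval_open.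
Qed.

Lemma lebesgue_bounded_fin (A : set 'rV[R]_n) (M : R) : measurable A ->
  (forall v, A v -> `|v| <= M) -> (lebesgue n A < +oo)%E.
Proof.
move=> mA AM; pose B := [set v : 'rV[R]_n | forall i, v ord0 i \in `]- (`|M| + 1), `|M| + 1] ].
have mB : measurable B.
  have -> : B = \bigcap_(i in [set: 'I_n])
      ((fun v : 'rV[R]_n => v ord0 i) @^-1` `](- (`|M| + 1)), (`|M| + 1)]%classic).
    by apply/seteqP; split=> v h i; [move=> _|]; have := h i; [|apply].
  apply: fin_bigcap_measurable => [|i _]; first exact: finite_finset.
  by rewrite -[X in measurable X]setTI; apply: measurable_coord.
apply: (@le_lt_trans _ _ (lebesgue n B)).
  apply: le_measure; rewrite ?inE // => v /AM vM i; rewrite in_itv /=.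
  have := rV_coord_le_norm v i; have := ler_norm M; rewrite ler_norml => h /andP[h1 h2].
  by apply/andP; split; lra.
rewrite (@lebesgue_box R n (fun=> - (`|M| + 1)) (fun=> `|M| + 1)) ?ltry // => i.
by have := normr_ge0 M; lra.
Qed.

Lemma compact_lebesgue_fin (A : set 'rV[R]_n) : compact A -> (lebesgue n A < +oo)%E.
Proof.
move=> cA; have [M [_ hM]] := compact_bounded cA.
apply: (@lebesgue_bounded_fin _ (M + 1)); first exact: compact_rV_measurable.
by move=> v Av; apply: hM => //; rewrite ltrDl.
Qed.

(** Codes of no box, and boxes that are not contained in [A], contribute nothing; finite unions of
    pieces are thus compact subsets of [A]. *)
Definition exhaustion_piece (A : set 'rV[R]_n) (k : nat) : set 'rV[R]_n :=
  if unpickle k is Some p then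
    if `[< rat_box p `<=` A >] then rat_box p else set0 else set0.

Definition exhaustion (A : set 'rV[R]_n) (m : nat) : set 'rV[R]_n :=
  \big[setU/set0]_(k < m) exhaustion_piece A k.

Lemma exhaustion_compact A m : compact (exhaustion A m).
Proof.
apply: bigsetU_compact => k _; rewrite /exhaustion_piece; case: unpickle => [p|]; last exact: compact0.
by case: asboolP => _; [exact: rat_box_compact|exact: compact0].
Qed.

(** Each point has an open box whose closed version belongs to the exhaustion from some rank on;
    compactness makes the rank uniform. *)
Lemma exhaustion_absorbs A (K : set 'rV[R]_n) : open A -> compact K -> K `<=` A ->
  exists m, K `<=` exhaustion A m.
Proof.
move=> oA /compact_near_coveringP cK KA.
have [|m _ /(_ m (leqnn m)) h] := cK nat \oo (fun m => exhaustion A m) _; last by exists m.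
move=> x /KA Ax; have [p px pA] := open_rat_boxP oA Ax.
exists (open_rat_box p, [set m | (pickle p < m)%N]) => /=.
  by split; [exact: nbhs_open_rat_box|exists (pickle p).+1].
move=> [v m] /= [pv pm]; rewrite /exhaustion -bigcup_mkord; exists (pickle p) => //.
by rewrite /exhaustion_piece pickleK; case: asboolP => // _; exact: rat_boxW.
Qed.

End rational_boxes.

(** * Translation invariance of Lebesgue measure *)

Section translation_invariance.
Context {R : realType} {n : nat}.
Notation mu := (lebesgue n : {measure set 'rV[R]_n -> \bar R}).

Definition ocbox (a b : 'I_n -> R) : set 'rV[R]_n :=
  [set v | forall i, v ord0 i \in `]a i, b i]].

Lemma measurable_ocbox a b : measurable (ocbox a b).
Proof.
have -> : ocbox a b = \bigcap_(i in [set: 'I_n])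
    ((fun v : 'rV[R]_n => v ord0 i) @^-1` `]a i, b i]%classic).
  by apply/seteqP; split=> v h i; [move=> _|]; have := h i; [|apply].
apply: fin_bigcap_measurable => [|i _]; first exact: finite_finset.
by rewrite -[X in measurable X]setTI; apply: measurable_coord.
Qed.

Definition ocboxes : set (set 'rV[R]_n) := [set ocbox p.1 p.2 | p in setT].

Lemma ocboxesE : @measurable _ 'rV[R]_n = <<s ocboxes >>.
Proof.
apply/seteqP; split; last first.
  apply: smallest_sub; first exact: sigma_algebra_measurable.
  by move=> _ [[a b] _ <-]; exact: measurable_ocbox.
apply: smallest_sub; first exact: smallest_sigma_algebra.
rewrite -bigcup_seq => _ [i _ [C mC <-]].
suff : @measurable_fun _ _ (g_sigma_algebraType ocboxes) R setT (fun v : 'rV[R]_n => v ord0 i).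
  by move=> /(_ measurableT C mC).
apply: (@measurability _ _ (g_sigma_algebraType ocboxes) R setT _ (@ocitv R)) => //.
move=> _ [_ [[a b] _ <-] <-]; rewrite setTI.
(* A slab is a countable union of boxes whose other sides exhaust the line. *)
have -> : (fun v : 'rV[R]_n => v ord0 i) @^-1` `]a, b]%classic =
    \bigcup_k ocbox (fun j => if j == i then a else - k%:R) (fun j => if j == i then b else k%:R).
  apply/seteqP; split=> [v /= vab|v [k _ /(_ i)]]; last by rewrite eqxx.
  have [k hk] : exists k : nat, `|v| < k%:R.
    by have [k _ /(_ k (leqnn k))] := nbhs_infty_gtr `|v|; exists k.
  exists k => // j; case: eqP => [->//|_]; rewrite in_itv /=.
  have := le_lt_trans (rV_coord_le_norm v j) hk; rewrite ltr_norml => /andP[h1 h2].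
  by rewrite h1 ltW.
apply: bigcup_measurable => k _; apply: sub_sigma_algebra.
by exists ((fun j => if j == i then a else - k%:R), (fun j => if j == i then b else k%:R)).
Qed.

Lemma ocbox_set0 a b i : b i <= a i -> ocbox a b = set0.
Proof.
move=> ba; apply/seteqP; split=> // v /(_ i); rewrite in_itv /= => /andP[h1 h2].
by have := lt_le_trans h1 (le_trans h2 ba); rewrite ltxx.
Qed.

Lemma measurable_translation (w : 'rV[R]_n) :
  measurable_fun setT (fun v : 'rV[R]_n => v + w).
Proof.
apply: measurable_fun_row => i; under eq_fun do rewrite mxE.
by apply: measurable_funD; [exact: measurable_coord|exact: measurable_cst].
Qed.

Lemma ocbox_translation (w : 'rV[R]_n) a b :
  (fun v => v + w) @^-1` ocbox a b = ocbox (fun i => a i - w ord0 i) (fun i => b i - w ord0 i).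
Proof.
by apply/seteqP; split=> v h i; have := h i; rewrite /= !in_itv /= !mxE ltrBlDr lerBrDr.
Qed.

Lemma lebesgue_ocbox a b : (forall i, a i <= b i) -> mu (ocbox a b) = (\prod_i (b i - a i))%:E.
Proof. exact: lebesgue_box. Qed.

Lemma lebesgue_ocbox_translation (w : 'rV[R]_n) a b :
  mu ((fun v => v + w) @^-1` ocbox a b) = mu (ocbox a b).
Proof.
rewrite ocbox_translation.
have [ab|/existsNP[i /negP]] := pselect (forall i, a i <= b i); last first.
  rewrite -ltNge => ba; rewrite (@ocbox_set0 a b i) ?ltW // (@ocbox_set0 _ _ i) //.
  by rewrite lerD2r ltW.
rewrite !lebesgue_ocbox // => [|i]; last by rewrite lerD2r.
by congr (_%:E); apply: eq_bigr => i _; rewrite opprB addrA subrK.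
Qed.

(** The translated measure agrees with [mu] on half-open boxes, a generating family that is stable
    under intersection and covers the space by sets of finite measure. *)
Lemma lebesgue_translation (w : 'rV[R]_n) (A : set 'rV[R]_n) : measurable A ->
  mu ((fun v => v + w) @^-1` A) = mu A.
Proof.
move=> mA.
pose m2 := measure_function_pushforward__canonical__measure_function_Measure mu (measurable_translation w).
apply: (measure_unique ocboxes (fun k => ocbox (fun=> - k%:R) (fun=> k%:R)) ocboxesE _ _ _ m2 mu) => //.
- move=> _ _ [[a b] _ <-] [[c d] _ <-] /=.
  exists ((fun i => Num.max (a i) (c i)), (fun i => Num.min (b i) (d i))) => //=.
  apply/seteqP; split=> v /=.
    move=> h; split=> i; have := h i; rewrite !in_itv /= gt_max le_min.
      by move=> /andP[/andP[-> _] /andP[-> _]].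
    by move=> /andP[/andP[_ ->] /andP[_ ->]].
  move=> [h1 h2] i; have := h1 i; have := h2 i; rewrite !in_itv /= gt_max le_min.
  by move=> /andP[-> ->] /andP[-> ->].
- by move=> k; exists ((fun=> - k%:R), (fun=> k%:R)).
- apply/seteqP; split=> // v _.
  have [k hk] : exists k : nat, `|v| < k%:R.
    by have [k _ /(_ k (leqnn k))] := nbhs_infty_gtr `|v|; exists k.
  exists k => // j; rewrite in_itv /=.
  have := le_lt_trans (rV_coord_le_norm v j) hk; rewrite ltr_norml => /andP[h1 h2].
  by rewrite h1 ltW.
- by move=> _ [[a b] _ <-]; exact: lebesgue_ocbox_translation.
- move=> k; rewrite /m2 /= /pushforward lebesgue_ocbox_translation lebesgue_ocbox ?ltry //.
  by move=> i; rewrite lerNl -mulN1r (@le_trans _ _ 0) ?mulN1r ?oppr_le0.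
Qed.

End translation_invariance.

(** * Smooth functions and integration by parts *)

Section smooth_functions.
Context {R : realType} (V : normedModType R).
Implicit Types (f g : V -> R).

(** Smoothness is proved throughout by exhibiting a class of differentiable functions that is stable
    under directional derivatives. *)
Lemma smooth_of_class (C : set (V -> R)) :
  (forall f, C f -> forall x, differentiable f x) ->
  (forall f v, C f -> C ('D_v f)) -> forall f, C f -> smooth_on setT f.
Proof.
move=> dC DC f Cf vs x _; apply: dC.
by elim: vs => //= v vs IH; exact: DC.
Qed.

Lemma smooth_differentiable f x : smooth_on setT f -> differentiable f x.
Proof. by move=> /(_ [::] x I). Qed.

Lemma smooth_continuous f : smooth_on setT f -> continuous f.
Proof. by move=> sf x; apply: differentiable_continuous; exact: smooth_differentiable. Qed.

Lemma smooth_derive f v : smooth_on setT f -> smooth_on setT ('D_v f).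
Proof. by move=> sf vs x _; have := sf (rcons vs v) x I; rewrite -cats1 foldr_cat. Qed.

(** The derivative of a product is a sum of products, so an induction over the directions does not
    stay within products. The algebra generated by the smooth functions is stable under
    derivation. *)
Inductive smooth_algebra : (V -> R) -> Prop :=
| smooth_algebra_base f : smooth_on setT f -> smooth_algebra f
| smooth_algebraD f g : smooth_algebra f -> smooth_algebra g -> smooth_algebra (fun x => f x + g x)
| smooth_algebraM f g : smooth_algebra f -> smooth_algebra g -> smooth_algebra (fun x => f x * g x).

Lemma smooth_algebra_differentiable f x : smooth_algebra f -> differentiable f x.
Proof.
elim=> {f} [f sf|f g _ df _ dg|f g _ df _ dg]; first exact: smooth_differentiable.
  exact: (differentiableD df dg).
exact: (differentiableM df dg).
Qed.

Lemma smooth_algebra_derive f v : smooth_algebra f -> smooth_algebra ('D_v f).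
Proof.
elim=> {f} [f sf|f g af Df ag Dg|f g af Df ag Dg].
- by apply: smooth_algebra_base; exact: smooth_derive.
- have -> : 'D_v (fun x => f x + g x) = (fun x => 'D_v f x + 'D_v g x).
    apply/funext => x; rewrite (@deriveD _ _ _ f g) //;
      by apply: diff_derivable; exact: smooth_algebra_differentiable.
  exact: smooth_algebraD.
- have -> : 'D_v (fun x => f x * g x) = (fun x => f x * 'D_v g x + g x * 'D_v f x).
    apply/funext => x; rewrite (@deriveM _ _ f g) //;
      by apply: diff_derivable; exact: smooth_algebra_differentiable.
  by apply: smooth_algebraD; exact: smooth_algebraM.
Qed.

Lemma smooth_algebra_smooth f : smooth_algebra f -> smooth_on setT f.
Proof.
apply: (@smooth_of_class smooth_algebra) => [g ag x|g v].
  exact: smooth_algebra_differentiable.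
exact: smooth_algebra_derive.
Qed.

Lemma smoothD f g : smooth_on setT f -> smooth_on setT g -> smooth_on setT (fun x => f x + g x).
Proof.
by move=> sf sg; apply/smooth_algebra_smooth/smooth_algebraD; exact: smooth_algebra_base.
Qed.

Lemma smoothM f g : smooth_on setT f -> smooth_on setT g -> smooth_on setT (fun x => f x * g x).
Proof.
by move=> sf sg; apply/smooth_algebra_smooth/smooth_algebraM; exact: smooth_algebra_base.
Qed.

Lemma smooth_cst (k : R) : smooth_on setT (cst k : V -> R).
Proof.
apply: (@smooth_of_class [set f | exists k, f = cst k]); last by exists k.
  by move=> _ [c ->] x; exact: differentiable_cst.
by move=> _ v [c ->]; exists 0; apply/funext => x; exact: derive_cst.
Qed.

Lemma smoothZ (k : R) f : smooth_on setT f -> smooth_on setT (fun x => k * f x).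
Proof. by apply: smoothM; exact: smooth_cst. Qed.

Lemma smooth_prod (I : Type) (s : seq I) (P : pred I) (f : I -> V -> R) :
  (forall i, smooth_on setT (f i)) -> smooth_on setT (fun x => \prod_(i <- s | P i) f i x).
Proof.
move=> sf; elim: s => [|i s IH].
  by under eq_fun do rewrite big_nil; exact: smooth_cst.
by under eq_fun do rewrite big_cons; case: (P i) => //; exact: smoothM.
Qed.

End smooth_functions.

Section smooth_comp_affine.
Context {R : realType} {n : nat}.

Definition affine_form (xi : 'rV[R]_n) (c : R) (x : 'rV[R]_n) : R :=
  \sum_i xi ord0 i * x ord0 i + c.

Lemma is_derive_affine_form (xi : 'rV[R]_n) c x v :
  differentiable (affine_form xi c) x /\
  'D_v (affine_form xi c) x = \sum_i xi ord0 i * v ord0 i.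
Proof.
have -> : affine_form xi c = (\sum_i (xi ord0 i \*: (fun x : 'rV[R]_n => x ord0 i : R))) + cst c.
  by apply/funext => y; rewrite /affine_form !fctE fct_sumE.
have dc i : differentiable (fun x : 'rV[R]_n => x ord0 i : R) x by exact: differentiable_coord.
have ds : differentiable (\sum_i (xi ord0 i \*: (fun x : 'rV[R]_n => x ord0 i : R))) x.
  by apply: differentiable_sum => i; exact: differentiableZ.
split; first exact: differentiableD.
rewrite deriveD; [|exact: diff_derivable|exact: derivable_cst].
rewrite derive_cst addr0 derive_sum; last by move=> i; apply: diff_derivable; exact: differentiableZ.
apply: eq_bigr => i _; rewrite deriveZ; last exact: diff_derivable.
by rewrite derive_coord.
Qed.

Lemma derive_comp_affine (a : R -> R) (xi : 'rV[R]_n) c x v :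
  differentiable a (affine_form xi c x) ->
  differentiable (a \o affine_form xi c) x /\
  'D_v (a \o affine_form xi c) x = (\sum_i xi ord0 i * v ord0 i) * 'D_1 a (affine_form xi c x).
Proof.
move=> da; have [dl Dl] := is_derive_affine_form xi c x v.
have dc := differentiable_comp dl da; split => //.
rewrite (deriveE _ dc) (diff_comp dl da) /= -(deriveE _ dl) Dl.
by rewrite -[X in 'd a _ X]mulr1 -/(_ *: 1) linearZ -deriveE.
Qed.

Lemma smooth_comp_affine (a : R -> R) (xi : 'rV[R]_n) c :
  smooth_on setT a -> smooth_on setT (a \o affine_form xi c).
Proof.
move=> sa.
(* The chain rule along an affine form only produces a constant factor, so these multiples form a
   stable class. *)
apply: (@smooth_of_class _ _ [set f | exists k, exists2 b : R -> R, smooth_on setT b &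
    f = (fun x => k * b (affine_form xi c x))]); last first.
  by exists 1, a => //; apply/funext => x; rewrite mul1r.
  move=> _ v [k [b sb ->]]; exists (k * \sum_i xi ord0 i * v ord0 i), ('D_1 b).
    exact: smooth_derive.
  apply/funext => x; have [db Db] := derive_comp_affine v (smooth_differentiable (affine_form xi c x) sb).
  rewrite (@deriveZ _ _ _ (b \o affine_form xi c)); last exact: diff_derivable.
  by rewrite Db /GRing.scale /= mulrA.
move=> _ [k [b sb ->]] x.
have [db Db] := derive_comp_affine 0 (smooth_differentiable (affine_form xi c x) sb).
exact: (@differentiableZ _ _ _ (b \o affine_form xi c)).
Qed.

End smooth_comp_affine.

(** * Trigonometric functions and exponential cutoffs *)

Section smooth_real_functions.
Context {R : realType}.

(** Directional derivatives on the line are multiples of the ordinary one, hence the closure of the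
    class under scalars. *)
Lemma smooth_of_class1 (C : (R -> R) -> Prop) :
  (forall f, C f -> exists2 df, C df & forall t : R, is_derive t 1 f (df t)) ->
  forall f, C f -> smooth_on setT f.
Proof.
move=> hC f Cf.
pose D : set (R -> R) := [set g | exists k, exists2 h, C h & g = (fun t => k * h t)].
apply: (@smooth_of_class R _ D).
- move=> _ [k [h Ch ->]] t; have [dh Cdh h1] := hC h Ch.
  by apply: (@differentiableZ _ _ _ h); apply/derivable1_diffP; have [] := h1 t.
- move=> _ v [k [h Ch ->]]; have [dh Cdh h1] := hC h Ch.
  exists (k * v), dh => //; apply/funext => t.
  have [h2 h3] := is_deriveZ k (h1 t); have /derivable1_diffP h4 := h2.
  rewrite (deriveE _ h4) -[X in 'd _ _ X]mulr1 -/(_ *: 1) linearZ -deriveE // h3.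
  by transitivity (v * (k * dh t)) => //; rewrite mulrA [v * k]mulrC.
- by exists 1, f => //; apply/funext => t; rewrite mul1r.
Qed.

Lemma smooth_cos_sin : smooth_on setT (@cos R) /\ smooth_on setT (@sin R).
Proof.
pose C (f : R -> R) := [\/ f = cos, f = sin, f = - cos | f = - sin].
have hC : forall f, C f -> exists2 df, C df & forall t : R, is_derive t 1 f (df t).
  move=> f [] ->.
  - by exists (- sin) => [|t]; [apply: Or44|exact: is_derive_cos].
  - by exists cos => [|t]; [apply: Or41|exact: is_derive_sin].
  - exists sin => [|t]; first by apply: Or42.
    by apply: (is_derive_eq (is_deriveN (is_derive_cos t))); rewrite opprK.
  - exists (- cos) => [|t]; first by apply: Or43.
    exact: (is_deriveN (is_derive_sin t)).
by split; apply: (smooth_of_class1 hC); [apply: Or41|apply: Or42].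
Qed.

(** The function [P(1/t) exp(-1/t)] extended by zero. Keeping [P] general makes the family stable
    under derivation, with [P] replaced by [X^2 (P - P')]; the case [P = 1] is the usual cutoff. *)
Definition exp_cutoff (P : {poly R}) (t : R) : R :=
  if 0 < t then P.[t^-1] * expR (- t^-1) else 0.

(** With [u = 1/t] and [d] the size of [P], the exponential dominates [u^(d + 2) / (d + 2)!], which
    absorbs [P(u)] and leaves [t^2]. Quadratic smallness gives a zero derivative at the origin. *)
Lemma exp_cutoff_bound (P : {poly R}) :
  exists K, forall t, `|t| <= 1 -> `|exp_cutoff P t| <= K * t ^+ 2.
Proof.
pose d := size P.
exists (\sum_(i < d) `|P`_i| * (d.+2`!)%:R) => t t1; rewrite /exp_cutoff.
case: ifPn => t0; last first.
  by rewrite normr0 mulr_ge0 ?sqr_ge0 // sumr_ge0 // => i _; rewrite mulr_ge0.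
rewrite gtr0_norm // in t1.
have u1 : 1 <= t^-1 by rewrite invf_ge1.
have u0 : 0 < t^-1 by rewrite invr_gt0.
set u := t^-1 in u1 u0 *.
have tu : t = u^-1 by rewrite invrK.
rewrite normrM (gtr0_norm (expR_gt0 _)) expRN horner_coef tu.
have e0 : u ^+ d.+2 <= (d.+2`!)%:R * expR u.
  have := expR_ge1Dxn d.+1 (ltW u0); rewrite -lerBrDl => h.
  have f0 : 0 < (d.+2`!)%:R :> R by rewrite ltr0n fact_gt0.
  by rewrite mulrC -ler_pdivrMr // (le_trans h) // gerBl.
have hP : `|\sum_(i < size P) P`_i * u ^+ i| <= (\sum_(i < d) `|P`_i|) * u ^+ d.
  apply: le_trans (ler_norm_sum _ _ _) _; rewrite mulr_suml; apply: ler_sum => i _.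
  rewrite normrM normrX (gtr0_norm u0) ler_wpM2l // ler_weXn2l //.
  by rewrite ltnW.
rewrite exprVn ler_pdivrMr ?expR_gt0 // mulrAC ler_pdivlMr ?exprn_gt0 //.
apply: le_trans (_ : (\sum_(i < d) `|P`_i|) * u ^+ d * u ^+ 2 <= _).
  by rewrite ler_wpM2r // exprn_ge0 // ltW.
rewrite -mulrA -exprD addn2 -mulr_suml -mulrA ler_wpM2l // sumr_ge0 //.
Qed.

Lemma is_derive_quadratic_small (f : R -> R) (K : R) : f 0 = 0 ->
  (forall t, `|t| <= 1 -> `|f t| <= K * t ^+ 2) -> is_derive (0 : R) 1 f 0.
Proof.
move=> f0 fK.
have K0 : 0 <= K by have := fK 1; rewrite normr1 lexx expr1n mulr1 => /(_ isT); apply: le_trans.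
have h : h^-1 *: ((f \o shift 0) (h *: 1) - f 0) @[h --> (0 : R)^'] --> (0 : R).
  apply/cvgrPdist_le => e e0.
  have d0 : 0 < Num.min 1 (e / (K + 1)) by rewrite lt_min ltr01 divr_gt0 // ltr_wpDl.
  exists (Num.min 1 (e / (K + 1))) => // t /=; rewrite sub0r normrN lt_min => /andP[t1 te] t0.
  rewrite sub0r normrN f0 subr0 /shift /= addr0 [_%:A]mulr1 /GRing.scale /= normrM normfV.
  rewrite ler_pdivrMl ?normr_gt0 //.
  apply: le_trans (fK t (ltW t1)) _; rewrite -[t ^+ 2]ger0_norm ?sqr_ge0 // normrX expr2.
  rewrite mulrCA ler_wpM2l //.
  move: te; rewrite ltr_pdivlMr ?ltr_wpDl // => /ltW; apply: le_trans.
  by rewrite mulrC ler_wpM2l // lerDl.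
by apply: DeriveDef; [apply/cvg_ex; exists 0|apply/cvg_lim].
Qed.

Lemma is_derive_exp_cutoff (P : {poly R}) (t : R) :
  is_derive t 1 (exp_cutoff P) (exp_cutoff ('X ^+ 2 * (P - P^`())) t).
Proof.
have [t0|t0|<-] := ltgtP 0 t.
- pose g (s : R) := P.[s^-1] * expR (- s^-1).
  have dg : is_derive t 1 g (exp_cutoff ('X ^+ 2 * (P - P^`())) t).
    have tn0 : t != 0 by rewrite gt_eqF.
    have dV : is_derive t 1 (fun s : R => s^-1) (- t ^- 2).
      have := is_derive_id t 1 => -[d1 e1].
      apply: DeriveDef; first exact: (@derivableV _ _ id).
      by rewrite (@deriveV _ _ id) // e1 /GRing.scale /= mulr1.
    have dP : is_derive t 1 (fun s => P.[s^-1]) (P^`().[t^-1] * (- t ^- 2)).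
      exact: (is_derive1_comp (is_derive_poly P t^-1) dV).
    have dE : is_derive t 1 (fun s : R => expR (- s^-1)) (expR (- t^-1) * t ^- 2).
      by apply: (is_derive_eq (is_derive1_comp (is_derive_expR _) (is_deriveN dV))); rewrite opprK.
    apply: (is_derive_eq (is_deriveM dP dE)).
    rewrite /exp_cutoff t0 !hornerE /= /GRing.scale /=.
    by set a := expR _; set b := P.[_]; set c := P^`().[_]; field.
  apply: (near_eq_is_derive _ dg); apply: filterS (lt_nbhsr t0) => s s0.
  by rewrite /exp_cutoff s0.
- rewrite /exp_cutoff (ltNge 0 t) (ltW t0) /=.
  apply: (near_eq_is_derive _ (is_derive_cst (0 : R) t 1)).
  apply: filterS (lt_nbhsl t0) => s s0.
  by rewrite /exp_cutoff ltNge (ltW s0).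
- rewrite {2}/exp_cutoff ltxx; have [K hK] := exp_cutoff_bound P.
  by apply: (is_derive_quadratic_small _ hK); rewrite /exp_cutoff ltxx.
Qed.

Lemma smooth_exp_cutoff P : smooth_on setT (exp_cutoff P).
Proof.
apply: (@smooth_of_class1 (fun f => exists P, f = exp_cutoff P)); last by exists P.
move=> _ [Q ->]; exists (exp_cutoff ('X ^+ 2 * (Q - Q^`()))); first by eexists.
exact: is_derive_exp_cutoff.
Qed.

End smooth_real_functions.

(** * Periodic profiles with high peaks *)

Section oscillating_profile.
Context {R : realType}.

(* [wallis N] is the mean of [cos ^+ N.*2]. *)
Fixpoint wallis (N : nat) : R :=
  if N is m.+1 then (1 - (m.+1.*2)%:R^-1) * wallis m else 1.

(** The reduction formula for the primitive of [cos^(2 N)], without the linear term [wallis N * t];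
    what remains is bounded. *)
Fixpoint wallis_primitive (N : nat) (t : R) : R :=
  if N is m.+1 then (m.+1.*2)%:R^-1 * (cos t ^+ m.*2.+1 * sin t)
    + (1 - (m.+1.*2)%:R^-1) * wallis_primitive m t else 0.

Lemma wallis_gt0 N : 0 < wallis N.
Proof.
elim: N => //= m IH; rewrite mulr_gt0 // subr_gt0 invf_lt1 ?ltr1n ?ltr0n // doubleS.
Qed.

Lemma is_derive_wallis_primitive N (t : R) :
  is_derive t 1 (wallis_primitive N) (cos t ^+ N.*2 - wallis N).
Proof.
elim: N => [|m IH]; first by rewrite expr0 subrr; exact: is_derive_cst.
have dm : is_derive t 1 (fun t : R => cos t ^+ m.*2.+1 * sin t)
    ((m.+1.*2)%:R * cos t ^+ m.+1.*2 - m.*2.+1%:R * cos t ^+ m.*2).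
  have h := is_deriveM (is_deriveX m.*2.+1 (is_derive_cos t)) (is_derive_sin t).
  have -> : (fun t : R => cos t ^+ m.*2.+1 * sin t) = cos ^+ m.*2.+1 * sin.
    by apply/funext => s; rewrite !fctE.
  apply: (is_derive_eq h); rewrite /GRing.scale /= /GRing.scale /= !fctE.
  have e2 := cos2Dsin2 t; have -> : m.+1.*2 = m.*2.+2 by rewrite doubleS.
  have -> : sin t * (m.*2.+1%:R * cos t ^+ m.*2 * - sin t) =
     - (m.*2.+1%:R * cos t ^+ m.*2 * sin t ^+ 2) by ring.
  have -> : sin t ^+ 2 = 1 - cos t ^+ 2 by rewrite -e2; ring.
  by rewrite !exprS -[m.*2.+2]addn1 natrD; ring.
have h := is_deriveD (is_deriveZ (m.+1.*2)%:R^-1 dm) (is_deriveZ (1 - (m.+1.*2)%:R^-1) IH).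
apply: (is_derive_eq h); rewrite /GRing.scale /=.
have n0 : (m.+1.*2)%:R != 0 :> R by rewrite pnatr_eq0.
have -> : m.*2.+1%:R = (m.+1.*2)%:R - 1 :> R by rewrite doubleS -[m.*2.+2]addn1 natrD addrK.
set a := (m.+1.*2)%:R in n0 *; set c := cos t ^+ _; set d := cos t ^+ _; set w := wallis m.
by rewrite /GRing.scale /=; field.
Qed.

Lemma smooth_wallis_primitive N : smooth_on setT (wallis_primitive N).
Proof.
have [sc ss] := @smooth_cos_sin R.
have sX k : smooth_on setT (fun t : R => cos t ^+ k).
  elim: k => [|k IH]; first exact: (smooth_cst 1).
  by under eq_fun do rewrite exprS; exact: smoothM.
elim: N => [|m IH]; first exact: (smooth_cst 0).
by apply: smoothD; apply: smoothZ => //; exact: smoothM.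
Qed.

Lemma wallis_primitive_bounded N : exists K, forall t, `|wallis_primitive N t| <= K.
Proof.
elim: N => [|m [K hK]]; first by exists 0 => t; rewrite normr0.
exists ((m.+1.*2)%:R^-1 + `|1 - (m.+1.*2)%:R^-1| * K) => t /=.
apply: le_trans (ler_normD _ _) _; apply: lerD; rewrite normrM; last first.
  by rewrite ler_wpM2l.
rewrite ger0_norm // -[leRHS]mulr1 ler_wpM2l // normrM normrX -[leRHS]mulr1.
have c1 : `|cos t| <= 1 by rewrite ler_norml cos_le1 cos_geN1.
have s1 : `|sin t| <= 1 by rewrite ler_norml sin_le1 sin_geN1.
by apply: ler_pM; rewrite ?exprn_ge0 // exprn_ile1.
Qed.

(** It makes [wallis N] tend to zero, so the normalised peaks become arbitrarily high. With
    [a = 2 m + 2] the induction step is [(1 - 1/a)^2 (a + 1) <= a - 1]. *)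
Lemma wallis_sqr_le N : wallis N ^+ 2 * N.*2.+1%:R <= 1.
Proof.
elim: N => [|m IH]; first by rewrite expr1n mulr1.
apply: le_trans IH.
have n0 : 0 < (m.+1.*2)%:R :> R by rewrite ltr0n.
have -> : m.+1.*2.+1%:R = (m.+1.*2)%:R + 1 :> R by rewrite -natr1.
have -> : m.*2.+1%:R = (m.+1.*2)%:R - 1 :> R by rewrite doubleS -[m.*2.+2]addn1 natrD addrK.
have n1 : 1 <= (m.+1.*2)%:R :> R by rewrite ler1n.
have -> : wallis m.+1 = (1 - (m.+1.*2)%:R^-1) * wallis m by [].
set a := (m.+1.*2)%:R in n0 n1 *; set w := wallis m.
have -> : ((1 - a^-1) * w) ^+ 2 * (a + 1) = w ^+ 2 * ((a - 1) * (1 - (a ^+ 2)^-1)).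
  by field; rewrite gt_eqF.
rewrite ler_wpM2l ?sqr_ge0 //.
by rewrite ler_piMr ?subr_ge0 // lerBlDr lerDl invr_ge0 sqr_ge0.
Qed.

(** [(N + 1) * wallis N] is nondecreasing in [N]; comparing [N] with [2 N] costs a factor of at most
    two. This compares the mean square of the profile with its height. *)
Lemma wallis_double N : wallis N <= 2 * wallis N.*2.
Proof.
have h m : wallis N * N.+1%:R <= wallis (N + m) * (N + m).+1%:R.
  elim: m => [|m IH]; first by rewrite addn0.
  apply: le_trans IH _; rewrite addnS.
  have k1 : 1 <= (N + m).+1%:R :> R by rewrite ler1n.
  have -> : (N + m).+2%:R = (N + m).+1%:R + 1 :> R by rewrite -natr1.
  have -> : wallis (N + m).+1 = (1 - ((N + m).+1.*2)%:R^-1) * wallis (N + m) by [].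
  have -> : ((N + m).+1.*2)%:R = 2 * (N + m).+1%:R :> R by rewrite -mul2n natrM.
  have w1 := wallis_gt0 (N + m).
  set a := (N + m).+1%:R in k1 *; set w := wallis (N + m) in w1 *.
  have a0 : 0 < a by exact: lt_le_trans k1.
  have -> : (1 - (2 * a)^-1) * w * (a + 1) = w * a + w * ((2 * a)^-1 * (a - 1)).
    by field; rewrite gt_eqF.
  rewrite lerDl; apply: mulr_ge0; first exact: ltW.
  by rewrite mulr_ge0 ?subr_ge0 // invr_ge0 mulr_ge0 // ltW.
have := h N; rewrite addnn => h2.
have w0 := wallis_gt0 N.*2; have n0 : 0 < N.+1%:R :> R by rewrite ltr0n.
rewrite -(ler_pM2r n0) (le_trans h2) // -mulrA mulrCA ler_wpM2l ?(ltW w0) //.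
by rewrite -natrM ler_nat mul2n doubleS.
Qed.

(* For [f = cos ^+ N.*2 / wallis N]: peaks of height [H], mean value one, and
   mean square [m] comparable to [H]. *)
Lemma oscillating_profile (M : R) : exists H m K (f h k : R -> R),
  [/\ M <= H /\ 0 < H, H <= 2 * m,
      [/\ smooth_on setT f, smooth_on setT h & smooth_on setT k],
      [/\ forall t, 0 <= f t <= H, forall t, `|h t| <= K & forall t, `|k t| <= K] &
      (forall t : R, is_derive t 1 h (f t - 1)) /\
      forall t : R, is_derive t 1 k (f t ^+ 2 - m)].
Proof.
(* By [wallis_sqr_le] the height satisfies [H^2 >= 2 N + 1], and this [N] exceeds [M^2]. *)
pose N := (Num.truncn (`|M| ^+ 2)).+1.
pose H := (wallis N)^-1; have w0 := wallis_gt0 N; have H0 : 0 < H by rewrite invr_gt0.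
have [K1 hK1] := wallis_primitive_bounded N; have [K2 hK2] := wallis_primitive_bounded N.*2.
pose m := wallis N.*2 * H ^+ 2.
exists H, m, (Num.max (H * K1) (H ^+ 2 * K2)), (fun t => H * cos t ^+ N.*2),
  (fun t => H * wallis_primitive N t), (fun t => H ^+ 2 * wallis_primitive N.*2 t).
have [sc ss] := @smooth_cos_sin R.
have sX k : smooth_on setT (fun t : R => cos t ^+ k).
  elim: k => [|k IH]; first exact: (smooth_cst 1).
  by under eq_fun do rewrite exprS; exact: smoothM.
split.
- split => //; apply: le_trans (ler_norm M) _.
  rewrite -(@ler_pXn2r _ 2) ?nnegrE ?(ltW H0) //.
  have : N%:R <= H ^+ 2.
    rewrite /H exprVn -[leRHS]mul1r ler_pdivlMr ?exprn_gt0 // mulrC.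
    apply: le_trans (wallis_sqr_le N); rewrite ler_wpM2l ?sqr_ge0 // ler_nat.
    by rewrite -addnn ltnW // ltnS leq_addr.
  by apply: le_trans; apply/ltW; exact: truncnS_gt.
- rewrite /m expr2 mulrA mulrA ler_peMl ?(ltW H0) // /H ler_pdivlMr // mul1r.
  exact: wallis_double.
- by split; apply: smoothZ => //; exact: smooth_wallis_primitive.
- split=> t.
  + have c0 : 0 <= cos t ^+ N.*2 by rewrite -mul2n exprM exprn_ge0 // sqr_ge0.
    have c1 : `|cos t| <= 1 by rewrite ler_norml cos_le1 cos_geN1.
    have c2 : cos t ^+ N.*2 <= 1.
      by apply: le_trans (ler_norm _) _; rewrite normrX exprn_ile1.
    by apply/andP; split; [exact: (mulr_ge0 (ltW H0) c0)|rewrite -[leRHS]mulr1 ler_pM2l].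
  + by rewrite le_max normrM gtr0_norm // ler_wpM2l // ltW.
  + by rewrite le_max normrM gtr0_norm ?exprn_gt0 // (ler_wpM2l _ (hK2 t)) ?orbT // exprn_ge0 // ltW.
- split=> t.
  + apply: (is_derive_eq (is_deriveZ H (is_derive_wallis_primitive N t))).
    by rewrite /GRing.scale /= mulrBr mulVf // gt_eqF.
  + apply: (is_derive_eq (is_deriveZ (H ^+ 2) (is_derive_wallis_primitive N.*2 t))).
    by rewrite /GRing.scale /= mulrBr exprMn -exprM muln2 /m [wallis _ * _]mulrC.
Qed.

End oscillating_profile.

(** * Integration by parts *)

Section integration_by_parts.
Context {R : realType} {n : nat}.
Notation mu := (lebesgue n : {measure set 'rV[R]_n -> \bar R}).
Implicit Types (f g : 'rV[R]_n -> R) (K : set 'rV[R]_n).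

Lemma continuous_rV_measurableT f : continuous f -> measurable_fun setT f.
Proof. by move=> cf; apply: continuous_rV_measurable => [|x _]; [exact: openT|exact: cf]. Qed.

Lemma continuous_compact_bounded f K : continuous f -> compact K ->
  exists M : R, 0 <= M /\ forall x, K x -> `|f x| <= M.
Proof.
move=> cf cK.
have cfK : compact (f @` K) by apply: continuous_compact => //; exact: continuous_subspaceT.
have [M [_ hM]] := compact_bounded cfK.
exists (`|M| + 1); split; first exact: ltW (ltr_wpDl (normr_ge0 M) ltr01).
by move=> x Kx; apply: (hM (`|M| + 1)); [rewrite ltr_pwDr // ler_norm|exists x].
Qed.

Lemma compact_integrable f K : continuous f -> compact K -> mu.-integrable K (EFin \o f).
Proof.
move=> cf cK; apply: measurable_bounded_integrable.
- exact: compact_rV_measurable.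
- exact: compact_lebesgue_fin.
- by apply: measurable_funS (continuous_rV_measurableT cf).
- have [M [_ hM]] := continuous_compact_bounded cf cK.
  by exists M; split; [exact: num_real|move=> m Mm x Kx; apply: le_trans (hM x Kx) (ltW Mm)].
Qed.

Lemma restrict_outside f K D :
  (forall x, ~ K x -> f x = 0) -> K `<=` D -> f \_ D = f.
Proof.
move=> f0 KD; apply/funext => x; rewrite patchE; case: ifPn => //.
by rewrite notin_setE => Dx; rewrite f0 // => /KD.
Qed.

Lemma integrable_compact_support f K D : continuous f -> compact K ->
  (forall x, ~ K x -> f x = 0) -> measurable D -> mu.-integrable D (EFin \o f).
Proof.
move=> cf cK f0 mD; apply: (@integrableS _ _ _ _ setT) => //.
have /(integrable_mkcond _ (compact_rV_measurable cK)) := compact_integrable cf cK.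
by rewrite restrict_EFin (restrict_outside f0).
Qed.

Lemma Rintegral_compact_support f K D : (forall x, ~ K x -> f x = 0) -> K `<=` D ->
  \int[mu]_(x in D) f x = \int[mu]_x f x.
Proof. by move=> f0 KD; rewrite Rintegral_mkcond (restrict_outside f0). Qed.

Lemma integral_translation f (w : 'rV[R]_n) : mu.-integrable setT (EFin \o (fun x => f (x + w))) ->
  measurable_fun setT f -> \int[mu]_x f (x + w) = \int[mu]_x f x.
Proof.
move=> intf mf; rewrite /Rintegral; congr fine.
have mT := measurable_translation w.
have mfE : measurable_fun setT (EFin \o f) by exact/measurable_EFinP.
have h := @integral_pushforward _ _ _ _ R _ mT mu setT (EFin \o f) mfE.
rewrite preimage_setT in h; rewrite -(h intf measurableT).
pose m2 := measure_function_pushforward__canonical__measure_function_Measure mu mT.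
by apply: (@eq_measure_integral _ _ R setT mu m2) => A mA _; exact: lebesgue_translation.
Qed.

Lemma closed_norm_ball_compact (M : R) : compact [set x : 'rV[R]_n | `|x| <= M].
Proof.
apply: bounded_closed_compact.
  by exists M; split; [exact: num_real|move=> m Mm x /= /le_trans; apply; exact: ltW].
apply: (@closed_comp _ _ _ [set t : R | t <= M]); last exact: closed_le.
by move=> x _; exact: (@norm_continuous R 'rV[R]_n).
Qed.

Lemma derive_outside f (v : 'rV[R]_n) K : closed K -> (forall x, ~ K x -> f x = 0) ->
  forall x, ~ K x -> 'D_v f x = 0.
Proof.
move=> cK f0 x Kx; rewrite (@derive_near _ _ f (cst 0) (~` K)) ?derive_cst //.
  by rewrite openC.
by move=> y /set_mem /f0.
Qed.

(** The integral of [f (x + t v)] does not depend on [t], by translation invariance; differentiating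
    under the integral at [t = 0] gives the claim without iterated integrals. *)
Lemma integral_derive_eq0 f (v : 'rV[R]_n) K : smooth_on setT f -> compact K ->
  (forall x, ~ K x -> f x = 0) -> \int[mu]_x 'D_v f x = 0.
Proof.
move=> sf cK f0; have clK := compact_rV_closed cK.
have Df0 := derive_outside v clK f0.
have cf := smooth_continuous sf; have cDf := smooth_continuous (smooth_derive v sf).
have [C [C0 hC]] := continuous_compact_bounded cDf cK.
have {}hC x : `|'D_v f x| <= C.
  by have [/hC//|/Df0 ->] := pselect (K x); rewrite normr0.
have [M [_ hM]] := compact_bounded cK.
(* For [|t| < 1] the supports of all translates lie in this ball, so one integrable function
   dominates all the derivatives. *)
pose K' := [set x : 'rV[R]_n | `|x| <= M + 1 + `|v|].
have cK' : compact K' by exact: closed_norm_ball_compact.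
have KK' (t : R) (x : 'rV[R]_n) : `|t| < 1 -> ~ K' x -> ~ K (x + t *: v).
  move=> t1 K'x Kx; apply: K'x; rewrite /K' /=.
  have h1 := hM (M + 1) _ _ Kx; rewrite ltrDl ltr01 in h1; have {}h1 := h1 isT.
  rewrite -[x](addrK (t *: v)); apply: le_trans (ler_normB _ _) _; apply: lerD => //.
  by rewrite normrZ ler_piMl // ltW.
pose G : 'rV[R]_n -> R := (cst C) \_ K'.
have intG : mu.-integrable setT (EFin \o G).
  rewrite /G -restrict_EFin; apply/(integrable_mkcond _ (compact_rV_measurable cK')).
  by apply: compact_integrable => //; exact: cst_continuous.
have dl (t : R) (x : 'rV[R]_n) : is_derive t 1 (fun s : R => f (x + s *: v)) ('D_v f (x + t *: v)).
  by apply: is_derive_line; exact: smooth_differentiable.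
have itv1 t : (`](-1)%R, 1%R[%classic : set R) t -> `|t| < 1.
  by rewrite /= in_itv /= ltr_norml.
have d1E t x : partial1of2 (fun s y => f (y + s *: v)) t x = 'D_v f (x + t *: v).
  by rewrite partial1of2E; have [_ ->] := dl t x.
have tr (t : R) : continuous (fun x : 'rV[R]_n => f (x + t *: v)).
  move=> x; apply: (@continuous_comp _ _ _ (fun x : 'rV[R]_n => x + t *: v) f); last exact: cf.
  by apply: differentiable_continuous; exact: (@differentiableD _ _ _ id (cst (t *: v))).
have trI (t : R) : `|t| < 1 -> mu.-integrable setT (EFin \o (fun x : 'rV[R]_n => f (x + t *: v))).
  move=> t1; apply: (@integrable_compact_support _ K') => //.
  by move=> x K'x; apply: f0; exact: KK'.
have I0 : (`](-1)%R, 1%R[%classic : set R) 0 by rewrite /= in_itv /= ltrN10 ltr01.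
have h : derive1 (fun t : R => \int[mu]_x f (x + t *: v)) 0 = \int[mu]_x 'D_v f x.
  rewrite (@differentiation_under_integral R _ _ mu (fun t x => f (x + t *: v)) setT measurableT
    0 (-1) 1 I0 (fun t It => trI t (itv1 t It)) _ G _ intG _).
  - by apply: eq_Rintegral => x _; rewrite d1E scale0r addr0.
  - by move=> t x _ _; have [] := dl t x.
  - by move=> x; rewrite /G patchE; case: ifP.
  - move=> t x It _; rewrite d1E /G patchE; case: ifPn => [_|]; first exact: hC.
    by rewrite notin_setE => K'x; rewrite Df0 ?normr0 //; apply: KK' => //; exact: itv1.
rewrite -h derive1E.
have -> : 'D_1 (fun t : R => \int[mu]_x f (x + t *: v)) 0 = 'D_1 (cst (\int[mu]_x f x) : R -> R) 0.
  apply: (@derive_near R R _ _ `](-1)%R, 1%R[%classic) => //.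
  move=> t /set_mem It; rewrite /cst; apply: integral_translation; last exact: continuous_rV_measurableT.
  exact/trI/itv1.
by rewrite derive_cst.
Qed.

End integration_by_parts.

(** * Test functions and weak differentials *)

Section test_functions.
Context {R : realType} {n : nat}.
Variable Omega : set 'rV[R]_n.
Hypothesis Omega_open : open Omega.
Notation mu := (lebesgue n : {measure set 'rV[R]_n -> \bar R}).
Implicit Types (f g u phi psi : 'rV[R]_n -> R) (K : set 'rV[R]_n) (du : 'rV[R]_n -> 'rV[R]_n).

Let Omega_measurable : measurable Omega.
Proof. exact: open_rV_measurable. Qed.

Lemma test_functionI f K : smooth_on setT f -> compact K -> K `<=` Omega ->
  (forall x, ~ K x -> f x = 0) -> test_function Omega f.
Proof.
move=> sf cK KO f0.
have h : closure [set x | f x != 0] `<=` K.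
  rewrite [X in _ `<=` X](closure_id _).1; last exact: compact_rV_closed.
  by apply: closure_subset => x /= fx; apply: contrapT => /f0 /eqP; apply/negP.
split => //; last exact: subset_trans KO.
by apply: (subclosed_compact _ cK) => //; exact: closed_closure.
Qed.

Lemma test_functionE f : test_function Omega f ->
  exists K, [/\ compact K, K `<=` Omega, smooth_on setT f & forall x, ~ K x -> f x = 0].
Proof.
move=> [sf cK KO]; exists (closure [set x | f x != 0]); split => // x nK.
by apply: contrapT => fx; apply: nK; apply: subset_closure; apply/eqP.
Qed.

Lemma test_function0 : test_function Omega (fun=> 0).
Proof. by apply: (@test_functionI _ set0) => //; [exact: smooth_cst|exact: compact0]. Qed.

Lemma test_functionD f g : test_function Omega f -> test_function Omega g ->
  test_function Omega (fun x => f x + g x).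
Proof.
move=> /test_functionE[K [cK KO sf f0]] /test_functionE[K' [cK' KO' sg g0]].
apply: (@test_functionI _ (K `|` K')).
- exact: smoothD.
- exact: compactU.
- by rewrite subUset.
- by move=> x h; rewrite f0 ?g0 ?addr0 // => ?; apply: h; [right|left].
Qed.

Lemma test_functionM f g : smooth_on setT f -> test_function Omega g ->
  test_function Omega (fun x => f x * g x).
Proof.
move=> sf /test_functionE[K [cK KO sg g0]]; apply: (@test_functionI _ K) => //.
  exact: smoothM.
by move=> x h; rewrite g0 ?mulr0.
Qed.

Lemma test_functionZ (a : R) g : test_function Omega g -> test_function Omega (fun x => a * g x).
Proof. by apply: test_functionM; exact: smooth_cst. Qed.

Lemma test_function_derive f (v : 'rV[R]_n) : test_function Omega f -> test_function Omega ('D_v f).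
Proof.
move=> /test_functionE[K [cK KO sf f0]]; apply: (@test_functionI _ K) => //.
  exact: smooth_derive.
by apply: derive_outside => //; exact: compact_rV_closed.
Qed.

Lemma test_function_integrable f D : test_function Omega f -> measurable D ->
  mu.-integrable D (EFin \o f).
Proof.
move=> /test_functionE[K [cK KO sf f0]] mD; apply: (integrable_compact_support _ cK) => //.
exact: smooth_continuous.
Qed.

Lemma integral_test_derive f (v : 'rV[R]_n) : test_function Omega f -> \int[mu]_(x in Omega) 'D_v f x = 0.
Proof.
move=> /test_functionE[K [cK KO sf f0]].
rewrite (@Rintegral_compact_support _ _ _ K) //; first exact: integral_derive_eq0 f0.
by apply: derive_outside => //; exact: compact_rV_closed.
Qed.

Lemma integral_test_by_parts f g (v : 'rV[R]_n) : smooth_on setT f -> test_function Omega g ->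
  \int[mu]_(x in Omega) ('D_v f x * g x) = - \int[mu]_(x in Omega) (f x * 'D_v g x).
Proof.
move=> sf tg; have sg : smooth_on setT g by case: tg.
have h := integral_test_derive v (test_functionM sf tg).
have E : 'D_v (fun x => f x * g x) = (fun x => f x * 'D_v g x + 'D_v f x * g x).
  apply/funext => x; rewrite (@deriveM _ _ f g) /GRing.scale /= ?[g x * _]mulrC //;
    by apply: diff_derivable; exact: smooth_differentiable.
move: h; rewrite E RintegralD //.
- by move=> /eqP; rewrite addr_eq0 => /eqP ->; rewrite opprK.
- by apply: test_function_integrable => //; apply: test_functionM => //; exact: test_function_derive.
- by apply: test_function_integrable => //; apply: test_functionM => //; exact: smooth_derive.
Qed.

Lemma locally_integrable_test f : test_function Omega f -> locally_integrable_row Omega f.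
Proof.
move=> tf; split.
  apply: measurable_funS (continuous_rV_measurableT _) => //.
  by apply: smooth_continuous; case: tf.
by move=> K cK KO; apply: compact_integrable => //; apply: smooth_continuous; case: tf.
Qed.

Lemma gradientE f x i : gradient f x ord0 i = partial i f x.
Proof. by rewrite mxE. Qed.

Lemma weak_differential_test f : test_function Omega f -> weak_differential Omega f (gradient f).
Proof.
move=> tf; split; first exact: locally_integrable_test.
  move=> i; under eq_fun do rewrite gradientE.
  by apply: locally_integrable_test; exact: test_function_derive.
move=> phi i tphi; under [in RHS]eq_fun do rewrite gradientE.
by rewrite /partial integral_test_by_parts ?opprK //; case: tf.
Qed.

Lemma locally_integrable_lin (a : R) u f : locally_integrable_row Omega u ->
  locally_integrable_row Omega f -> locally_integrable_row Omega (fun x => a * u x + f x).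
Proof.
move=> [mu1 iu] [mf1 if1]; split.
  by apply: measurable_funD => //; exact: measurable_funM.
move=> K cK KO.
have -> : EFin \o (fun x => a * u x + f x) = (fun x => a%:E * (EFin \o u) x + (EFin \o f) x)%E.
  by apply/funext => x.
have mK := compact_rV_measurable cK.
by apply: integrableD => //; [apply: integrableZl => //|]; [exact: iu|exact: if1].
Qed.

Lemma locally_integrable_test_integrable u f : locally_integrable_row Omega u -> test_function Omega f ->
  mu.-integrable Omega (EFin \o (fun x => u x * f x)).
Proof.
move=> [mu1 iu] /test_functionE[K [cK KO sf f0]].
have mK := compact_rV_measurable cK.
have h : mu.-integrable K (EFin \o (fun x => u x * f x)).
  have -> : EFin \o (fun x => u x * f x) = (fun x => (EFin \o u) x * (EFin \o f) x)%E.
    by apply/funext => x.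
  apply: integrableMl => //; first exact: iu.
    by apply: measurable_funS (continuous_rV_measurableT (smooth_continuous sf)).
  have [M [_ hM]] := continuous_compact_bounded (smooth_continuous sf) cK.
  by exists M; split; [exact: num_real|move=> m Mm x Kx; apply: le_trans (hM x Kx) (ltW Mm)].
apply: (@integrableS _ _ _ _ setT) => //.
move/(integrable_mkcond _ mK) : h; rewrite restrict_EFin.
by rewrite (@restrict_outside _ _ (fun x => u x * f x) K K) // => x /f0 ->; rewrite mulr0.
Qed.

Lemma weak_differential_lin (a : R) u du f df : weak_differential Omega u du ->
  weak_differential Omega f df ->
  weak_differential Omega (fun x => a * u x + f x) (fun x => a *: du x + df x).
Proof.
move=> [lu ldu hu] [lf ldf hf]; split.
- exact: locally_integrable_lin.
- by move=> i; under eq_fun do rewrite !mxE; exact: locally_integrable_lin.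
- move=> phi i tphi; have tDphi : test_function Omega (partial i phi) by exact: test_function_derive.
  have Z g : mu.-integrable Omega (EFin \o g) -> mu.-integrable Omega (EFin \o (fun x => a * g x)).
    move=> ig; have -> : EFin \o (fun x => a * g x) = (fun x => a%:E * (EFin \o g) x)%E by [].
    exact: integrableZl.
  have I1 := locally_integrable_test_integrable lu tDphi.
  have I2 := locally_integrable_test_integrable lf tDphi.
  have I3 := locally_integrable_test_integrable (ldu i) tphi.
  have I4 := locally_integrable_test_integrable (ldf i) tphi.
  under eq_Rintegral do rewrite mulrDl -mulrA.
  under [in RHS]eq_Rintegral do rewrite !mxE mulrDl -mulrA.
  rewrite (RintegralD _ (Z _ I1) I2) // (RintegralD _ (Z _ I3) I4) //.
  by rewrite !RintegralZl // hu // hf // mulrN opprD.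
Qed.

End test_functions.

(** * Minkowski norms and the co-metric *)

Section minkowski_norms.
Context {R : realType} {n : nat}.
Variable psi : 'rV[R]_n -> R.
Hypothesis psiM : minkowski_norm psi.
Implicit Types (y z v : 'rV[R]_n).

Let E : 'rV[R]_n -> R := psi * psi.

Lemma minkowski_differentiable z : z != 0 -> differentiable psi z.
Proof. by move=> z0; case: psiM => _ _ _ /(_ [::] z z0). Qed.

Lemma minkowski_gt0 z : z != 0 -> 0 < psi z.
Proof.
move=> z0; case: psiM => ge0 eq0 _ _ _; rewrite lt_neqAle ge0 andbT eq_sym.
by apply/eqP => /eq0 /eqP; apply/negP.
Qed.

Lemma minkowskiZ (a : R) z : 0 <= a -> psi (a *: z) = a * psi z.
Proof.
case: psiM => _ eq0 hZ _ _; rewrite le_eqVlt => /predU1P[<-|]; last exact: hZ.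
by rewrite scale0r mul0r; apply/eq0.
Qed.

Let derive_sqr v z : z != 0 -> 'D_v E z = 2 * (psi z * 'D_v psi z).
Proof.
move=> z0; have dm := @diff_derivable _ _ _ _ _ v (minkowski_differentiable z0).
by rewrite /E (deriveM dm dm) /GRing.scale /=; ring.
Qed.

Let near_n0 z : z != 0 -> \near z, z != 0.
Proof.
move=> z0; apply: open_nbhs_nbhs; split => //.
rewrite (_ : (fun w => is_true _) = ~` [set 0]); last by apply/seteqP; split=> w /= /eqP.
exact/closed_openC/accessible_closed_set1/hausdorff_accessible/norm_hausdorff.
Qed.

Let sqr_differentiable z : z != 0 -> differentiable E z.
Proof. by move=> z0; apply: differentiableM; exact: minkowski_differentiable. Qed.

Let derive_sqr_differentiable v z : z != 0 -> differentiable ('D_v E) z.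
Proof.
move=> z0; apply: (near_eq_differentiable (f := 2 \*: (psi * 'D_v psi))).
  by apply: filterS (near_n0 z0) => w w0; rewrite derive_sqr.
apply: differentiableZ; apply: differentiableM; first exact: minkowski_differentiable.
by case: psiM => _ _ _ /(_ [:: v] z z0).
Qed.

Let sqr_convex v z : z != 0 -> 0 <= 'D_v ('D_v E) z.
Proof.
move=> z0; have [->|v0] := eqVneq v 0.
  by rewrite (deriveE _ (derive_sqr_differentiable 0 z0)) linear0.
apply: ltW; case: psiM => _ _ _ _ /(_ z z0) /(_ v v0).
have -> : (fun z => psi z ^+ 2) = E by apply/funext => w; rewrite expr2.
suff -> : (v *m hessian E z *m v^T) ord0 ord0 = 'D_v ('D_v E) z by [].
rewrite (derive_partial _ (derive_sqr_differentiable v z0)) mxE; apply: eq_bigr => j _.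
rewrite [v^T _ _]mxE mulrC; apply: (f_equal (fun a => _ * a)).
have -> : partial j ('D_v E) z = 'D_(delta_mx ord0 j) (\sum_i (v ord0 i \*: partial i E)) z.
  rewrite /partial; apply: near_eq_derive; apply: filterS (near_n0 z0) => w w0.
  by rewrite (derive_partial _ (sqr_differentiable w0)) fct_sumE.
have dp i : derivable (partial i E) z (delta_mx ord0 j).
  by apply: diff_derivable; exact: derive_sqr_differentiable.
rewrite derive_sum; last by move=> i; exact: derivableZ.
rewrite mxE; apply: eq_bigr => i _.
by rewrite deriveZ // mxE.
Qed.

(** The square of [psi] is convex along the segment from [z] to [t y], where [t] is chosen with
    [psi (t y) = psi z]. Equal values at both ends make its derivative at [z] towards [t y]
    nonpositive, which is the claim after Euler's identity. *)
Lemma minkowski_fundamental z y : z != 0 -> 'D_y psi z <= psi y.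
Proof.
move=> z0; have pz := minkowski_gt0 z0.
have [->|y0] := eqVneq y 0.
  by rewrite (deriveE _ (minkowski_differentiable z0)) linear0; case: psiM => ->.
have py := minkowski_gt0 y0.
have ez : 'D_z psi z = psi z.
  rewrite (@euler_homogeneous _ _ psi 1) ?mul1r //; first exact: minkowski_differentiable.
  by move=> a a0; rewrite expr1 minkowskiZ // ltW.
have dl v : 'D_v psi z = 'd psi z v by rewrite (deriveE _ (minkowski_differentiable z0)).
pose t := psi z / psi y; have t0 : 0 < t by rewrite divr_gt0.
(* The segment meets the origin, where [psi] need not be differentiable, only if [y] is a
   nonpositive multiple of [z]; in that case the left-hand side is nonpositive. *)
have [[a a0 ya]|noncol] := pselect (exists2 a : R, 0 <= a & y = - (a *: z)).
  rewrite ya dl linearN linearZ /= -dl ez; apply: (@le_trans _ _ 0).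
    by rewrite oppr_le0 mulr_ge0 // ltW.
  by case: psiM.
pose w := t *: y - z.
have seg (s : R) : 0 <= s <= 1 -> z + s *: w != 0.
  move=> /andP[s0 s1]; apply/eqP => h.
  have [s00|s0'] := eqVneq s 0; first by move: h z0; rewrite s00 scale0r addr0 => ->; rewrite eqxx.
  have st : 0 < s * t by rewrite mulr_gt0 // lt_neqAle eq_sym s0'.
  apply: noncol; exists ((1 - s) / (s * t)); first by rewrite divr_ge0 ?subr_ge0 // ltW.
  have : (s * t) *: y = - ((1 - s) *: z).
    apply/eqP; rewrite -addr_eq0 -h /w scalerBr scalerA scalerBl scale1r.
    by apply/eqP; rewrite [LHS]addrC addrAC addrA.
  move=> /(f_equal (fun u => (s * t)^-1 *: u)).
  by rewrite scalerA mulVf ?gt_eqF // scale1r scalerN scalerA mulrC.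
have d1 (s : R) : 0 <= s <= 1 -> is_derive s 1 (fun s : R => E (z + s *: w)) ('D_w E (z + s *: w)).
  by move=> /seg h; apply: is_derive_line; exact: sqr_differentiable.
have d2 (s : R) : 0 <= s <= 1 ->
    is_derive s 1 (fun s : R => 'D_w E (z + s *: w)) ('D_w ('D_w E) (z + s *: w)).
  by move=> /seg h; apply: is_derive_line; exact: derive_sqr_differentiable.
have mono (s : R) : 0 <= s <= 1 -> 'D_w E z <= 'D_w E (z + s *: w).
  move=> /andP[s0 s1].
  have h (u : R) : 0 <= u <= s -> 0 <= u <= 1 by move=> /andP[-> /le_trans]; apply.
  have := derive_ge_growth (m := 0) s0 (fun u us => d2 u (h u us))
    (fun u us => sqr_convex w (seg u (h u us))).
  by rewrite mul0r scale0r addr0 subr_ge0.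
have := derive_ge_growth ler01 d1 mono.
rewrite subr0 mulr1 scale1r scale0r addr0; have -> : z + w = t *: y by rewrite addrC subrK.
have EE u : E u = psi u * psi u by [].
rewrite derive_sqr // !EE (minkowskiZ _ (ltW t0)) /w.
rewrite dl linearB linearZ /= -!dl ez /t => h.
have {}h : psi z * (psi z / psi y * 'D_y psi z - psi z) <= 0.
  have e : psi z / psi y * psi y = psi z by rewrite divfK // gt_eqF.
  by move: h; rewrite e subrr pmulr_rle0.
move: h; rewrite pmulr_rle0 // subr_le0 mulrAC ler_pdivrMr // ler_pM2l //.
Qed.

End minkowski_norms.

Section cometric_theory.
Context {R : realType} {n : nat}.
Context (Omega : set 'rV[R]_n) (F : 'rV[R]_n -> 'rV[R]_n -> R).
Context (Omega_open : open Omega) (finslerF : finsler_metric Omega F) (n_gt0 : (0 < n)%N).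
Implicit Types (x y : 'rV[R]_n) (xi eta : 'rV[R]_n).

Definition dot xi y : R := (xi *m y^T) ord0 ord0.

Lemma dotE xi y : dot xi y = \sum_i xi ord0 i * y ord0 i.
Proof. by rewrite /dot mxE; apply: eq_bigr => i _; rewrite mxE. Qed.

Lemma dotDl xi eta y : dot (xi + eta) y = dot xi y + dot eta y.
Proof. by rewrite /dot mulmxDl mxE. Qed.

Lemma dotZl a xi y : dot (a *: xi) y = a * dot xi y.
Proof. by rewrite /dot -scalemxAl mxE. Qed.

Lemma dotNl xi y : dot (- xi) y = - dot xi y.
Proof. by rewrite /dot mulNmx mxE. Qed.

Lemma dotNr xi y : dot xi (- y) = - dot xi y.
Proof. by rewrite /dot linearN mulmxN mxE. Qed.

Lemma dotZr a xi y : dot xi (a *: y) = a * dot xi y.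
Proof. by rewrite /dot linearZ -scalemxAr mxE. Qed.

Lemma dot_le xi y : dot xi y <= (\sum_i `|xi ord0 i|) * `|y|.
Proof.
rewrite dotE mulr_suml; apply: le_trans (ler_norm _) _.
apply: le_trans (ler_norm_sum _ _ _) _; apply: ler_sum => i _.
by rewrite normrM ler_wpM2l // rV_coord_le_norm.
Qed.

Lemma exists_neq0 : exists y : 'rV[R]_n, y != 0.
Proof.
exists (const_mx 1); apply/eqP => /rowP /(_ (Ordinal n_gt0)); rewrite !mxE.
by move/eqP; rewrite oner_eq0.
Qed.

Lemma metric_minkowski x : Omega x -> minkowski_norm (F x).
Proof. by move: x; case: finslerF. Qed.

Lemma metric_at0 x : Omega x -> F x 0 = 0.
Proof. by move=> /metric_minkowski[_ h _ _ _]; apply/h. Qed.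

Lemma cometric_ge x xi y : y != 0 -> ((dot xi y / F x y)%:E <= cometric F x xi)%E.
Proof. by move=> y0; apply: ereal_sup_ubound; exists y. Qed.

Lemma cometric_le x xi (M : R) : Omega x -> (forall y, y != 0 -> dot xi y <= M * F x y) ->
  (cometric F x xi <= M%:E)%E.
Proof.
move=> Ox h; apply: ge_ereal_sup => _ [y y0 <-].
by rewrite lee_fin ler_pdivrMr ?(metric_gt0 finslerF) // h.
Qed.

Lemma cometric_ge0 x xi : Omega x -> (0 <= cometric F x xi)%E.
Proof.
move=> Ox; have [y y0] := exists_neq0; have ny0 : - y != 0 by rewrite oppr_eq0.
have [h|/ltW h] := leP 0 (dot xi y).
  apply: le_trans (cometric_ge x xi y0).
  by rewrite lee_fin divr_ge0 // (metric_ge0 finslerF).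
apply: le_trans (cometric_ge x xi ny0).
by rewrite lee_fin dotNr divr_ge0 ?oppr_ge0 // (metric_ge0 finslerF).
Qed.

Lemma cometricD x xi eta : (cometric F x (xi + eta) <= cometric F x xi + cometric F x eta)%E.
Proof.
apply: ge_ereal_sup => _ [y y0 <-]; rewrite -/(dot _ _) dotDl mulrDl EFinD.
by apply: leeD; exact: cometric_ge.
Qed.

Lemma cometricZ x xi (a : R) : 0 < a -> (cometric F x (a *: xi) <= a%:E * cometric F x xi)%E.
Proof.
move=> a0; apply: ge_ereal_sup => _ [y y0 <-]; rewrite -/(dot _ _) dotZl -mulrA EFinM.
by rewrite lee_pmul2l ?lte_fin //; exact: cometric_ge.
Qed.

Lemma cometric0 x : Omega x -> cometric F x 0 = 0%E.
Proof.
move=> Ox; apply/eqP; rewrite eq_le cometric_ge0 // andbT.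
by apply: cometric_le => // y _; rewrite /dot mul0mx mxE mul0r.
Qed.

Lemma cometricN x xi (L : R) : Omega x -> 0 < L ->
  (forall w, w != 0 -> F x (- w) <= L * F x w) ->
  (cometric F x (- xi) <= L%:E * cometric F x xi)%E.
Proof.
move=> Ox L0 hL; apply: ge_ereal_sup => _ [y y0 <-]; rewrite -/(dot _ _) dotNl -dotNr.
have ny0 : - y != 0 by rewrite oppr_eq0.
have Fy := metric_gt0 finslerF Ox y0; have Fny := metric_gt0 finslerF Ox ny0.
have [h|/ltW h] := leP 0 (dot xi (- y)); last first.
  apply: (@le_trans _ _ 0%E); last by rewrite mule_ge0 ?cometric_ge0 // lee_fin ltW.
  by rewrite lee_fin pmulr_lle0 // invr_gt0.
apply: (@le_trans _ _ (L%:E * (dot xi (- y) / F x (- y))%:E)%E).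
  rewrite -EFinM lee_fin ler_pdivrMr //; set d := dot xi (- y) in h *.
  have -> : L * (d / F x (- y)) * F x y = d * (L * F x y) / F x (- y) by ring.
  by rewrite ler_pdivlMr // ler_wpM2l // hL.
by rewrite lee_pmul2l ?lte_fin //; exact: cometric_ge.
Qed.

Lemma metric_continuous2 x y : Omega x -> y != 0 -> {for y, continuous (F x)}.
Proof.
move=> Ox y0; apply: differentiable_continuous.
exact: (differentiable_slice2 (metric_differentiable finslerF (conj Ox y0 : slit_tangent Omega (x, y)))).
Qed.

Lemma metric_continuous1 x y : Omega x -> y != 0 -> {for x, continuous (F^~ y)}.
Proof.
move=> Ox y0; apply: differentiable_continuous.
exact: (differentiable_slice1 (metric_differentiable finslerF (conj Ox y0 : slit_tangent Omega (x, y)))).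
Qed.

Let S := [set w : 'rV[R]_n | `|w| = 1].

Let S0 w : S w -> w != 0. Proof. by move=> Sw; rewrite -normr_gt0 Sw. Qed.

Let nS w : w != 0 -> S (`|w|^-1 *: w).
Proof. by move=> w0'; rewrite /S /= normrZ normfV normr_id mulVf // normr_eq0. Qed.

Let cS : compact S.
Proof.
apply: bounded_closed_compact.
  by exists 1; split; [exact: num_real|move=> M M1 w /= ->; exact: ltW].
rewrite (_ : S = (fun w : 'rV[R]_n => `|w|) @^-1` [set 1]) //.
apply: closed_comp; last exact: closed_eq.
by move=> w _; exact: norm_continuous.
Qed.

Lemma metric_lower_bound x : Omega x -> exists2 c, 0 < c & forall y, c * `|y| <= F x y.
Proof.
move=> Ox; have [w0 w00] := exists_neq0.
have cf : {within S, continuous (fun w => - F x w)}.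
  apply: continuous_in_subspaceT => w; rewrite inE => /S0 w0'.
  by apply: continuousN; exact: metric_continuous2.
have [|w1 Sw1 hw1] := EVT_max_rV _ cS cf; first by exists (`|w0|^-1 *: w0); exact: nS.
exists (F x w1); first by apply: (metric_gt0 finslerF) => //; apply: S0; exact: set_mem.
move=> y; have [->|y0] := eqVneq y 0; first by rewrite normr0 mulr0 metric_at0.
have k0 : 0 < `|y|^-1 by rewrite invr_gt0 normr_gt0.
have := hw1 _ (mem_set (nS y0)); rewrite lerN2 (metricZ finslerF _ Ox k0).
by rewrite ler_pdivlMl ?normr_gt0 // mulrC.
Qed.

Lemma metric_upper_bound x : Omega x -> exists2 c, 0 < c & forall y, F x y <= c * `|y|.
Proof.
move=> Ox; have [w0 w00] := exists_neq0.
have cf : {within S, continuous (F x)}.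
  apply: continuous_in_subspaceT => w; rewrite inE => /S0 w0'.
  exact: metric_continuous2.
have [|w1 Sw1 hw1] := EVT_max_rV _ cS cf; first by exists (`|w0|^-1 *: w0); exact: nS.
exists (F x w1); first by apply: (metric_gt0 finslerF) => //; apply: S0; exact: set_mem.
move=> y; have [->|y0] := eqVneq y 0; first by rewrite normr0 mulr0 metric_at0.
have k0 : 0 < `|y|^-1 by rewrite invr_gt0 normr_gt0.
have := hw1 _ (mem_set (nS y0)); rewrite (metricZ finslerF _ Ox k0).
by rewrite ler_pdivrMl ?normr_gt0 // mulrC.
Qed.

(** Compactness of the unit sphere makes joint continuity uniform over directions, and homogeneity
    extends the comparison to all vectors. *)
Lemma metric_near_equiv x0 : Omega x0 ->
  \forall x \near x0, Omega x /\ forall y, F x0 y <= 2 * F x y /\ F x y <= 2 * F x0 y.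
Proof.
move=> O0; have nO : \forall x \near x0, Omega x by apply: open_nbhs_nbhs.
suff h : \forall x \near x0, S `<=` (fun y => F x0 y <= 2 * F x y /\ F x y <= 2 * F x0 y).
  near=> x; have Ox : Omega x by near: x.
  split => // y; have [->|y0] := eqVneq y 0; first by rewrite !metric_at0 // mulr0.
  have k0 : 0 < `|y|^-1 by rewrite invr_gt0 normr_gt0.
  have : S `<=` (fun y => F x0 y <= 2 * F x y /\ F x y <= 2 * F x0 y) by near: x.
  move=> /(_ _ (nS y0)); rewrite /= !(metricZ finslerF) //.
  by rewrite !(mulrCA 2) !ler_pM2l.
have /compact_near_coveringP cv := cS.
apply: (cv _ (nbhs x0) (fun x y => F x0 y <= 2 * F x y /\ F x y <= 2 * F x0 y)) => y /S0 y0.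
have U0 : slit_tangent Omega (x0, y) by split.
have c1 : {for (x0, y), continuous (metric_fun F)}.
  by apply: differentiable_continuous; exact: (metric_differentiable finslerF).
have c2 := metric_continuous2 O0 y0.
have Fy := metric_gt0 finslerF O0 y0.
have e0 : 0 < F x0 y / 4 by rewrite divr_gt0.
have /cvgrPdist_lt /(_ _ e0) [[A B] /= [A0 B0] h1] := c1.
have /cvgrPdist_lt /(_ _ e0) h2 := c2.
exists (B `&` (fun t => `|F x0 y - F x0 t| < F x0 y / 4), A) => /=.
  by split => //; apply: filterI.
move=> [w x] /= [[Bw hw] Ax]; have /= := h1 (x, w) (conj Ax Bw).
move: hw; rewrite /metric_fun /= !ltr_norml => /andP[a1 a2] /andP[b1 b2]; split; lra.
Unshelve. all: by end_near. Qed.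

(** By continuity of the quotient in [y] the supremum may be restricted to rational vectors, and a
    countable supremum of measurable functions is measurable. *)
Lemma cometric_measurable (xi : 'rV[R]_n -> 'rV[R]_n) :
  (forall i, measurable_fun Omega (fun x => xi x ord0 i)) ->
  measurable_fun Omega (fun x => cometric F x (xi x)).
Proof.
move=> mxi; have mO := open_rV_measurable Omega_open.
(* Codes of no vector and the zero vector contribute [-oo], which does not affect the supremum. *)
pose h (k : nat) (x : 'rV[R]_n) : \bar R :=
  if unpickle k is Some q then
    let y := map_mx ratr (q : 'rV[rat]_n) in
    if y != 0 then (dot (xi x) y / F x y)%:E else -oo%E
  else -oo%E.
have mh k : measurable_fun Omega (h k).
  rewrite /h; case: unpickle => [q|] /=; last exact: measurable_cst.
  case: (boolP (map_mx ratr q != 0 :> 'rV[R]_n)) => [y0|_]; last exact: measurable_cst.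
  apply/measurable_EFinP; apply: measurable_funM.
    under eq_fun do rewrite dotE.
    by apply: measurable_sum => i; exact: measurable_funM.
  apply: continuous_rV_measurable => // x /set_mem Ox.
  apply: cvgV; [exact: nbhs_filter|by rewrite gt_eqF // (metric_gt0 finslerF)|].
  exact: metric_continuous1.
apply: (@eq_measurable_fun _ _ _ _ _ (fun x => esups (h ^~ x) 0%N)); last first.
  exact: measurable_fun_esups.
move=> x /set_mem Ox; apply/eqP; rewrite eq_le; apply/andP; split.
  apply: ge_ereal_sup => _ [k _ <-]; rewrite /h; case: unpickle => [q|] /=; last exact: leNye.
  by case: ifPn => [y0|_]; [exact: cometric_ge|exact: leNye].
apply: ge_ereal_sup => _ [y y0 <-]; rewrite -/(dot _ _).
apply/lee_addgt0Pr => e e0.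
have cd : continuous (dot (xi x)).
  have -> : dot (xi x) = affine_form (xi x) 0 by apply/funext => w; rewrite dotE /affine_form addr0.
  by move=> w; apply: differentiable_continuous; have [] := is_derive_affine_form (xi x) 0 w 0.
have cy : {for y, continuous (fun w => dot (xi x) w / F x w)}.
  apply: cvgM; [exact: nbhs_filter|exact: cd|].
  by apply: cvgV; [exact: nbhs_filter|rewrite gt_eqF // (metric_gt0 finslerF)|exact: metric_continuous2].
have n0 : \near y, y != 0.
  by apply: filterS (near_slit2 Omega_open (conj Ox y0 : slit_tangent Omega (x, y))) => w [].
have /cvgrPdist_lt /(_ _ e0) h1 := cy.
pose A : set 'rV[R]_n := [set w | w != 0 /\ `|dot (xi x) y / F x y - dot (xi x) w / F x w| < e].
have hA : interior A y by exact: filterI n0 h1.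
have [p py pA] := open_rat_boxP (open_interior A) hA.
have hp : rat_box p (map_mx ratr p.1 : 'rV[R]_n).
  by move=> i; rewrite mxE subrr normr0 invr_ge0.
have [q0 qe] := interior_subset (pA _ hp).
have hk : (h (pickle p.1) x <= esups (h ^~ x) 0%N)%E.
  by apply: ereal_sup_ubound; exists (pickle p.1).
apply: le_trans (leeD hk (lexx _)); rewrite /h pickleK q0 -EFinD lee_fin.
by move: qe; rewrite ltr_norml => /andP[_ /ltW]; rewrite lerBlDl addrC.
Qed.

End cometric_theory.

(** * Finite reversibility *)

Section poweR_estimates.
Context {R : realType}.
Implicit Types (p : R).

Lemma ge0_le_poweR p (x y : \bar R) : 0 <= p -> (0 <= x)%E -> (x <= y)%E -> (x `^ p <= y `^ p)%E.
Proof.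
move=> p0 x0 xy; apply: (gt0_ler_poweR p0) => //; rewrite in_itv /= ?leey ?andbT //.
exact: le_trans xy.
Qed.

Lemma poweR_add_le p (x y : \bar R) : 0 <= p -> (0 <= x)%E -> (0 <= y)%E ->
  ((x + y) `^ p <= (2 `^ p)%:E * (x `^ p + y `^ p))%E.
Proof.
move=> p0; wlog xy : x y / (x <= y)%E.
  move=> h x0 y0; have [xy|/ltW yx] := leP x y; first exact: h.
  by rewrite addeC [(x `^ p + _)%E]addeC; exact: h.
move=> x0 y0; apply: (@le_trans _ _ ((2%:E * y) `^ p)%E).
  by apply: ge0_le_poweR; rewrite ?adde_ge0 // mule_natl mule2n leeD2r.
rewrite poweRM ?lee_fin // poweR_EFin; apply: lee_pmul; rewrite ?lee_fin ?powR_ge0 ?poweR_ge0 //.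
by rewrite leeDr // poweR_ge0.
Qed.

Lemma cvg_ge0_ereal0P (x : nat -> \bar R) : (forall k, (0 <= x k)%E) ->
  x k @[k --> \oo] --> 0%E <-> forall e : R, 0 < e -> \forall k \near \oo, (x k <= e%:E)%E.
Proof.
move=> x0; split=> [h e e0|h].
  have /fine_cvgP[hf /cvgrPdist_le /(_ _ e0) h2] := h.
  near=> k; have fk : x k \is a fin_num by near: k.
  have : `|0 - fine (x k)| <= e by near: k.
  rewrite -[x k]fineK // lee_fin sub0r normrN => /(le_trans (ler_norm _)); exact.
have fin : \forall k \near \oo, x k \is a fin_num.
  apply: filterS (h 1 ltr01) => k xk; rewrite ge0_fin_numE //.
  exact: le_lt_trans xk (ltry _).
apply/fine_cvgP; split => //; apply/cvgrPdist_le => e e0.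
near=> k; have fk : x k \is a fin_num by near: k.
have xe : (x k <= e%:E)%E by near: k; exact: h.
by rewrite sub0r normrN ger0_norm ?fine_ge0 // -lee_fin fineK.
Unshelve. all: by end_near. Qed.

Lemma cvg_poweR_inv p (x : nat -> \bar R) : 0 < p -> (forall k, (0 <= x k)%E) ->
  (x k `^ p^-1)%E @[k --> \oo] --> 0%E <-> x k @[k --> \oo] --> 0%E.
Proof.
move=> p0 x0; have pi0 : 0 < p^-1 by rewrite invr_gt0.
have xK k : ((x k `^ p^-1) `^ p)%E = x k.
  by rewrite -poweRrM mulVf ?gt_eqF // poweRe1.
have xp k : (0 <= x k `^ p^-1)%E by exact: poweR_ge0.
split=> [/(cvg_ge0_ereal0P xp) h|/(cvg_ge0_ereal0P x0) h].
- apply/cvg_ge0_ereal0P => // e e0; have d0 : 0 < e `^ p^-1 by exact: powR_gt0.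
  apply: filterS (h _ d0) => k hk.
  rewrite -xK; apply: le_trans (ge0_le_poweR (ltW p0) (poweR_ge0 _ _) hk) _.
  by rewrite poweR_EFin -powRrM mulVf ?gt_eqF // powRr1 // ltW.
- apply/cvg_ge0_ereal0P => // e e0; have d0 : 0 < e `^ p by exact: powR_gt0.
  apply: filterS (h _ d0) => k hk.
  apply: le_trans (ge0_le_poweR (ltW pi0) (x0 k) hk) _.
  by rewrite poweR_EFin -powRrM mulfV ?gt_eqF // powRr1 // ltW.
Qed.

Lemma cvg_add_ge0 (x y : nat -> \bar R) : (forall k, (0 <= x k)%E) -> (forall k, (0 <= y k)%E) ->
  (x k + y k)%E @[k --> \oo] --> 0%E <->
  x k @[k --> \oo] --> 0%E /\ y k @[k --> \oo] --> 0%E.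
Proof.
move=> x0 y0; have xy0 k : (0 <= x k + y k)%E by rewrite adde_ge0.
split=> [/(cvg_ge0_ereal0P xy0) h|[/(cvg_ge0_ereal0P x0) hx /(cvg_ge0_ereal0P y0) hy]].
  split; apply/cvg_ge0_ereal0P => // e e0; apply: filterS (h e e0) => k; apply: le_trans.
    by rewrite leeDl.
  by rewrite leeDr.
apply/cvg_ge0_ereal0P => // e e0; have e2 : 0 < e / 2 by rewrite divr_gt0.
near=> k; rewrite [e]splitr EFinD; apply: leeD; near: k; [exact: hx|exact: hy].
Unshelve. all: by end_near. Qed.

Lemma cvg_le_lin (c : R) (x y z : nat -> \bar R) : 0 <= c ->
  (forall k, (0 <= x k)%E) -> (forall k, (0 <= y k)%E) -> (forall k, (0 <= z k)%E) ->
  (forall k, (z k <= c%:E * (x k + y k))%E) ->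
  x k @[k --> \oo] --> 0%E -> y k @[k --> \oo] --> 0%E -> z k @[k --> \oo] --> 0%E.
Proof.
move=> c0 x0 y0 z0 zxy hx hy.
have xy0 k : (0 <= x k + y k)%E by rewrite adde_ge0.
have /(cvg_ge0_ereal0P xy0) h : (x k + y k)%E @[k --> \oo] --> 0%E by apply/cvg_add_ge0.
apply/cvg_ge0_ereal0P => // e e0.
have c1 : 0 < c + 1 by rewrite ltr_wpDl.
have d0 : 0 < e / (c + 1) by rewrite divr_gt0.
apply: filterS (h _ d0) => k hk; apply: le_trans (zxy k) _.
apply: (@le_trans _ _ ((c + 1)%:E * (e / (c + 1))%:E)%E).
  by apply: lee_pmul; rewrite ?lee_fin // lerDl.
by rewrite -EFinM lee_fin mulrCA divff ?mulr1 // gt_eqF.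
Qed.

Context {d} {T : measurableType d} (mu : {measure set T -> \bar R}).

Lemma integral_poweR_le (D : set T) (p c : R) (f g h : T -> \bar R) :
  measurable D -> 0 < p -> 0 <= c ->
  measurable_fun D f -> measurable_fun D g -> measurable_fun D h ->
  (forall x : T, D x -> [/\ (0 <= f x)%E, (0 <= g x)%E, (0 <= h x)%E & (h x <= c%:E * f x + g x)%E]) ->
  (\int[mu]_(x in D) h x `^ p <= (2 `^ p * (c `^ p + 1))%:E *
     (\int[mu]_(x in D) f x `^ p + \int[mu]_(x in D) g x `^ p))%E.
Proof.
move=> mD p0 c0 mf mg mh H.
have mP (k : T -> \bar R) : measurable_fun D k -> measurable_fun D (fun x => k x `^ p)%E.
  by move=> mk; exact: (measurableT_comp (measurable_poweR p) mk).
have P0 (k : T -> \bar R) (x : T) : D x -> (0 <= k x `^ p)%E by move=> _; exact: poweR_ge0.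
rewrite -ge0_integralD //; [|exact: P0|exact: mP|exact: P0|exact: mP].
rewrite -ge0_integralZl_EFin //; last 3 first.
- by move=> x Dx; rewrite adde_ge0 // poweR_ge0.
- by apply: emeasurable_funD; exact: mP.
- by rewrite mulr_ge0 ?powR_ge0 // addr_ge0 // powR_ge0.
apply: ge0_le_integral => //.
- exact: P0.
- exact: mP.
- by apply: measurable_funeM; apply: emeasurable_funD; exact: mP.
move=> x Dx; have [f0 g0 h0 hx] := H x Dx.
apply: le_trans (ge0_le_poweR (ltW p0) h0 hx) _.
have cf0 : (0 <= c%:E * f x)%E by rewrite mule_ge0.
apply: le_trans (poweR_add_le (ltW p0) cf0 g0) _.
rewrite EFinM -muleA; apply: lee_pmul; rewrite ?lee_fin ?powR_ge0 //.
  by rewrite adde_ge0 ?poweR_ge0.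
rewrite poweRM ?lee_fin // poweR_EFin ge0_muleDr ?poweR_ge0 //.
apply: leeD; first by apply: lee_pmul; rewrite ?lee_fin ?powR_ge0 ?poweR_ge0 // lerDl.
rewrite -[leLHS]mul1e; apply: lee_pmul; rewrite ?poweR_ge0 // ?lee_fin // lerDr powR_ge0 //.
Qed.

End poweR_estimates.

Section reversible_sobolev.
Context {R : realType} {n : nat}.
Context (Omega : set 'rV[R]_n) (F : 'rV[R]_n -> 'rV[R]_n -> R) (p : R).
Context (Omega_open : open Omega) (finslerF : finsler_metric Omega F).
Context (n_gt0 : (0 < n)%N) (p_gt1 : 1 < p).
Notation mu := (lebesgue n : {measure set 'rV[R]_n -> \bar R}).

Let p_gt0 : 0 < p. Proof. exact: lt_trans p_gt1. Qed.
Let mO : measurable Omega. Proof. exact: open_rV_measurable. Qed.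

Lemma sobolev_norm_cvg (w : nat -> 'rV[R]_n -> R) (dw : nat -> 'rV[R]_n -> 'rV[R]_n) :
  sobolev_norm Omega F p (w k) (dw k) @[k --> \oo] --> 0%E <->
  (\int[mu]_(x in Omega) (`|w k x| `^ p)%:E)%E @[k --> \oo] --> 0%E /\
  (\int[mu]_(x in Omega) cometric F x (dw k x) `^ p)%E @[k --> \oo] --> 0%E.
Proof.
rewrite /sobolev_norm cvg_add_ge0; [|by move=> k; exact: poweR_ge0|by move=> k; exact: poweR_ge0].
rewrite !cvg_poweR_inv //.
- by move=> k; apply: integral_ge0 => x _; exact: poweR_ge0.
- by move=> k; apply: integral_ge0 => x _; rewrite lee_fin powR_ge0.
Qed.

Lemma weak_differential_cometric_measurable u du : weak_differential Omega u du ->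
  measurable_fun Omega (fun x => cometric F x (du x)).
Proof. by move=> [_ h _]; apply: cometric_measurable => // i; case: (h i). Qed.

Lemma sobolev_norm_cvg_lin (a c : R) (w w' w'' : nat -> 'rV[R]_n -> R)
    (dw dw' dw'' : nat -> 'rV[R]_n -> 'rV[R]_n) : 0 <= a -> 0 <= c ->
  (forall k, weak_differential Omega (w k) (dw k)) ->
  (forall k, weak_differential Omega (w' k) (dw' k)) ->
  (forall k, weak_differential Omega (w'' k) (dw'' k)) ->
  (forall k x, `|w'' k x| <= a * `|w k x| + `|w' k x|) ->
  (forall k x, Omega x -> (cometric F x (dw'' k x) <=
     c%:E * cometric F x (dw k x) + cometric F x (dw' k x))%E) ->
  sobolev_norm Omega F p (w k) (dw k) @[k --> \oo] --> 0%E ->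
  sobolev_norm Omega F p (w' k) (dw' k) @[k --> \oo] --> 0%E ->
  sobolev_norm Omega F p (w'' k) (dw'' k) @[k --> \oo] --> 0%E.
Proof.
move=> a0 c0 hw hw' hw'' le1 le2 /sobolev_norm_cvg[cu1 cu2] /sobolev_norm_cvg[cv1 cv2].
apply/sobolev_norm_cvg.
have mabs f df : weak_differential Omega f df -> measurable_fun Omega (fun x => (`|f x|)%:E).
  by move=> [[mf _] _ _]; apply/measurable_EFinP; exact: measurableT_comp.
have ge0 (f : 'rV[R]_n -> R) : (0 <= \int[mu]_(x in Omega) (`|f x| `^ p)%:E)%E.
  by apply: integral_ge0 => x _; rewrite lee_fin powR_ge0.
have ge0' df : (0 <= \int[mu]_(x in Omega) cometric F x (df x) `^ p)%E.
  by apply: integral_ge0 => x _; exact: poweR_ge0.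
have K0 (b : R) : 0 <= 2 `^ p * (b `^ p + 1) by rewrite mulr_ge0 ?addr_ge0 ?powR_ge0.
have pE (f : 'rV[R]_n -> R) : (\int[mu]_(x in Omega) (`|f x| `^ p)%:E =
    \int[mu]_(x in Omega) (`|f x|%:E `^ p))%E.
  by apply: eq_integral => x _; rewrite poweR_EFin.
split.
- apply: (cvg_le_lin (K0 a) _ _ _ _ cu1 cv1) => k; [exact: ge0|exact: ge0|exact: ge0|].
  rewrite !pE; apply: (integral_poweR_le mu mO p_gt0 a0 (mabs _ _ (hw k)) (mabs _ _ (hw' k)) (mabs _ _ (hw'' k))).
  by move=> x Ox; split; rewrite ?lee_fin // -EFinM -EFinD lee_fin.
- apply: (cvg_le_lin (K0 c) _ _ _ _ cu2 cv2) => k; [exact: ge0'|exact: ge0'|exact: ge0'|].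
  apply: (integral_poweR_le mu mO p_gt0 c0 (weak_differential_cometric_measurable (hw k))
    (weak_differential_cometric_measurable (hw' k)) (weak_differential_cometric_measurable (hw'' k))).
  by move=> x Ox; split; [exact: (cometric_ge0 finslerF)..|exact: le2].
Qed.

Lemma reversible_submod_closed (L : R) :
  (forall z w, Omega z -> w != 0 -> F z (- w) <= L * F z w) ->
  GRing.submod_closed (mem (W1p0 Omega F p)).
Proof.
move=> hL.
(* Raising the constant to at least one makes it positive, as [cometricN] requires. *)
pose M := Num.max L 1; have M0 : 0 < M by rewrite lt_max ltr01 orbT.
have hM z w : Omega z -> w != 0 -> F z (- w) <= M * F z w.
  move=> Oz w0; apply: le_trans (hL z w Oz w0) _.
  by rewrite ler_wpM2r ?le_max ?lexx // (metric_ge0 finslerF).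
have cZ (a : R) : exists2 c : R, 0 <= c & forall x xi, Omega x ->
    (cometric F x (a *: xi) <= c%:E * cometric F x xi)%E.
  have [a0|a0|->] := ltgtP a 0.
  - exists (- a * M); first by rewrite mulr_ge0 ?oppr_ge0 // ltW.
    move=> x xi Ox; rewrite -[a in (a *: _)]opprK scaleNr -scalerN EFinM -muleA.
    have a0' : 0 < - a by rewrite oppr_gt0.
    apply: le_trans (cometricZ F x _ a0') _; rewrite lee_pmul2l ?lte_fin //.
    by apply: (cometricN finslerF) => // w; exact: hM.
  - by exists a; [exact: ltW|move=> x xi Ox; exact: cometricZ].
  - by exists 0 => // x xi Ox; rewrite scale0r (cometric0 finslerF) // mul0e.
have grad_lin (b : R) (f g : 'rV[R]_n -> R) x : test_function Omega f -> test_function Omega g ->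
    gradient (fun x => b * f x + g x) x = b *: gradient f x + gradient g x.
  move=> [sf _ _] [sg _ _]; apply/rowP => i; rewrite !mxE /partial.
  have df := @diff_derivable _ _ _ f x (delta_mx ord0 i) (smooth_differentiable x sf).
  have dg := @diff_derivable _ _ _ g x (delta_mx ord0 i) (smooth_differentiable x sg).
  by have [_ ->] := is_deriveD (is_deriveZ b (derivableP df)) (derivableP dg).
split.
  apply/mem_set; have e0 : gradient (fun=> 0) = (fun=> 0) :> ('rV[R]_n -> 'rV[R]_n).
    by apply/funext => x; apply/rowP => i; rewrite !mxE /partial derive_cst.
  exists (fun=> 0).
    by rewrite -e0; apply: weak_differential_test => //; exact: test_function0.
  exists (fun _ _ => 0); first by move=> k; exact: test_function0.
  apply/(@sobolev_norm_cvg (fun=> _) (fun=> _)); rewrite e0; split.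
    rewrite integral0_eq; first exact: cvg_cst.
    by move=> x _; rewrite /= subrr normr0 powR0 // gt_eqF.
  rewrite integral0_eq; first exact: cvg_cst.
  by move=> x Ox; rewrite /= subrr (cometric0 finslerF) // poweR_EFin powR0 // gt_eqF.
move=> a u v /set_mem[du wu [u_ tu cu]] /set_mem[dv wv [v_ tv cv]]; apply/mem_set.
exists (fun x => a *: du x + dv x); first exact: weak_differential_lin.
pose w_ k := fun x => a * u_ k x + v_ k x.
exists w_; first by move=> k; apply: test_functionD => //; exact: test_functionZ.
(* The differences with the approximants are written as linear combinations, so that
   [weak_differential_lin] and [sobolev_norm_cvg_lin] apply to them. *)
have wdu k : weak_differential Omega (fun x => (-1) * u_ k x + u x)
    (fun x => (-1) *: gradient (u_ k) x + du x).
  by apply: weak_differential_lin => //; exact: weak_differential_test.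
have wdv k : weak_differential Omega (fun x => (-1) * v_ k x + v x)
    (fun x => (-1) *: gradient (v_ k) x + dv x).
  by apply: weak_differential_lin => //; exact: weak_differential_test.
have wdw k := weak_differential_lin Omega_open a (wdu k) (wdv k).
have [c c0 hc] := cZ a.
have e1 k : u \- u_ k = (fun x => (-1) * u_ k x + u x) by apply/funext => x /=; rewrite mulN1r addrC.
have e2 k : du \- gradient (u_ k) = (fun x => (-1) *: gradient (u_ k) x + du x).
  by apply/funext => x /=; rewrite scaleN1r addrC.
have e3 k : v \- v_ k = (fun x => (-1) * v_ k x + v x) by apply/funext => x /=; rewrite mulN1r addrC.
have e4 k : dv \- gradient (v_ k) = (fun x => (-1) *: gradient (v_ k) x + dv x).
  by apply/funext => x /=; rewrite scaleN1r addrC.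
have e5 k : (a *: u + v : _ -> R^o) \- w_ k =
    (fun x => a * ((-1) * u_ k x + u x) + ((-1) * v_ k x + v x)).
  apply/funext => x; transitivity (a * u x + v x - (a * u_ k x + v_ k x)) => //; ring.
have e6 k : (fun x => a *: du x + dv x) \- gradient (w_ k) =
    (fun x => a *: ((-1) *: gradient (u_ k) x + du x) + ((-1) *: gradient (v_ k) x + dv x)).
  apply/funext => x /=; rewrite grad_lin // !scaleN1r scalerDr scalerN opprD.
  by rewrite addrACA [a *: du x - _]addrC [dv x - _]addrC.
have E1 : (fun k => sobolev_norm Omega F p (u \- u_ k) (du \- gradient (u_ k))) =
    (fun k => sobolev_norm Omega F p (fun x => (-1) * u_ k x + u x)
       (fun x => (-1) *: gradient (u_ k) x + du x)).
  by apply/funext => k; rewrite e1 e2.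
have E2 : (fun k => sobolev_norm Omega F p (v \- v_ k) (dv \- gradient (v_ k))) =
    (fun k => sobolev_norm Omega F p (fun x => (-1) * v_ k x + v x)
       (fun x => (-1) *: gradient (v_ k) x + dv x)).
  by apply/funext => k; rewrite e3 e4.
rewrite E1 in cu; rewrite E2 in cv.
under eq_fun do rewrite e5 e6.
apply: (sobolev_norm_cvg_lin (normr_ge0 a) c0 wdu wdv wdw _ _ cu cv).
  by move=> k x; rewrite -normrM; exact: ler_normD.
move=> k x Ox; set A := -1 *: _ + du x; set B := _ + dv x.
exact: (le_trans (cometricD F x (a *: A) B) (leeD (hc x A Ox) (lexx _))).
Qed.

End reversible_sobolev.

(** * Infinite reversibility *)

Section cube_bump.
Context {R : realType} {n : nat}.
Notation mu := (lebesgue n : {measure set 'rV[R]_n -> \bar R}).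

Implicit Types (c x : 'rV[R]_n) (r : R).

Let psi : R -> R := exp_cutoff 1.

Let psi_ge0 t : 0 <= psi t.
Proof. by rewrite /psi /exp_cutoff; case: ifP => // _; rewrite hornerC mul1r expR_ge0. Qed.

Let psi_le1 t : psi t <= 1.
Proof.
rewrite /psi /exp_cutoff; case: ifP => // t0; rewrite hornerC mul1r -expR0 ler_expR oppr_le0.
by rewrite invr_ge0 ltW.
Qed.

Let psi_half t : 2^-1 <= t -> expR (- 2) <= psi t.
Proof.
move=> t2; have t0 : 0 < t by apply: lt_le_trans t2; rewrite invr_gt0.
rewrite /psi /exp_cutoff t0 hornerC mul1r ler_expR lerN2 -[leRHS]invrK lef_pV2 ?posrE //.
Qed.

Let psi_neg t : t <= 0 -> psi t = 0.
Proof. by rewrite /psi /exp_cutoff ltNge => ->. Qed.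

Definition box_bump (c : 'rV[R]_n) (r : R) (x : 'rV[R]_n) : R :=
  \prod_i (exp_cutoff 1 (1 - (x ord0 i - c ord0 i) / r) * exp_cutoff 1 (1 + (x ord0 i - c ord0 i) / r)).

Lemma smooth_box_bump c r : smooth_on setT (box_bump c r).
Proof.
apply: smooth_prod => i; apply: smoothM.
- have -> : (fun x : 'rV[R]_n => exp_cutoff 1 (1 - (x ord0 i - c ord0 i) / r)) =
      exp_cutoff 1 \o affine_form (- r^-1 *: delta_mx ord0 i) (1 + c ord0 i / r).
    apply/funext => x; rewrite /= /affine_form (bigD1 i) //= big1 => [|j ji].
      by rewrite !mxE !eqxx /=; congr (exp_cutoff _ _); ring.
    by rewrite !mxE eqxx (negbTE ji) mulr0 mul0r.
  by apply: smooth_comp_affine; exact: smooth_exp_cutoff.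
- have -> : (fun x : 'rV[R]_n => exp_cutoff 1 (1 + (x ord0 i - c ord0 i) / r)) =
      exp_cutoff 1 \o affine_form (r^-1 *: delta_mx ord0 i) (1 - c ord0 i / r).
    apply/funext => x; rewrite /= /affine_form (bigD1 i) //= big1 => [|j ji].
      by rewrite !mxE !eqxx /=; congr (exp_cutoff _ _); ring.
    by rewrite !mxE eqxx (negbTE ji) mulr0 mul0r.
  by apply: smooth_comp_affine; exact: smooth_exp_cutoff.
Qed.

Lemma box_bump_itv c r x : 0 <= box_bump c r x <= 1.
Proof.
rewrite /box_bump; elim/big_rec: _ => [|i y _ /andP[y0 y1]]; first by rewrite ler01 lexx.
have a0 := psi_ge0 (1 - (x ord0 i - c ord0 i) / r).
have b0 := psi_ge0 (1 + (x ord0 i - c ord0 i) / r).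
have a1 := psi_le1 (1 - (x ord0 i - c ord0 i) / r).
have b1 := psi_le1 (1 + (x ord0 i - c ord0 i) / r).
by rewrite !mulr_ge0 //= mulr_ile1 ?mulr_ge0 // mulr_ile1.
Qed.

Lemma box_bump_out c r x : 0 < r -> (exists i, r <= `|x ord0 i - c ord0 i|) -> box_bump c r x = 0.
Proof.
move=> r0 [i]; rewrite /box_bump (bigD1 i) //=; set d := x ord0 i - c ord0 i => hd.
suff -> : exp_cutoff 1 (1 - d / r) * exp_cutoff 1 (1 + d / r) = 0 by rewrite mul0r.
have [d0|/ltW d0] := leP 0 d.
  rewrite ger0_norm // in hd; rewrite (_ : exp_cutoff 1 (1 - d / r) = 0) ?mul0r //.
  by apply: psi_neg; rewrite subr_le0 ler_pdivlMr // mul1r.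
rewrite ler0_norm // in hd; rewrite (_ : exp_cutoff 1 (1 + d / r) = 0) ?mulr0 //.
by apply: psi_neg; rewrite -lerBrDl sub0r ler_pdivrMr // mulN1r lerNr.
Qed.

Lemma box_bump_in c r x : 0 < r -> (forall i, `|x ord0 i - c ord0 i| <= r / 2) ->
  expR (- 4) ^+ n <= box_bump c r x.
Proof.
move=> r0 hx; rewrite -[X in _ ^+ X]card_ord -prodr_const; apply: ler_prod => i _.
rewrite expR_ge0 /=; have -> : expR (- 4) = expR (- 2) * expR (- 2) :> R.
  by rewrite -expRD; congr expR; ring.
have := hx i; rewrite ler_norml; set d := x ord0 i - c ord0 i => /andP[d1 d2].
have e1 : d / r <= 2^-1 by rewrite ler_pdivrMr // mulrC.
have e2 : - 2^-1 <= d / r by rewrite ler_pdivlMr // mulNr mulrC.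
by apply: ler_pM; rewrite ?expR_ge0 //; apply: psi_half; lra.
Qed.

Lemma rV_box_ball (x0 : 'rV[R]_n) (U : set 'rV[R]_n) : open U -> U x0 ->
  exists2 r : R, 0 < r & forall x, (forall i, `|x ord0 i - x0 ord0 i| <= r) -> U x.
Proof.
move=> oU Ux; have /nbhs_ballP[e /= e0 eU] : nbhs x0 U by apply: open_nbhs_nbhs.
exists (e / 2); first by rewrite divr_gt0.
move=> x hx; apply: eU; rewrite -ball_normE /=; apply: coord_ball => // i.
by apply: le_lt_trans (hx i) _; rewrite ltr_pdivrMr // ltr_pMr // ltr1n.
Qed.

(** [c0] is fixed before the open set and the point: the ratio of the square integral to [V] does
    not degenerate as the support shrinks, so the required reversibility ratio will not depend on
    where the bump is placed. *)
Lemma cube_bump : exists2 c0 : R, 0 < c0 & forall (U : set 'rV[R]_n) x0, open U -> U x0 ->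
  exists (chi : 'rV[R]_n -> R) (V : R) (K : set 'rV[R]_n),
  [/\ compact K, K `<=` U, (mu K <= V%:E)%E & 0 < V] /\
  [/\ smooth_on setT chi, forall x, 0 <= chi x <= 1, forall x, ~ K x -> chi x = 0,
      \int[mu]_x chi x <= V & c0 * V <= \int[mu]_x (chi x ^+ 2)].
Proof.
(* On the box of half side [r / 2] the bump is at least [e^(- 4 n)], and the volume of this box is
   [r^n = V / 4^n] with [V = (4 r)^n]. *)
exists ((expR (- 4) ^+ n) ^+ 2 / 4 ^+ n); first by rewrite divr_gt0 ?exprn_gt0 ?expR_gt0.
move=> U x0 oU Ux0; have [r r0 hr] := rV_box_ball oU Ux0.
pose K := [set x : 'rV[R]_n | forall i, `|x ord0 i - x0 ord0 i| <= r].
pose B (s : R) := ocbox (fun i => x0 ord0 i - s) (fun i => x0 ord0 i + s).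
have muB s : 0 < s -> mu (B s) = ((2 * s) ^+ n)%:E.
  move=> s0; rewrite lebesgue_ocbox; last by move=> i; rewrite lerD2l ge0_cp // ltW.
  rewrite (eq_bigr (fun=> 2 * s)) => [|i _]; last by ring.
  by rewrite prodr_const card_ord.
have cK : compact K.
  have -> : K = [set v : 'rV[R]_n | forall i, `[x0 ord0 i - r, x0 ord0 i + r]%classic (v ord0 i)].
    by apply/seteqP; split=> v h i; have := h i; rewrite /= in_itv /= ler_distl.
  by apply: (@rV_compact R _ (fun i => `[x0 ord0 i - r, x0 ord0 i + r]%classic)) => i; exact: segment_compact.
have mK := compact_rV_measurable cK.
have KB : K `<=` B (2 * r).
  move=> x hx i; rewrite in_itv /=; have := hx i; rewrite ler_distl => /andP[h1 h2].
  by apply/andP; split; lra.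
have V0 : 0 < (4 * r) ^+ n by rewrite exprn_gt0 // mulr_gt0.
have muK : (mu K <= ((4 * r) ^+ n)%:E)%E.
  have r20 : 0 < 2 * r by rewrite mulr_gt0.
  have -> : 4 * r = 2 * (2 * r) by ring.
  by rewrite -muB //; apply: le_measure => //; rewrite inE //; exact: measurable_ocbox.
have fK : mu K \is a fin_num by rewrite ge0_fin_numE //; exact: compact_lebesgue_fin.
have K0 x : ~ K x -> box_bump x0 r x = 0.
  move=> nK; apply: box_bump_out => //; apply: contrapT => hn; apply: nK => i.
  by rewrite leNgt; apply/negP => /ltW h; apply: hn; exists i.
have sb := smooth_box_bump x0 r; have cb := smooth_continuous sb.
exists (box_bump x0 r), ((4 * r) ^+ n), K; split; split => //.
- by move=> x; exact: box_bump_itv.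
- rewrite -(@Rintegral_compact_support _ _ _ K K) //.
  apply: (@le_trans _ _ (\int[mu]_(x in K) (cst 1) x)).
    apply: le_Rintegral => //; [exact: compact_integrable|apply: compact_integrable => //; exact: cst_continuous|].
    by move=> x _; have /andP[] := box_bump_itv x0 r x.
  by rewrite Rintegral_cst // mul1r -lee_fin fineK.
- have r2 : 0 < r / 2 by rewrite divr_gt0.
  set a := expR (- 4) ^+ n; have a0 : 0 <= a by rewrite exprn_ge0 // expR_ge0.
  have mB : measurable (B (r / 2)) by exact: measurable_ocbox.
  have -> : a ^+ 2 / 4 ^+ n * (4 * r) ^+ n = \int[mu]_x ((cst (a ^+ 2)) \_ (B (r / 2))) x.
    rewrite -Rintegral_mkcond Rintegral_cst // muB //= exprMn -mulrA mulKf ?expf_neq0 //.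
    by rewrite mulrCA divff ?mulr1 // pnatr_eq0.
  apply: le_Rintegral => //.
  + rewrite -restrict_EFin; apply/(integrable_mkcond _ mB).
    by apply: measurable_bounded_integrable => //; [rewrite muB ?ltry|exact: bounded_cst].
  + apply: (integrable_compact_support _ cK) => // [|x /K0 ->]; last by rewrite expr0n.
    by apply: smooth_continuous; under eq_fun do rewrite expr2; exact: smoothM.
  + move=> x _; rewrite patchE; case: ifPn => [/set_mem Bx|_]; last exact: sqr_ge0.
    rewrite ler_pXn2r ?nnegrE //; last by have /andP[] := box_bump_itv x0 r x.
    apply: box_bump_in => // i; have := Bx i; rewrite in_itv /= ler_distl => /andP[/ltW -> ->].
    by [].
Qed.

End cube_bump.

Lemma integrable_EFinZl {R : realType} {d} {T : measurableType d} (mu : {measure set T -> \bar R})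
  (D : set T) (c : R) (g : T -> R) : measurable D -> mu.-integrable D (EFin \o g) ->
  mu.-integrable D (EFin \o (fun x => c * g x)).
Proof.
move=> mD ig; have -> : EFin \o (fun x => c * g x) = (fun x => c%:E * (EFin \o g) x)%E by [].
exact: integrableZl.
Qed.

(** * Averages of rapidly oscillating functions *)

Section oscillation.
Context {R : realType} {n : nat}.
Notation mu := (lebesgue n : {measure set 'rV[R]_n -> \bar R}).
Implicit Types (xi v w : 'rV[R]_n) (a k : R -> R) (e : R).

Definition oscillate xi e a (x : 'rV[R]_n) : R := a (affine_form (e^-1 *: xi) 0 x).

Lemma smooth_oscillate xi e a : smooth_on setT a -> smooth_on setT (oscillate xi e a).
Proof. by move=> sa; exact: (smooth_comp_affine _ _ sa). Qed.

Lemma derive_oscillate xi v e a (da : R) x : is_derive (affine_form (e^-1 *: xi) 0 x) 1 a da ->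
  'D_v (oscillate xi e a) x = e^-1 * dot xi v * da.
Proof.
move=> [d1 d2]; have dfa : differentiable a (affine_form (e^-1 *: xi) 0 x) by apply/derivable1_diffP.
have [_] := derive_comp_affine v dfa; rewrite d2 => ->.
by rewrite -dotE dotZl.
Qed.

(** A form of the Riemann-Lebesgue lemma: as [xi . w = 1], the centred oscillation is the derivative
    along [w] of [e k (xi . x / e)], and integrating by parts against [rho] leaves a factor [e]. *)
Lemma oscillation_average a k (m K : R) xi w (rho : 'rV[R]_n -> R) :
  smooth_on setT a -> smooth_on setT k -> (forall t : R, is_derive t 1 k (a t - m)) ->
  (forall t, `|k t| <= K) -> dot xi w = 1 -> test_function setT rho ->
  forall d, 0 < d -> \forall e \near 0^'+,
    `|\int[mu]_x (oscillate xi e a x * rho x) - m * \int[mu]_x rho x| <= d.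
Proof.
move=> sa sk dk kK xiw trho d d0.
have oT : open [set: 'rV[R]_n] by exact: openT.
have K0 : 0 <= K by apply: le_trans (kK 0).
have tD := test_function_derive w trho.
have iD : mu.-integrable setT (EFin \o 'D_w rho) := test_function_integrable tD measurableT.
have iDn : mu.-integrable setT (EFin \o (fun x => `|'D_w rho x|)).
  exact: integrable_abse iD.
pose J := \int[mu]_x `|'D_w rho x|.
have J0 : 0 <= J by apply: Rintegral_ge0.
have srho : smooth_on setT rho by case: trho.
near=> e.
have e0 : 0 < e by near: e; exact: nbhs_right_gt.
have eJ : e * (K * J) <= d.
  have : e < d / (K * J + 1) by near: e; apply: nbhs_right_lt; rewrite divr_gt0 // ltr_wpDl // mulr_ge0.
  rewrite ltr_pdivlMr ?ltr_wpDl ?mulr_ge0 // => /ltW; apply: le_trans.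
  by rewrite ler_pM2l // lerDl.
have Dk x : 'D_w (oscillate xi e (fun t => e * k t)) x = oscillate xi e a x - m.
  have h := is_deriveZ e (dk (affine_form (e^-1 *: xi) 0 x)).
  rewrite (derive_oscillate _ h) xiw mulr1 /GRing.scale /= mulKf ?gt_eqF //.
have sek : smooth_on setT (oscillate xi e (fun t => e * k t)).
  by apply: smooth_oscillate; exact: smoothZ.
have toa : test_function setT (fun x => oscillate xi e a x * rho x).
  by apply: test_functionM => //; exact: smooth_oscillate.
have -> : \int[mu]_x (oscillate xi e a x * rho x) - m * \int[mu]_x rho x =
    \int[mu]_x ('D_w (oscillate xi e (fun t => e * k t)) x * rho x).
  rewrite -RintegralZl //; last exact: (test_function_integrable trho).
  rewrite -RintegralB //; first by apply: eq_Rintegral => x _; rewrite Dk mulrBl.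
    exact: (test_function_integrable toa).
  exact: (test_function_integrable (test_functionZ m trho)).
rewrite (integral_test_by_parts oT) // normrN.
apply: le_trans (le_normr_Rintegral _ _) _ => //.
  exact: (test_function_integrable (test_functionM sek tD)).
apply: le_trans eJ; rewrite mulrA -[leRHS]RintegralZl //.
apply: le_Rintegral => //.
- exact: integrable_abse (test_function_integrable (test_functionM sek tD) measurableT).
- exact: (@integrable_EFinZl _ _ _ mu).
- move=> x _; rewrite normrM ler_wpM2r // /oscillate normrM gtr0_norm // ler_pM2l //.
Unshelve. all: by end_near. Qed.

End oscillation.

Section power_bounds.
Context {R : realType}.
Implicit Types (p s t kap : R).

(* Convexity of [X ^ p], relaxed so as to be affine in [t]. *)
Lemma poweR_ge_affine p kap t (psi : R) (X : \bar R) : 1 < p -> 0 < kap -> (0 <= X)%E -> (t%:E <= X)%E ->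
  0 <= psi <= 1 -> ((kap `^ (p - 1) * ((t - kap) * psi))%:E <= X `^ p)%E.
Proof.
move=> p1 k0 X0 tX /andP[q0 q1]; have p0 : 0 < p by exact: lt_trans p1.
have kp : 0 < kap `^ (p - 1) by exact: powR_gt0.
have [tk|kt] := leP t kap.
  apply: le_trans (poweR_ge0 _ _); rewrite lee_fin pmulr_rle0 //.
  by rewrite mulr_le0_ge0 // subr_le0.
have t0 : 0 < t by exact: lt_trans kt.
apply: le_trans (ge0_le_poweR (ltW p0) _ tX); last by rewrite lee_fin ltW.
rewrite poweR_EFin lee_fin -(mulr_powRB1 (ltW t0) p0) mulrC.
apply: ler_pM; [by rewrite mulr_ge0 // subr_ge0 ltW|exact: ltW| |].
  apply: (@le_trans _ _ (t - kap)); first by rewrite ler_piMr // subr_ge0 ltW.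
  by rewrite gerBl ltW.
by apply: ge0_ler_powR; rewrite ?nnegrE ?subr_ge0 ?ltW.
Qed.

(** The power is relaxed to an expression affine in [a], with slope of order [H^(p - 1)], so that
    its integral only involves the mean of the profile. The constant 4 comes from bounding a sum by
    twice a maximum. *)
Lemma powR_sum_le p s H M a : 1 < p -> 0 <= s -> 0 <= a <= H -> 0 <= M -> M `^ p <= H `^ (p - 1) ->
  (2 * s * (a + 2 * M)) `^ p <= (4 * s) `^ p * (H `^ (p - 1) * (a + 2 `^ p)).
Proof.
move=> p1 s0 /andP[a0 aH] M0 MH; have p0 : 0 < p by exact: lt_trans p1.
have M20 : 0 <= 2 * M by rewrite mulr_ge0.
have H0 : 0 <= H by exact: le_trans aH.
have pm : 0 <= p - 1 by rewrite subr_ge0 ltW.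
apply: (@le_trans _ _ ((4 * s * Num.max a (2 * M)) `^ p)).
  have hm : a + 2 * M <= 2 * Num.max a (2 * M).
    have m1 : a <= Num.max a (2 * M) by rewrite le_max lexx.
    have m2 : 2 * M <= Num.max a (2 * M) by rewrite le_max lexx orbT.
    by move: m1 m2; set b := 2 * M; set m := Num.max _ _; lra.
  apply: ge0_ler_powR; rewrite ?nnegrE ?(ltW p0) ?mulr_ge0 ?addr_ge0 ?le_max ?a0 //.
  have -> : 4 * s * Num.max a (2 * M) = 2 * s * (2 * Num.max a (2 * M)) by ring.
  by rewrite ler_wpM2l // mulr_ge0.
rewrite powRM ?mulr_ge0 ?le_max ?a0 // ler_wpM2l ?powR_ge0 //.
have h1 : a `^ p <= H `^ (p - 1) * a.
  rewrite -(mulr_powRB1 a0 p0) mulrC ler_wpM2r //.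
  by apply: ge0_ler_powR.
have h2 : (2 * M) `^ p <= H `^ (p - 1) * 2 `^ p.
  by rewrite powRM // mulrC ler_wpM2r ?powR_ge0.
rewrite [leRHS]mulrDr /Num.max; case: ifP => _.
  by apply: le_trans h2 _; rewrite lerDr mulr_ge0 // powR_ge0.
by apply: le_trans h1 _; rewrite lerDl mulr_ge0 // powR_ge0.
Qed.

End power_bounds.

Section lower_functional.
Context {R : realType} {n : nat}.
Context (Omega : set 'rV[R]_n) (F : 'rV[R]_n -> 'rV[R]_n -> R) (p : R).
Context (Omega_open : open Omega) (finslerF : finsler_metric Omega F).
Context (n_gt0 : (0 < n)%N) (p_gt1 : 1 < p).
Notation mu := (lebesgue n : {measure set 'rV[R]_n -> \bar R}).

Let mO : measurable Omega. Proof. exact: open_rV_measurable. Qed.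

Lemma integrable_dot_test (dw : 'rV[R]_n -> 'rV[R]_n) (y : 'rV[R]_n) psi :
  (forall i, locally_integrable_row Omega (fun x => dw x ord0 i)) -> test_function Omega psi ->
  mu.-integrable Omega (EFin \o (fun x => dot (dw x) y * psi x)) /\
  \int[mu]_(x in Omega) (dot (dw x) y * psi x) =
    \sum_i y ord0 i * \int[mu]_(x in Omega) (dw x ord0 i * psi x).
Proof.
move=> ldw tpsi.
have I i : mu.-integrable Omega (EFin \o (fun x => y ord0 i * (dw x ord0 i * psi x))).
  apply: (@integrable_EFinZl _ _ _ mu) => //; exact: locally_integrable_test_integrable.
have -> : (fun x => dot (dw x) y * psi x) = (fun x => \sum_i y ord0 i * (dw x ord0 i * psi x)).
  by apply/funext => x; rewrite dotE mulr_suml; apply: eq_bigr => i _; ring.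
have h (s : seq 'I_n) : mu.-integrable Omega (EFin \o (fun x => \sum_(i <- s) y ord0 i * (dw x ord0 i * psi x))) /\
   \int[mu]_(x in Omega) (\sum_(i <- s) y ord0 i * (dw x ord0 i * psi x)) =
    \sum_(i <- s) y ord0 i * \int[mu]_(x in Omega) (dw x ord0 i * psi x).
  elim: s => [|i s [IH1 IH2]].
    under eq_fun do rewrite big_nil; rewrite big_nil; split; first exact: integrable0.
    by rewrite Rintegral_cst // mul0r.
  have -> : (fun x => \sum_(j <- i :: s) y ord0 j * (dw x ord0 j * psi x)) =
      (fun x => y ord0 i * (dw x ord0 i * psi x) + \sum_(j <- s) y ord0 j * (dw x ord0 j * psi x)).
    by apply/funext => x; rewrite big_cons.
  split; first by have := integrableD mO (I i) IH1.
  rewrite RintegralD // IH2 big_cons RintegralZl //; exact: locally_integrable_test_integrable.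
exact: h.
Qed.

(** [poweR_ge_affine] is integrated with [t = dw(y) / (2 D)], which is at most the co-metric of
    [dw]. The bound sees [dw] only through its pairing with [psi], and such pairings are what the
    definition of a weak differential prescribes. *)
Lemma lower_functional (dw : 'rV[R]_n -> 'rV[R]_n) (y : 'rV[R]_n) (psi : 'rV[R]_n -> R)
    (K : set 'rV[R]_n) (D kap : R) :
  (forall i, locally_integrable_row Omega (fun x => dw x ord0 i)) -> test_function Omega psi ->
  compact K -> K `<=` Omega -> (forall x, ~ K x -> psi x = 0) -> (forall x, 0 <= psi x <= 1) ->
  y != 0 -> 0 < D -> (forall x, K x -> F x y <= 2 * D) -> 0 < kap ->
  ((kap `^ (p - 1) * ((\int[mu]_(x in Omega) (dot (dw x) y * psi x)) / (2 * D)
      - kap * \int[mu]_(x in Omega) psi x))%:E <=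
   \int[mu]_(x in K) cometric F x (dw x) `^ p)%E.
Proof.
move=> ldw tpsi cK KO psi0 psi01 y0 D0 hD k0.
have mK := compact_rV_measurable cK.
have [Id _] := integrable_dot_test y ldw tpsi.
have Ip : mu.-integrable Omega (EFin \o psi) by exact: test_function_integrable tpsi mO.
pose G x := kap `^ (p - 1) * ((dot (dw x) y / (2 * D) - kap) * psi x).
have IG1 : mu.-integrable Omega (EFin \o (fun x => (2 * D)^-1 * (dot (dw x) y * psi x))).
  exact: (@integrable_EFinZl _ _ _ mu).
have IG2 : mu.-integrable Omega (EFin \o (fun x => kap * psi x)).
  exact: (@integrable_EFinZl _ _ _ mu).
have IG3 : mu.-integrable Omega (EFin \o (fun x => (2 * D)^-1 * (dot (dw x) y * psi x) - kap * psi x)).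
  by have := integrableB mO IG1 IG2.
have GE : G = (fun x => kap `^ (p - 1) * ((2 * D)^-1 * (dot (dw x) y * psi x) - kap * psi x)).
  by apply/funext => x; rewrite /G; congr (_ * _); ring.
have IG : mu.-integrable Omega (EFin \o G) by rewrite GE; exact: (@integrable_EFinZl _ _ _ mu).
have -> : kap `^ (p - 1) * ((\int[mu]_(x in Omega) (dot (dw x) y * psi x)) / (2 * D)
      - kap * \int[mu]_(x in Omega) psi x) = \int[mu]_(x in K) G x.
  have -> : \int[mu]_(x in K) G x = \int[mu]_(x in Omega) G x.
    have G0 x : ~ K x -> G x = 0 by move=> /psi0; rewrite /G => ->; rewrite !mulr0.
    by rewrite (Rintegral_compact_support G0 KO) (Rintegral_compact_support G0 (@subset_refl _ K)).
  by rewrite GE RintegralZl // RintegralB // !RintegralZl // [_ * _^-1]mulrC.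
have IGK : mu.-integrable K (EFin \o G) by exact: integrableS IG.
rewrite /Rintegral fineK; last exact: integrable_fin_num.
have mcom : measurable_fun K (fun x => cometric F x (dw x) `^ p)%E.
  apply: (measurableT_comp (measurable_poweR p)).
  apply: (measurable_funS mO KO); apply: (cometric_measurable Omega_open finslerF) => i.
  by case: (ldw i).
(* An infinite energy satisfies every lower bound; a finite one is integrable and can be compared
   with a function of variable sign. *)
have [->|fin] := eqVneq (\int[mu]_(x in K) cometric F x (dw x) `^ p)%E +oo%E; first exact: leey.
apply: le_integral => //.
  apply/integrableP; split => //.
  under eq_integral do rewrite gee0_abs ?poweR_ge0 //.
  by rewrite ltey.
move=> x /set_mem Kx; rewrite /= /G; have Ox := KO _ Kx.
apply: poweR_ge_affine => //; first exact: (cometric_ge0 finslerF).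
have [h|/ltW h] := leP 0 (dot (dw x) y); last first.
  apply: le_trans (cometric_ge0 finslerF n_gt0 _ Ox); rewrite lee_fin.
  by rewrite mulr_le0_ge0 // invr_ge0 mulr_ge0 // ltW.
apply: le_trans (cometric_ge _ _ _ y0); rewrite lee_fin ler_wpM2l //.
by rewrite lef_pV2 ?posrE ?mulr_gt0 // ?hD // (metric_gt0 finslerF).
Qed.

End lower_functional.

Section integral_bounds.
Context {R : realType} {d} {T : measurableType d} (mu : {measure set T -> \bar R}).

Lemma integral_le_Rintegral (D : set T) (g : T -> \bar R) (b : T -> R) : measurable D ->
  measurable_fun D g -> (forall x, D x -> (0 <= g x <= (b x)%:E)%E) -> mu.-integrable D (EFin \o b) ->
  (\int[mu]_(x in D) g x <= (\int[mu]_(x in D) b x)%:E)%E.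
Proof.
move=> mD mg gb ib; rewrite /Rintegral fineK; last exact: integrable_fin_num.
apply: ge0_le_integral => //.
- by move=> x /gb /andP[].
- by case/integrableP : ib.
- by move=> x /gb /andP[].
Qed.

Lemma Rintegral_restrict_cst (D K : set T) (c V : R) : measurable D -> measurable K -> K `<=` D ->
  (mu K <= V%:E)%E -> 0 <= c ->
  mu.-integrable D (EFin \o (cst c \_ K)) /\ \int[mu]_(x in D) (cst c \_ K) x <= c * V.
Proof.
move=> mD mK KD KV c0; have fK : mu K \is a fin_num.
  by rewrite ge0_fin_numE // (le_lt_trans KV) // ltry.
split.
  apply: (@integrableS _ _ _ _ setT) => //; rewrite -restrict_EFin; apply/(integrable_mkcond _ mK).
  by apply: measurable_bounded_integrable => //; [rewrite (le_lt_trans KV) // ltry|exact: bounded_cst].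
rewrite Rintegral_mkcond -patch_setI setIC.
rewrite (setIidl KD) -Rintegral_mkcond Rintegral_cst //.
by rewrite ler_wpM2l // -lee_fin fineK.
Qed.

End integral_bounds.

(** * Energy of one oscillating bump and of its opposite *)

Section oscillating_bump.
Context {R : realType} {n : nat}.
Context (Omega : set 'rV[R]_n) (F : 'rV[R]_n -> 'rV[R]_n -> R) (p : R).
Context (Omega_open : open Omega) (finslerF : finsler_metric Omega F).
Context (n_gt0 : (0 < n)%N) (p_gt1 : 1 < p).
Notation mu := (lebesgue n : {measure set 'rV[R]_n -> \bar R}).

Let mO : measurable Omega. Proof. exact: open_rV_measurable. Qed.

Context (x0 : 'rV[R]_n) (Ox0 : Omega x0) (K : set 'rV[R]_n) (chi : 'rV[R]_n -> R) (V : R).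
Context (compactK : compact K) (KOmega : K `<=` Omega) (muK : (mu K <= V%:E)%E) (V_gt0 : 0 < V).
Context (smooth_chi : smooth_on setT chi) (chi_itv : forall x, 0 <= chi x <= 1).
Context (chi_out : forall x, ~ K x -> chi x = 0) (int_chi : \int[mu]_x chi x <= V).
Context (near_x0 : forall x, K x -> forall z, F x0 z <= 2 * F x z).
Context (xi : 'rV[R]_n) (M : R) (M_ge1 : 1 <= M).
Context (xi_le : forall z, dot xi z <= F x0 z) (xi_ge : forall z, - dot xi z <= M * F x0 z).
Context (f h k : R -> R) (H m K0 : R) (H_gt0 : 0 < H) (MH : M `^ p <= H `^ (p - 1)).
Context (smooth_f : smooth_on setT f) (smooth_h : smooth_on setT h).
Context (f_itv : forall t, 0 <= f t <= H) (h_le : forall t, `|h t| <= K0).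
Context (derive_h : forall t : R, is_derive t 1 h (f t - 1)).
Context (C1 : R) (C1_ge0 : 0 <= C1) (chi_D : forall x z, `|'D_z chi x| <= C1 * F x0 z).
Context (s e : R) (s_gt0 : 0 < s) (e_gt0 : 0 < e).
Context (e_small : e * K0 * C1 <= 1).
Context (avg1 : `|\int[mu]_x (oscillate xi e f x * chi x) - \int[mu]_x chi x| <= V).

Let fe := oscillate xi e f.
Let he := oscillate xi e h.

Definition oscillating_bump x : R := (s * e) * (he x * chi x).
Notation phi := oscillating_bump.

Let test_chi : test_function Omega chi.
Proof. exact: (test_functionI smooth_chi compactK KOmega chi_out). Qed.

Let smooth_fe : smooth_on setT fe. Proof. exact: smooth_oscillate. Qed.
Let smooth_he : smooth_on setT he. Proof. exact: smooth_oscillate. Qed.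

Lemma smooth_oscillating_bump : smooth_on setT phi.
Proof. by apply: smoothZ; exact: smoothM. Qed.

Lemma oscillating_bump_out x : ~ K x -> phi x = 0.
Proof. by move=> /chi_out e0; rewrite /phi e0 !mulr0. Qed.

Lemma test_oscillating_bump : test_function Omega phi.
Proof. exact: (test_functionI smooth_oscillating_bump compactK KOmega oscillating_bump_out). Qed.

Lemma derive_oscillating_bump z x :
  'D_z phi x = s * ((fe x - 1) * dot xi z * chi x + e * he x * 'D_z chi x).
Proof.
have dh : 'D_z he x = e^-1 * dot xi z * (fe x - 1) by apply: derive_oscillate; exact: derive_h.
have d1 := @diff_derivable _ _ _ he x z (smooth_differentiable x smooth_he).
have d2 := @diff_derivable _ _ _ chi x z (smooth_differentiable x smooth_chi).
have [_] := is_deriveZ (s * e) (is_deriveM (derivableP d1) (derivableP d2)).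
move=> E; transitivity ((s * e) * (he x * 'D_z chi x + chi x * 'D_z he x)); first exact: E.
by rewrite dh; field; rewrite gt_eqF.
Qed.

Let K0_ge0 : 0 <= K0. Proof. exact: le_trans (h_le 0). Qed.

Lemma oscillating_bump_le x : `|phi x| <= s * e * K0.
Proof.
rewrite /phi normrM (gtr0_norm (mulr_gt0 s_gt0 e_gt0)) ler_pM2l ?mulr_gt0 //.
have /andP[c0 c1] := chi_itv x.
by rewrite normrM (ger0_norm c0) -[leRHS]mulr1; apply: ler_pM => //; exact: h_le.
Qed.

Lemma integral_oscillating_bump_le (delta : R) : 0 < delta -> s * e * K0 <= (delta / V) `^ p^-1 ->
  (\int[mu]_(x in Omega) (`|phi x| `^ p)%:E <= delta%:E)%E.
Proof.
move=> d0 hs; have p0 : 0 < p by exact: lt_trans p_gt1.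
have mK := compact_rV_measurable compactK.
have c0 : 0 <= delta / V by rewrite divr_ge0 // ltW.
have [I1 I2] := Rintegral_restrict_cst mO mK KOmega muK c0.
apply: le_trans (_ : ((\int[mu]_(x in Omega) (cst (delta / V) \_ K) x)%:E <= _)%E); last first.
  by rewrite lee_fin (le_trans I2) // divfK // gt_eqF.
apply: integral_le_Rintegral => //.
  apply/measurable_EFinP; apply: (measurableT_comp (measurable_powR p)); apply: measurableT_comp => //.
  apply: measurable_funS (continuous_rV_measurableT _) => //.
  exact: smooth_continuous smooth_oscillating_bump.
move=> x Ox; rewrite !lee_fin powR_ge0 patchE /=; case: ifPn => [_|].
  have -> : delta / V = ((delta / V) `^ p^-1) `^ p.
    by rewrite -powRrM mulVf ?gt_eqF // powRr1.
  apply: ge0_ler_powR; rewrite ?nnegrE ?(ltW p0) ?powR_ge0 //.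
  exact: le_trans (oscillating_bump_le x) hs.
by rewrite notin_setE => /oscillating_bump_out ->; rewrite normr0 powR0 // gt_eqF.
Qed.

Let fchi_itv x : 0 <= fe x * chi x <= H.
Proof.
have /andP[c0 c1] := chi_itv x; have /andP[f0 f1] := f_itv (affine_form (e^-1 *: xi) 0 x).
rewrite mulr_ge0 //= -[leRHS]mulr1; apply: ler_pM => //.
Qed.

(** Up to the factor [s], the differential splits into the climb [f chi xi], bounded by [f chi F],
    and the descent [- chi xi] and the cutoff term, each bounded by [M F], all at [x0]; a factor 2
    passes from [x0] to [x]. *)
Lemma cometric_oscillating_bump x : K x ->
  (cometric F x (gradient phi x) <= (2 * s * (fe x * chi x + 2 * M))%:E)%E.
Proof.
move=> Kx; have Ox := KOmega Kx; apply: (cometric_le finslerF) => // z z0.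
have -> : dot (gradient phi x) z = 'D_z phi x.
  rewrite dotE (derive_partial _ (smooth_differentiable x smooth_oscillating_bump)).
  by apply: eq_bigr => i _; rewrite gradientE mulrC.
rewrite derive_oscillating_bump.
have /andP[c0 c1] := chi_itv x; have /andP[f0 f1] := f_itv (affine_form (e^-1 *: xi) 0 x).
have F0 : 0 <= F x0 z by exact: (metric_ge0 finslerF).
have M0 : 0 <= M by exact: le_trans M_ge1.
have a1 : fe x * chi x * dot xi z <= fe x * chi x * F x0 z by rewrite ler_wpM2l // mulr_ge0.
have a2 : chi x * - dot xi z <= M * F x0 z.
  apply: le_trans (ler_wpM2l c0 (xi_ge z)) _.
  by rewrite ler_piMl // mulr_ge0.
have a3 : e * he x * 'D_z chi x <= M * F x0 z.
  apply: le_trans (ler_norm _) _; rewrite normrM normrM (gtr0_norm e_gt0).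
  apply: (@le_trans _ _ (e * K0 * C1 * F x0 z)).
    rewrite -[e * K0 * C1 * _]mulrA; apply: ler_pM => //; first by rewrite mulr_ge0 // ltW.
    by rewrite ler_pM2l //; exact: h_le.
  by rewrite ler_wpM2r // (le_trans e_small).
have a4 : (fe x * chi x + 2 * M) * F x0 z <= (fe x * chi x + 2 * M) * (2 * F x z).
  by rewrite ler_wpM2l ?near_x0 // addr_ge0 ?mulr_ge0.
have -> : (fe x - 1) * dot xi z * chi x = fe x * chi x * dot xi z + chi x * - dot xi z by ring.
have -> : 2 * s * (fe x * chi x + 2 * M) * F x z = s * ((fe x * chi x + 2 * M) * (2 * F x z)) by ring.
rewrite ler_wpM2l //; [exact: ltW|].
apply: le_trans a4; rewrite [leRHS]mulrDl -[2 * M * _]mulrA; move: a1 a2 a3.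
by set t1 := fe x * chi x * dot xi z; set t2 := chi x * _; set t3 := e * _ * _; set t4 := M * _; lra.
Qed.

Lemma integral_cometric_oscillating_bump :
  (\int[mu]_(x in Omega) cometric F x (gradient phi x) `^ p <=
   ((4 * s) `^ p * (H `^ (p - 1) * (2 * V + 2 `^ p * V)))%:E)%E.
Proof.
have p0 : 0 < p by exact: lt_trans p_gt1.
have mK := compact_rV_measurable compactK.
have [I1 I2] := Rintegral_restrict_cst mO mK KOmega muK (@ler01 R).
pose one : 'rV[R]_n -> R := (@cst 'rV[R]_n R 1) \_ K.
have I3 : mu.-integrable Omega (EFin \o (fun x => fe x * chi x)).
  exact: (test_function_integrable (test_functionM smooth_fe test_chi)).
have I4 : mu.-integrable Omega (EFin \o (fun x => 2 `^ p * one x)).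
  exact: (@integrable_EFinZl _ _ _ mu).
have I5 : mu.-integrable Omega (EFin \o (fun x => fe x * chi x + 2 `^ p * one x)).
  by have := integrableD mO I3 I4.
have I6 : mu.-integrable Omega (EFin \o (fun x => H `^ (p - 1) * (fe x * chi x + 2 `^ p * one x))).
  exact: (@integrable_EFinZl _ _ _ mu).
have I7 : mu.-integrable Omega (EFin \o
    (fun x => (4 * s) `^ p * (H `^ (p - 1) * (fe x * chi x + 2 `^ p * one x)))).
  exact: (@integrable_EFinZl _ _ _ mu).
apply: le_trans (integral_le_Rintegral mO _ _ I7) _.
- apply: (measurableT_comp (measurable_poweR p)).
  exact: (weak_differential_cometric_measurable Omega_open finslerF
    (weak_differential_test Omega_open test_oscillating_bump)).
- move=> x Ox; rewrite poweR_ge0 /= /one patchE; case: ifPn => [/set_mem Kx|].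
    apply: le_trans (ge0_le_poweR (ltW p0) (cometric_ge0 finslerF n_gt0 _ Ox) (cometric_oscillating_bump Kx)) _.
    rewrite poweR_EFin lee_fin mulr1.
    apply: powR_sum_le => //; [exact: ltW|exact: le_trans M_ge1].
  rewrite notin_setE => nK.
  have -> : gradient phi x = 0.
    apply/rowP => i; rewrite gradientE mxE.
    exact: (derive_outside _ (compact_rV_closed compactK) oscillating_bump_out).
  by rewrite (cometric0 finslerF) // poweR_EFin powR0 ?gt_eqF // lee_fin chi_out // !mulr0 addr0 mulr0.
rewrite lee_fin RintegralZl // ler_wpM2l ?powR_ge0 // RintegralZl // ler_wpM2l ?powR_ge0 //.
rewrite RintegralD // RintegralZl //; apply: lerD; last first.
  by rewrite ler_wpM2l ?powR_ge0 // (le_trans I2) // mul1r.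
have O0 x : ~ K x -> fe x * chi x = 0 by move=> /chi_out ->; rewrite mulr0.
rewrite (Rintegral_compact_support O0 KOmega).
have := le_trans (ler_norm _) avg1; rewrite lerBlDr => /le_trans; apply.
by rewrite mulr_natl mulr2n lerD2l.
Qed.

(** Against functions supported in [K], [dw] acts as the differential of [- phi]. Pairing with
    [psi], which favours the peaks, gives [s N / H] times the integral of [(f^2 - f) chi^2], up to
    an error of order [e]. The mean square of [f] is comparable to [H], so the pairing is of order
    [s N V], with [N >= Lam F (x0, y)]. *)
Lemma integral_cometric_reversed_ge (dw : 'rV[R]_n -> 'rV[R]_n) (y : 'rV[R]_n) (N c0 Lam : R) :
  y != 0 -> dot xi y = - N -> 0 < c0 -> 0 < Lam -> Lam * F x0 y <= N ->
  c0 * V <= \int[mu]_x (chi x ^+ 2) -> H <= 2 * m -> 4 <= H ->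
  `|\int[mu]_x (fe x * chi x ^+ 2) - \int[mu]_x (chi x ^+ 2)| <= c0 * V * H / 32 ->
  `|\int[mu]_x (fe x ^+ 2 * chi x ^+ 2) - m * \int[mu]_x (chi x ^+ 2)| <= c0 * V * H / 32 ->
  e * (K0 * (C1 * F x0 y) * H * V) <= N * (c0 * V * H / 16) ->
  (forall x, K x -> F x y <= 2 * F x0 y) ->
  (forall i, locally_integrable_row Omega (fun x => dw x ord0 i)) ->
  (forall psi i, test_function Omega psi -> (forall x, ~ K x -> psi x = 0) ->
    \int[mu]_(x in Omega) (dw x ord0 i * psi x) = \int[mu]_(x in Omega) (phi x * partial i psi x)) ->
  (((c0 / 64) `^ (p - 1) * (c0 / 32) * ((s * Lam) `^ p * (H `^ (p - 1) * V)))%:E <=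
    \int[mu]_(x in K) cometric F x (dw x) `^ p)%E.
Proof.
move=> y0 xiy c00 L0 LN cV Hm H4 a2 a3 e3 FK ldw hdw.
have D0 : 0 < F x0 y by exact: (metric_gt0 finslerF).
have N0 : 0 < N by apply: lt_le_trans LN; rewrite mulr_gt0.
have mK := compact_rV_measurable compactK.
(* Division by [H] brings the values into [[0, 1]], as [lower_functional] requires. *)
pose psi x := H^-1 * (fe x * chi x).
have tfc := test_functionM smooth_fe test_chi.
have tpsi : test_function Omega psi by exact: test_functionZ.
have psi_out x : ~ K x -> psi x = 0 by move=> /chi_out E; rewrite /psi E !mulr0.
have psi_itv x : 0 <= psi x <= 1.
  have /andP[b1 b2] := fchi_itv x; rewrite mulr_ge0 ?invr_ge0 ?(ltW H_gt0) //=.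
  by rewrite ler_pdivrMl // mulr1.
(* With this threshold the subtracted term [kap * \int psi] is at most [s Lam c0 V / 32], half of
   the lower bound [b1] for the pairing. *)
pose kap := s * Lam * c0 * H / 64.
have k0 : 0 < kap by rewrite !mulr_gt0 // invr_gt0.
have := lower_functional Omega_open finslerF n_gt0 p_gt1 ldw tpsi compactK KOmega psi_out psi_itv y0 D0 FK k0.
apply: le_trans; rewrite lee_fin.
have I1 : \int[mu]_(x in Omega) (dot (dw x) y * psi x) = - \int[mu]_(x in Omega) ('D_y phi x * psi x).
  have [_ ->] := integrable_dot_test Omega_open y ldw tpsi.
  have [_ E] := integrable_dot_test Omega_open y
    (fun i => let: And3 _ h _ := weak_differential_test Omega_open tpsi in h i) test_oscillating_bump.
  rewrite (integral_test_by_parts Omega_open _ smooth_oscillating_bump tpsi) opprK.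
  have -> : \int[mu]_(x in Omega) (phi x * 'D_y psi x) = \int[mu]_(x in Omega) (dot (gradient psi x) y * phi x).
    apply: eq_Rintegral => x _; rewrite mulrC dotE; congr (_ * _).
    have spsi : smooth_on setT psi by case: tpsi.
    rewrite (derive_partial _ (smooth_differentiable x spsi)).
    by apply: eq_bigr => i _; rewrite gradientE mulrC.
  rewrite E; apply: eq_bigr => i _; rewrite hdw //; congr (_ * _).
  by apply: eq_Rintegral => x _; rewrite gradientE mulrC.
have srho : smooth_on setT (fun x => chi x ^+ 2).
  by under eq_fun do rewrite expr2; exact: smoothM.
have rho_out x : ~ K x -> chi x ^+ 2 = 0 by move=> /chi_out ->; rewrite expr0n.
have trho : test_function Omega (fun x => chi x ^+ 2) by exact: (test_functionI srho compactK KOmega rho_out).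
have t2 : test_function Omega (fun x => fe x * chi x ^+ 2) by exact: test_functionM.
have sfe2 : smooth_on setT (fun x => fe x ^+ 2) by under eq_fun do rewrite expr2; exact: smoothM.
have t3 : test_function Omega (fun x => fe x ^+ 2 * chi x ^+ 2) by exact: test_functionM.
pose E3 x := (he x * 'D_y chi x) * (fe x * chi x).
have tE : test_function Omega E3.
  by apply: test_functionM tfc; apply: smoothM => //; exact: smooth_derive.
pose c3 := K0 * (C1 * F x0 y) * H.
have c30 : 0 <= c3 by rewrite !mulr_ge0 // ltW.
have E3b : `|\int[mu]_(x in Omega) E3 x| <= c3 * V.
  have [J1 J2] := Rintegral_restrict_cst mO mK KOmega muK c30.
  have iE := test_function_integrable tE mO.
  apply: le_trans (le_normr_Rintegral mO iE) _; apply: le_trans J2.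
  apply: le_Rintegral => //; first exact: integrable_abse iE.
  move=> x Ox; rewrite patchE /E3; case: ifPn => [_|].
    have /andP[b1 b2] := fchi_itv x; rewrite normrM (ger0_norm b1) normrM.
    by apply: ler_pM => //; apply: ler_pM => //; exact: h_le.
  by rewrite notin_setE => /chi_out ->; rewrite !mulr0 normr0.
have I2 : s * N * (c0 * V) / 8 <= \int[mu]_(x in Omega) (dot (dw x) y * psi x).
  rewrite I1; set P1 := \int[mu]_x (chi x ^+ 2) in cV a2 a3.
  set P2 := \int[mu]_x (fe x * chi x ^+ 2) in a2.
  set P3 := \int[mu]_x (fe x ^+ 2 * chi x ^+ 2) in a3.
  set P4 := \int[mu]_(x in Omega) E3 x in E3b.
  have O2 x : ~ K x -> fe x * chi x ^+ 2 = 0 by move=> /rho_out ->; rewrite mulr0.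
  have O3 x : ~ K x -> fe x ^+ 2 * chi x ^+ 2 = 0 by move=> /rho_out ->; rewrite mulr0.
  have e2 : \int[mu]_(x in Omega) (fe x * chi x ^+ 2) = P2 := Rintegral_compact_support O2 KOmega.
  have e3' : \int[mu]_(x in Omega) (fe x ^+ 2 * chi x ^+ 2) = P3 := Rintegral_compact_support O3 KOmega.
  have J2 := test_function_integrable t2 mO.
  have J3 := test_function_integrable t3 mO.
  have J4 := test_function_integrable tE mO.
  have Z (c : R) (g : 'rV[R]_n -> R) (ig : mu.-integrable Omega (EFin \o g)) :=
    @integrable_EFinZl _ _ _ mu Omega c g mO ig.
  have J23 : mu.-integrable Omega (EFin \o (fun x => N * (fe x * chi x ^+ 2) - N * (fe x ^+ 2 * chi x ^+ 2))).
    by have := integrableB mO (Z N _ J2) (Z N _ J3).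
  have J234 : mu.-integrable Omega (EFin \o
      (fun x => N * (fe x * chi x ^+ 2) - N * (fe x ^+ 2 * chi x ^+ 2) + e * E3 x)).
    by have := integrableD mO J23 (Z e _ J4).
  have -> : \int[mu]_(x in Omega) ('D_y phi x * psi x) = s / H * (N * P2 - N * P3 + e * P4).
    rewrite -e2 -e3' -!RintegralZl // -RintegralB //; [|exact: Z|exact: Z].
    rewrite -RintegralD //; last exact: Z.
    rewrite -RintegralZl //; apply: eq_Rintegral => x _.
    by rewrite derive_oscillating_bump xiy /psi /E3; ring.
  have P4b : e * P4 <= N * (c0 * V * H / 16).
    apply: le_trans e3; rewrite ler_pM2l //; exact: le_trans (ler_norm _) E3b.
  (* [m >= H / 2] and [H >= 4] give [m - 1 >= H / 4]. The two averaging errors [c0 V H / 32] and the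
     cutoff error [c0 V H / 16] together consume half of the resulting term. *)
  have hm : H / 4 * (c0 * V) <= (m - 1) * P1.
    apply: (@le_trans _ _ ((m - 1) * (c0 * V))).
      by rewrite ler_wpM2r //; [rewrite mulr_ge0 // ltW|lra].
    by rewrite ler_wpM2l //; lra.
  move: a2 a3; rewrite !ler_norml => /andP[_ a2] /andP[a3 _].
  have key : H * (c0 * V) / 8 <= P3 - P2 - c0 * V * H / 16.
    by move: hm a2 a3; rewrite mulrBl mul1r; set q := c0 * V; lra.
  have -> : s * N * (c0 * V) / 8 = s / H * (N * (H * (c0 * V) / 8)) by field; rewrite gt_eqF.
  rewrite -mulrN ler_pM2l ?divr_gt0 //.
  have {}key := ler_wpM2l (ltW N0) key; apply: le_trans key _.
  by move: P4b; rewrite !mulrBr; lra.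
have I3 : \int[mu]_(x in Omega) psi x <= 2 * V / H.
  have J := test_function_integrable tfc mO.
  rewrite RintegralZl // mulrC ler_pM2r ?invr_gt0 //.
  have O0 x : ~ K x -> fe x * chi x = 0 by move=> /chi_out ->; rewrite mulr0.
  rewrite (Rintegral_compact_support O0 KOmega).
  have := le_trans (ler_norm _) avg1; rewrite lerBlDr => /le_trans; apply.
  by rewrite mulr_natl mulr2n lerD2l.
have sL : 0 < s * Lam by rewrite mulr_gt0.
apply: (@le_trans _ _ (kap `^ (p - 1) * (s * Lam * c0 * V / 32))).
  have -> : kap = c0 / 64 * ((s * Lam) * H) by rewrite /kap; ring.
  have c64 : 0 <= c0 / 64 by rewrite divr_ge0 // ltW.
  have -> : (c0 / 64 * ((s * Lam) * H)) `^ (p - 1) =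
      (c0 / 64) `^ (p - 1) * ((s * Lam) `^ (p - 1) * H `^ (p - 1)).
    rewrite (@powRM _ _ (s * Lam * H)) //; last by rewrite mulr_ge0 // ltW.
    by rewrite (@powRM _ (s * Lam) H) // ltW.
  rewrite -(mulr_powRB1 (ltW sL) (lt_trans ltr01 p_gt1)).
  set A := _ `^ (p - 1); set B := _ `^ (p - 1); set C := _ `^ (p - 1).
  by rewrite le_eqVlt; apply/orP; left; apply/eqP; ring.
rewrite ler_wpM2l ?powR_ge0 //.
have b1 : s * Lam * (c0 * V) / 16 <= (\int[mu]_(x in Omega) (dot (dw x) y * psi x)) / (2 * F x0 y).
  rewrite ler_pdivlMr ?mulr_gt0 //; apply: le_trans I2.
  have -> : s * Lam * (c0 * V) / 16 * (2 * F x0 y) = s * (c0 * V) / 8 * (Lam * F x0 y) by field.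
  have -> : s * N * (c0 * V) / 8 = s * (c0 * V) / 8 * N by ring.
  by rewrite ler_wpM2l // !mulr_ge0 // ?ltW // invr_ge0.
have b2 : kap * \int[mu]_(x in Omega) psi x <= s * Lam * (c0 * V) / 32.
  apply: le_trans (ler_wpM2l (ltW k0) I3) _; rewrite le_eqVlt; apply/orP; left; apply/eqP.
  by rewrite /kap; field; rewrite gt_eqF.
by apply: le_trans (lerB b1 b2); rewrite le_eqVlt; apply/orP; left; apply/eqP; field.
Qed.

End oscillating_bump.

Section expensive_reversal.
Context {R : realType} {n : nat}.
Context (Omega : set 'rV[R]_n) (F : 'rV[R]_n -> 'rV[R]_n -> R) (p : R).
Context (Omega_open : open Omega) (finslerF : finsler_metric Omega F).
Context (n_gt0 : (0 < n)%N) (p_gt1 : 1 < p).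
Notation mu := (lebesgue n : {measure set 'rV[R]_n -> \bar R}).

Lemma supporting_covector x z : Omega x -> z != 0 ->
  exists xi, dot xi z = F x z /\ forall v, dot xi v <= F x v.
Proof.
move=> Ox z0; have mk := metric_minkowski finslerF Ox.
have dF := minkowski_differentiable mk z0.
have E v : dot (gradient (F x) z) v = 'D_v (F x) z.
  by rewrite dotE (derive_partial _ dF); apply: eq_bigr => i _; rewrite gradientE mulrC.
exists (gradient (F x) z); split => [|v]; rewrite E; last exact: minkowski_fundamental.
rewrite (@euler_homogeneous _ _ (F x) 1) ?mul1r // => a a0.
by rewrite expr1 (minkowskiZ mk) // ltW.
Qed.

Lemma covector_reverse_bound x xi : Omega x -> exists2 M, 1 <= M & forall v, - dot xi v <= M * F x v.
Proof.
move=> Ox; have [c c0 hc] := metric_lower_bound finslerF n_gt0 Ox.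
have S0 : 0 <= \sum_i `|xi ord0 i| by apply: sumr_ge0.
exists ((\sum_i `|xi ord0 i|) / c + 1); first by rewrite lerDr divr_ge0 // ltW.
move=> v; rewrite -dotNr; apply: le_trans (dot_le _ _) _; rewrite normrN mulrDl mul1r.
apply: (@le_trans _ _ ((\sum_i `|xi ord0 i|) / c * F x v)); last first.
  by rewrite lerDl (metric_ge0 finslerF).
by rewrite -mulrA ler_wpM2l // ler_pdivlMl.
Qed.

Lemma test_derive_bound x chi K : Omega x -> smooth_on setT chi -> compact K ->
  (forall v, ~ K v -> chi v = 0) ->
  exists2 C : R, 0 <= C & forall v z, `|'D_z chi v| <= C * F x z.
Proof.
move=> Ox sc cK c0; have [c cp hc] := metric_lower_bound finslerF n_gt0 Ox.
have B i : exists b : R, 0 <= b /\ forall v, `|partial i chi v| <= b.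
  have [b [b0 hb]] := continuous_compact_bounded (smooth_continuous (smooth_derive (delta_mx ord0 i) sc)) cK.
  exists b; split => // v; have [/hb//|nK] := pselect (K v).
  by rewrite /partial (derive_outside _ (compact_rV_closed cK) c0 nK) normr0.
have [b hb] := choice B.
exists ((\sum_i b i) / c).
  by rewrite divr_ge0 ?(ltW cp) // sumr_ge0 // => i _; have [] := hb i.
move=> v z; rewrite (derive_partial _ (smooth_differentiable v sc)).
apply: le_trans (ler_norm_sum _ _ _) _.
apply: (@le_trans _ _ ((\sum_i b i) * `|z|)).
  rewrite mulr_suml; apply: ler_sum => i _; rewrite normrM mulrC.
  by apply: ler_pM => //; [have [_ ->] := hb i|exact: rV_coord_le_norm].
rewrite -mulrA ler_wpM2l ?sumr_ge0 // => [i _|]; first by have [] := hb i.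
by rewrite ler_pdivlMl.
Qed.

(** [Lam] depends on [delta] but not on the point, the open set or the bump: amplitude, height and
    support enter both energies through the same product [s^p H^(p - 1) V], so their ratio is
    governed by [Lam^p] alone. *)
Lemma expensive_reversal (delta : R) : 0 < delta -> exists2 Lam : R, 0 < Lam &
  forall (U : set 'rV[R]_n) x0 y, open U -> U `<=` Omega -> U x0 -> y != 0 ->
  Lam * F x0 y <= F x0 (- y) ->
  exists (phi : 'rV[R]_n -> R) (K : set 'rV[R]_n),
  [/\ compact K, K `<=` U, smooth_on setT phi & forall x, ~ K x -> phi x = 0] /\
  [/\ (\int[mu]_(x in Omega) (`|phi x| `^ p)%:E <= delta%:E)%E,
      (\int[mu]_(x in Omega) cometric F x (gradient phi x) `^ p <= delta%:E)%E &
      forall dw : 'rV[R]_n -> 'rV[R]_n,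
      (forall i, locally_integrable_row Omega (fun x => dw x ord0 i)) ->
      (forall psi i, test_function Omega psi -> (forall x, ~ K x -> psi x = 0) ->
        \int[mu]_(x in Omega) (dw x ord0 i * psi x) = \int[mu]_(x in Omega) (phi x * partial i psi x)) ->
      (1 <= \int[mu]_(x in K) cometric F x (dw x) `^ p)%E].
Proof.
move=> delta0; have p0 : 0 < p by exact: lt_trans p_gt1.
have eqW (a b : R) : a = b -> a <= b by move=> ->.
have p10 : 0 < p - 1 by rewrite subr_gt0.
have [c0 c00 bump] := @cube_bump R n.
(* [A] and [C2] are the constants of the upper and the lower energy bound. With
   [s^p H^(p - 1) V = dl], the former becomes [A dl = delta] and the latter [C2 Lam^p dl = 1]. *)
pose A := 4 `^ p * (2 + 2 `^ p); have A0 : 0 < A by rewrite mulr_gt0 ?addr_gt0 ?powR_gt0.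
pose dl := delta / A; have dl0 : 0 < dl by rewrite divr_gt0.
pose C2 := (c0 / 64) `^ (p - 1) * (c0 / 32).
have C20 : 0 < C2 by rewrite mulr_gt0 ?powR_gt0 ?divr_gt0.
exists ((C2 * dl)^-1 `^ p^-1); first by rewrite powR_gt0 // invr_gt0 mulr_gt0.
set Lam := _ `^ p^-1; have Lam0 : 0 < Lam by rewrite powR_gt0 // invr_gt0 mulr_gt0.
have LamE : Lam `^ p = (C2 * dl)^-1.
  by rewrite -powRrM mulVf ?gt_eqF // powRr1 // ltW // invr_gt0 mulr_gt0.
move=> U x0 y oU UO Ux0 y0 hy; have Ox0 := UO _ Ux0.
have ny0 : - y != 0 by rewrite oppr_eq0.
have D0 := metric_gt0 finslerF Ox0 y0; have N0 := metric_gt0 finslerF Ox0 ny0.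
have [xi [xiy xi_le]] := supporting_covector Ox0 ny0.
have [M M1 xi_ge] := covector_reverse_bound xi Ox0.
(* A height of at least 4 is needed for the lower bound, and [H >= M^(p / (p - 1))] gives
   [M^p <= H^(p - 1)], so that the descents cost no more than the peaks in the estimate. *)
have [H [m [K0 [f [h [k [[HM H0] Hm [sf sh sk] [fH hK kK] [dh dk]]]]]]]] :=
  oscillating_profile (Num.max 4 (M `^ (p / (p - 1)))).
move: HM; rewrite ge_max => /andP[H4 HM].
have MH : M `^ p <= H `^ (p - 1).
  have -> : M `^ p = (M `^ (p / (p - 1))) `^ (p - 1).
    by rewrite -powRrM divfK // gt_eqF.
  by apply: ge0_ler_powR; rewrite ?nnegrE ?powR_ge0 ?(ltW H0) ?(ltW p10).
have K00 : 0 <= K0 by exact: le_trans (hK 0).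
(* The bump is placed where the metric is comparable with its value at [x0]: from below in all
   directions for the upper bound, from above in the direction [y] for the lower bound. *)
pose U' := U `&` (interior [set x | Omega x /\ forall z, F x0 z <= 2 * F x z] `&`
  interior [set x | F x y <= 2 * F x0 y]).
have oU' : open U' by apply: openI => //; apply: openI; exact: open_interior.
have U'x0 : U' x0.
  split => //; split; first by apply: filterS (metric_near_equiv Omega_open finslerF Ox0)
      => x [Ox hx]; split => // z; have [] := hx z.
  have /cvgrPdist_lt /(_ _ D0) h1 := metric_continuous1 finslerF Ox0 y0.
  apply: filterS h1 => x /=; rewrite ltr_norml => /andP[h2 h3]; lra.
have [chi [V [K [[cK KU' muK V0] [schi chi01 chi_out int_chi cV]]]]] := bump U' x0 oU' U'x0.
have KU : K `<=` U by move=> x /KU' [].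
have KO : K `<=` Omega by move=> x /KU /UO.
have near_x0 x : K x -> forall z, F x0 z <= 2 * F x z.
  by move=> /KU' [_ [/interior_subset[_ h1] _]].
have near_y x : K x -> F x y <= 2 * F x0 y.
  by move=> /KU' [_ [_ /interior_subset]].
have [C1 C10 chiD] := test_derive_bound Ox0 schi cK chi_out.
pose s := (dl / (H `^ (p - 1) * V)) `^ p^-1.
have HV0 : 0 < H `^ (p - 1) * V by rewrite mulr_gt0 ?powR_gt0.
have s0 : 0 < s by rewrite powR_gt0 // divr_gt0.
have sE : s `^ p = dl / (H `^ (p - 1) * V).
  by rewrite -powRrM mulVf ?gt_eqF // powRr1 // ltW // divr_gt0.
pose d2 := c0 * V * H / 32; have d20 : 0 < d2 by rewrite !mulr_gt0.
pose w := - (F x0 (- y))^-1 *: y.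
have xiy' : dot xi y = - F x0 (- y) by rewrite -xiy dotNr opprK.
have xiw : dot xi w = 1.
  by rewrite /w dotZr xiy' mulrNN mulVf // gt_eqF.
have tchi : test_function setT chi by exact: (test_functionI schi cK).
have srho : smooth_on setT (fun x => chi x ^+ 2) by under eq_fun do rewrite expr2; exact: smoothM.
have trho : test_function setT (fun x => chi x ^+ 2).
  by apply: (test_functionI srho cK) => // x /chi_out ->; rewrite expr0n.
have sf2 : smooth_on setT (fun t => f t ^+ 2) by under eq_fun do rewrite expr2; exact: smoothM.
have small (a b : R) : 0 <= a -> 0 < b -> \forall e \near 0^'+, e * a <= b.
  move=> a0 b0; near=> e; have : e < b / (a + 1).
    by near: e; apply: nbhs_right_lt; rewrite divr_gt0 // ltr_wpDl.
  have e0 : 0 < e by near: e; exact: nbhs_right_gt.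
  rewrite ltr_pdivlMr ?ltr_wpDl // => /ltW; apply: le_trans.
  by rewrite ler_pM2l // lerDl.
have avg1 := oscillation_average sf sh dh hK xiw tchi V0.
have avg2 := oscillation_average sf sh dh hK xiw trho d20.
have avg3 := oscillation_average sf2 sk dk kK xiw trho d20.
have sm1 := small _ 1 (mulr_ge0 K00 C10) ltr01.
have q0 : 0 < (delta / V) `^ p^-1 by rewrite powR_gt0 // divr_gt0.
have sm2 := small _ _ (mulr_ge0 (ltW s0) K00) q0.
have c30 : 0 <= K0 * (C1 * F x0 y) * H * V by rewrite !mulr_ge0 // ltW.
have r0 : 0 < F x0 (- y) * (c0 * V * H / 16) by rewrite !mulr_gt0.
have sm3 := small _ _ c30 r0.
(* The wavelength is chosen last: all the conditions hold for sufficiently small [e]. *)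
have [e [e0 [a1 a2 a3] [s1 s2 s3]]] : exists e, [/\ 0 < e,
    [/\ `|\int[mu]_x (oscillate xi e f x * chi x) - 1 * \int[mu]_x chi x| <= V,
        `|\int[mu]_x (oscillate xi e f x * chi x ^+ 2) - 1 * \int[mu]_x (chi x ^+ 2)| <= d2 &
        `|\int[mu]_x (oscillate xi e (fun t => f t ^+ 2) x * chi x ^+ 2) - m * \int[mu]_x (chi x ^+ 2)| <= d2] &
    [/\ e * (K0 * C1) <= 1, e * (s * K0) <= (delta / V) `^ p^-1 &
        e * (K0 * (C1 * F x0 y) * H * V) <= F x0 (- y) * (c0 * V * H / 16)]].
  near (0 : R)^'+ => e; exists e; split; first by near: e; exact: nbhs_right_gt.
    by split; near: e.
  by split; near: e.
rewrite mul1r in a1; rewrite mul1r in a2.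
exists (oscillating_bump chi xi h s e), K; split; split => //.
- exact: smooth_oscillating_bump.
- by move=> x; exact: oscillating_bump_out.
- apply: (integral_oscillating_bump_le Omega_open p_gt1 cK KO muK V0 schi chi01 chi_out xi sh hK s0 e0 delta0).
  by rewrite -mulrA mulrCA.
- have s1' : e * K0 * C1 <= 1 by rewrite -mulrA.
  apply: le_trans (integral_cometric_oscillating_bump Omega_open finslerF n_gt0 p_gt1 Ox0 cK KO muK
     schi chi01 chi_out int_chi near_x0 M1 xi_le xi_ge MH sf sh fH hK dh chiD s0 e0 s1' a1) _.
  rewrite lee_fin powRM ?(ltW s0) // sE; apply: eqW.
  have Hp : 0 < H `^ (p - 1) by rewrite powR_gt0.
  have p4 : 0 < 4 `^ p :> R by rewrite powR_gt0.
  have p2 : 0 < 2 + 2 `^ p :> R by rewrite addr_gt0 // powR_gt0.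
  rewrite /dl /A; set a := H `^ _ in Hp *; set b := 4 `^ p in p4 *; set c := 2 `^ p in p2 *.
  by field; rewrite !gt_eqF.
- move=> dw ldw hdw.
  apply: le_trans (integral_cometric_reversed_ge Omega_open finslerF n_gt0 p_gt1 Ox0 cK KO muK V0
     schi chi01 chi_out int_chi H0 sf sh fH hK dh C10 chiD s0 e0 a1 y0 xiy' c00 Lam0 hy cV Hm H4
     a2 a3 s3 near_y ldw hdw).
  rewrite lee_fin -/C2 powRM ?(ltW s0) ?(ltW Lam0) // sE LamE.
  have Hp : 0 < H `^ (p - 1) by rewrite powR_gt0.
  apply: eqW; set a := H `^ _ in Hp *.
  by field; rewrite !gt_eqF.
Unshelve. all: by end_near. Qed.

End expensive_reversal.

(** * Disjoint bumps that leave every compact set *)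

Section irreversible_sobolev.
Context {R : realType} {n : nat}.
Context (Omega : set 'rV[R]_n) (F : 'rV[R]_n -> 'rV[R]_n -> R) (p : R).
Context (Omega_open : open Omega) (finslerF : finsler_metric Omega F).
Context (n_gt0 : (0 < n)%N) (p_gt1 : 1 < p).
Notation mu := (lebesgue n : {measure set 'rV[R]_n -> \bar R}).

Let mO : measurable Omega. Proof. exact: open_rV_measurable. Qed.
Let p_gt0 : 0 < p. Proof. exact: lt_trans p_gt1. Qed.

(** On compact sets the reversibility is finite, so points with a larger ratio lie outside; this is
    what lets the bumps escape. *)
Lemma compact_reversible (C : set 'rV[R]_n) : compact C -> C `<=` Omega ->
  exists L : R, forall z w, C z -> w != 0 -> F z (- w) <= L * F z w.
Proof.
move=> /compact_near_coveringP cC CO.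
have [|m _ /(_ m (leqnn m)) h] := cC nat \oo
    (fun m z => forall w, w != 0 -> F z (- w) <= m%:R * F z w) _; last first.
  by exists m%:R => z w /h; apply.
move=> z0 /CO O0; have [c c0 hc] := metric_lower_bound finslerF n_gt0 O0.
have [b b0 hb] := metric_upper_bound finslerF n_gt0 O0.
have nz := metric_near_equiv Omega_open finslerF O0.
(* On this neighbourhood [F (z, - w) <= 2 b |w|] and [|w| <= 2 F (z, w) / c], whence the ratio
   [4 b / c]. *)
exists ([set x | Omega x /\ forall y, F z0 y <= 2 * F x y /\ F x y <= 2 * F z0 y],
  [set m : nat | 4 * b / c <= m%:R]).
  split => //=; near=> m; near: m; exact: nbhs_infty_ger.
move=> [z m] /= [[Oz hz] hm] w w0; have Fz := metric_gt0 finslerF Oz w0.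
have [_ h1] := hz (- w); have [h2 _] := hz w.
apply: (le_trans h1); apply: (@le_trans _ _ (4 * b / c * F z w)); last by rewrite ler_wpM2r // ltW.
have h3 := hb (- w); rewrite normrN in h3; have h4 := hc w.
have h5 : `|w| <= 2 * F z w / c by rewrite ler_pdivlMr // mulrC (le_trans h4).
apply: (@le_trans _ _ (2 * (b * `|w|))); first by rewrite ler_pM2l.
have -> : 4 * b / c * F z w = 2 * (b * (2 * F z w / c)) by ring.
by rewrite ler_pM2l // ler_pM2l.
Unshelve. all: by end_near. Qed.

Context (irreversible : forall L : R, exists z w, [/\ Omega z, w != 0 & L * F z w < F z (- w)]).

(** The upper bounds are summable, with tail sums [2^(- k)], whereas the lower bound for the
    opposite function is the same for all [j]. *)
Definition expensive_bump (C : set 'rV[R]_n) (j : nat) (phi : 'rV[R]_n -> R) (K : set 'rV[R]_n) : Prop :=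
  [/\ compact K, K `<=` Omega `\` C, smooth_on setT phi & forall x, ~ K x -> phi x = 0] /\
  [/\ (\int[mu]_(x in Omega) (`|phi x| `^ p)%:E <= (2 ^- j.+1)%:E)%E,
      (\int[mu]_(x in Omega) cometric F x (gradient phi x) `^ p <= (2 ^- j.+1)%:E)%E &
      forall dw : 'rV[R]_n -> 'rV[R]_n,
      (forall i, locally_integrable_row Omega (fun x => dw x ord0 i)) ->
      (forall psi i, test_function Omega psi -> (forall x, ~ K x -> psi x = 0) ->
        \int[mu]_(x in Omega) (dw x ord0 i * psi x) = \int[mu]_(x in Omega) (phi x * partial i psi x)) ->
      (1 <= \int[mu]_(x in K) cometric F x (dw x) `^ p)%E].

Lemma expensive_bump_exists C j : compact C -> C `<=` Omega ->
  exists q : ('rV[R]_n -> R) * set 'rV[R]_n, expensive_bump C j q.1 q.2.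
Proof.
move=> cC CO; have [L hL] := compact_reversible cC CO.
have [|Lam L0 hLam] := expensive_reversal Omega_open finslerF n_gt0 p_gt1 (delta := 2 ^- j.+1).
  by rewrite invr_gt0 exprn_gt0.
have [z [w [Oz w0 hw]]] := irreversible (Num.max Lam L).
have Fz := metric_gt0 finslerF Oz w0.
have Cz : ~ C z.
  move=> Cz; move: hw; rewrite ltNge; apply/negP; rewrite negbK.
  apply: le_trans (hL z w Cz w0) _; rewrite ler_wpM2r ?le_max ?lexx ?orbT //; exact: ltW.
have oU : open (Omega `\` C).
  by apply: openI => //; apply: closed_openC; exact: compact_rV_closed.
have hw' : Lam * F z w <= F z (- w).
  by apply: le_trans (ltW hw); rewrite ler_wpM2r ?le_max ?lexx //; exact: ltW.
by have [phi [K h]] := hLam _ z w oU (@subDsetl _ _ _) (conj Oz Cz) w0 hw'; exists (phi, K).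
Qed.

Lemma exhaustion_sub (A : set 'rV[R]_n) m : exhaustion A m `<=` A.
Proof.
rewrite /exhaustion -bigcup_mkord => x [k _]; rewrite /exhaustion_piece.
by case: unpickle => [q|//]; case: asboolP => // h /h.
Qed.

Lemma exhaustion_mono (A : set 'rV[R]_n) m m' : (m <= m')%N -> exhaustion A m `<=` exhaustion A m'.
Proof.
move=> mm; rewrite /exhaustion -!bigcup_mkord => x [k km kx]; exists k => //=.
exact: leq_trans mm.
Qed.

Lemma expensive_sequence : exists (phi : nat -> 'rV[R]_n -> R) (K : nat -> set 'rV[R]_n),
  (forall j, expensive_bump (exhaustion Omega j) j (phi j) (K j)) /\
  forall i j x, (i < j)%N -> K i x -> ~ K j x.
Proof.
have /choice[pick hpick] : forall a : set 'rV[R]_n * nat, exists q : ('rV[R]_n -> R) * set 'rV[R]_n,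
    compact a.1 -> a.1 `<=` Omega -> expensive_bump a.1 a.2 q.1 q.2.
  move=> [C j] /=; have [[cC CO]|h] := pselect (compact C /\ C `<=` Omega).
    by have [q hq] := expensive_bump_exists j cC CO; exists q.
  by exists (fun=> 0, set0) => cC CO; exfalso; apply: h.
(* [avoid j] collects the supports already used; together with the exhaustion it is the compact set
   that the next bump must miss. *)
pose fix avoid j : set 'rV[R]_n := if j is i.+1 then
  avoid i `|` (pick (avoid i `|` exhaustion Omega i, i)).2 else set0.
pose bump j := pick (avoid j `|` exhaustion Omega j, j).
have bumpE j : avoid j.+1 = avoid j `|` (bump j).2 by [].
have inv j : [/\ compact (avoid j), avoid j `<=` Omega &
    expensive_bump (avoid j `|` exhaustion Omega j) j (bump j).1 (bump j).2].
  have good i : compact (avoid i) -> avoid i `<=` Omega ->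
      expensive_bump (avoid i `|` exhaustion Omega i) i (bump i).1 (bump i).2.
    move=> cA AO; apply: (hpick (avoid i `|` exhaustion Omega i, i)) => /=.
      by apply: compactU => //; exact: exhaustion_compact.
    by rewrite subUset; split => //; exact: exhaustion_sub.
  elim: j => [|j [cA AO hb]].
    by split; [exact: compact0| |apply: good => //; exact: compact0].
  have [[cK KO _ _] _] := hb.
  have cA' : compact (avoid j.+1) by rewrite bumpE; exact: compactU.
  have AO' : avoid j.+1 `<=` Omega by rewrite bumpE subUset; split => // x /KO [].
  by split => //; exact: good.
exists (fun j => (bump j).1), (fun j => (bump j).2); split.
  move=> j; have [_ _ [[cK KO sb b0] h]] := inv j; split => //; split => // x /KO [Ox nx].
  by split => // ex; apply: nx; right.
have mono i j : (i < j)%N -> (bump i).2 `<=` avoid j.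
  elim: j => // j IH; rewrite ltnS leq_eqVlt bumpE => /predU1P[<-|/IH h] x bx; first by right.
  by left; exact: h.
move=> i j x ij bi bj; have [_ _ [[_ KO _ _] _]] := inv j.
by have [_ h] := KO _ bj; apply: h; left; exact: mono ij _ bi.
Qed.

End irreversible_sobolev.

(** * The sum of the bumps *)

Section locally_finite_sum.
Context {R : realType} {n : nat}.
Context (Omega : set 'rV[R]_n) (F : 'rV[R]_n -> 'rV[R]_n -> R) (p : R).
Context (Omega_open : open Omega) (finslerF : finsler_metric Omega F).
Context (n_gt0 : (0 < n)%N) (p_gt1 : 1 < p).
Notation mu := (lebesgue n : {measure set 'rV[R]_n -> \bar R}).
Context (phi : nat -> 'rV[R]_n -> R) (K : nat -> set 'rV[R]_n).
Context (bump : forall j, expensive_bump Omega F p (exhaustion Omega j) j (phi j) (K j)).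
Context (disj : forall i j x, (i < j)%N -> K i x -> ~ K j x).

Let mO : measurable Omega. Proof. exact: open_rV_measurable. Qed.
Let p_gt0 : 0 < p. Proof. exact: lt_trans p_gt1. Qed.

(** The supports are disjoint, so at most one index qualifies. Outside all of them the default index
    0 is harmless, because [phi 0] and its gradient vanish there. *)
Definition bump_index (x : 'rV[R]_n) : nat := xget 0%N [set j | K j x].
Definition bump_sum (x : 'rV[R]_n) : R := phi (bump_index x) x.
Definition bump_gradient (x : 'rV[R]_n) : 'rV[R]_n := gradient (phi (bump_index x)) x.
Definition partial_bump_sum m (x : 'rV[R]_n) : R := \sum_(j < m) phi j x.

Let phi_out j x : ~ K j x -> phi j x = 0.
Proof. by move: x; have [[_ _ _ h] _] := bump j. Qed.

Let smooth_phi j : smooth_on setT (phi j).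
Proof. by have [[_ _ h _] _] := bump j. Qed.

Let KOmega j : K j `<=` Omega.
Proof. by move=> x; have [[_ h _ _] _] := bump j; move=> /h []. Qed.

Let compactK j : compact (K j). Proof. by have [[]] := bump j. Qed.

Let grad_out j x : ~ K j x -> gradient (phi j) x = 0.
Proof.
move=> nK; apply/rowP => i; rewrite gradientE mxE.
exact: (derive_outside (delta_mx ord0 i) (compact_rV_closed (@compactK j)) (@phi_out j) nK).
Qed.

Let test_phi j : test_function Omega (phi j).
Proof. exact: (test_functionI (@smooth_phi j) (@compactK j) (@KOmega j) (@phi_out j)). Qed.

Let disj' i j x : K i x -> K j x -> i = j.
Proof. by move=> Ki Kj; case: (ltngtP i j) => // ij; [case: (disj ij Ki)|case: (disj ij Kj)]. Qed.

Let bump_indexE j x : K j x -> bump_index x = j.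
Proof.
move=> Kj; have h : K (bump_index x) x by apply: (@xgetPex _ 0%N [set j | K j x]); exists j.
exact: disj' h Kj.
Qed.

Lemma test_partial_bump_sum m : test_function Omega (partial_bump_sum m).
Proof.
elim: m => [|m IH].
  have -> : partial_bump_sum 0 = (fun=> 0) by apply/funext => x; rewrite /partial_bump_sum big_ord0.
  exact: test_function0.
have -> : partial_bump_sum m.+1 = (fun x => partial_bump_sum m x + phi m x).
  by apply/funext => x; rewrite /partial_bump_sum big_ord_recr.
exact: test_functionD.
Qed.

Let gradient_partial m x : gradient (partial_bump_sum m) x = \sum_(j < m) gradient (phi j) x.
Proof.
apply/rowP => i; rewrite gradientE summxE /partial.
have -> : partial_bump_sum m = \sum_(j < m) phi j.
  by apply/funext => z; rewrite /partial_bump_sum fct_sumE.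
rewrite derive_sum; first by apply: eq_bigr => j _; rewrite gradientE.
by move=> j; apply: diff_derivable; exact: smooth_differentiable (@smooth_phi j).
Qed.

Lemma bump_sum_tail m x :
  (exists j, [/\ (m <= j)%N, K j x, bump_sum x - partial_bump_sum m x = phi j x &
     bump_gradient x - gradient (partial_bump_sum m) x = gradient (phi j) x]) \/
  (bump_sum x = partial_bump_sum m x /\ bump_gradient x = gradient (partial_bump_sum m) x).
Proof.
rewrite gradient_partial; have [[j Kj]|nK] := pselect (exists j, K j x); last first.
  right; rewrite /bump_sum /bump_gradient /partial_bump_sum.
  have out j : ~ K j x by move=> Kj; apply: nK; exists j.
  by rewrite phi_out // grad_out // !big1 // => j _; [exact: grad_out|exact: phi_out].
have out i : i != j -> ~ K i x by move=> /eqP ij Ki; apply: ij; exact: disj' Ki Kj.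
have jE := bump_indexE Kj; rewrite /bump_sum /bump_gradient jE /partial_bump_sum.
have [mj|jm] := leqP m j.
  left; exists j; rewrite !big1 ?subr0 // => i _; [apply: grad_out|apply: phi_out];
    by apply: out; rewrite neq_ltn (leq_trans (ltn_ord i) mj).
right; rewrite (bigD1 (Ordinal jm)) //= [X in _ + X]big1 ?addr0 => [|i ij]; last first.
  by apply: phi_out; apply: out; move: ij; rewrite -val_eqE.
rewrite (bigD1 (Ordinal jm)) //= big1 ?addr0 => [//|i ij].
by apply: grad_out; apply: out; move: ij; rewrite -val_eqE.
Qed.

Lemma bump_sum_exhaustion m x : exhaustion Omega m x ->
  bump_sum x = partial_bump_sum m x /\ bump_gradient x = gradient (partial_bump_sum m) x.
Proof.
move=> mx; have [[j [mj Kj _ _]]|//] := bump_sum_tail m x.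
have [[_ h _ _] _] := bump j; have [_ nx] := h _ Kj.
by exfalso; apply: nx; exact: exhaustion_mono mj _ mx.
Qed.

Lemma bump_sum_compact C : compact C -> C `<=` Omega -> exists m, forall x, C x ->
  bump_sum x = partial_bump_sum m x /\ bump_gradient x = gradient (partial_bump_sum m) x.
Proof.
move=> cC CO; have [m hm] := exhaustion_absorbs Omega_open cC CO.
by exists m => x /hm; exact: bump_sum_exhaustion.
Qed.

Lemma exhaustion_point x : Omega x -> exists m, exhaustion Omega m x.
Proof.
move=> Ox; have [m hm] := @exhaustion_absorbs _ _ Omega [set x] Omega_open (@compact_set1 _ x)
  (fun y (e : y = x) => eq_ind_r Omega Ox e).
by exists m; exact: hm.
Qed.

Let locally_integrable_limit (v : 'rV[R]_n -> R) (v_ : nat -> 'rV[R]_n -> R) :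
  (forall m, locally_integrable_row Omega (v_ m)) ->
  (forall m x, exhaustion Omega m x -> v x = v_ m x) -> locally_integrable_row Omega v.
Proof.
move=> lv vE; split.
  apply: (@measurable_fun_cvg _ _ _ _ v_) => [m|x Ox]; first by case: (lv m).
  have [m hm] := exhaustion_point Ox.
  apply: cvg_near_cst; exists m => // k /= mk.
  by rewrite -(vE k) //; exact: exhaustion_mono mk _ hm.
move=> C cC CO; have [m hm] := exhaustion_absorbs Omega_open cC CO.
have [_ /(_ C cC CO)] := lv m; apply: eq_integrable; first exact: compact_rV_measurable.
by move=> x /set_mem Cx; rewrite /= (vE m) //; exact: hm.
Qed.

(** The support of a test function meets only finitely many bumps, so the identity reduces to a
    finite sum; measurability comes from partial sums that are eventually constant at each point. *)
Lemma weak_differential_bump_sum : weak_differential Omega bump_sum bump_gradient.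
Proof.
have w m := weak_differential_test Omega_open (test_partial_bump_sum m).
split.
- apply: (@locally_integrable_limit _ partial_bump_sum) => [m|m x mx]; first by case: (w m).
  by have [] := bump_sum_exhaustion mx.
- move=> i; apply: (@locally_integrable_limit _ (fun m x => gradient (partial_bump_sum m) x ord0 i)) => [m|m x mx].
    by case: (w m).
  by have [_ ->] := bump_sum_exhaustion mx.
- move=> psi i tpsi; have [C [cC CO spsi psi0]] := test_functionE tpsi.
  have [m hm] := bump_sum_compact cC CO; have [_ _ /(_ psi i tpsi)] := w m.
  rewrite (@eq_Rintegral _ _ _ mu Omega (fun x => bump_sum x * partial i psi x)); last first.
    move=> x _; have [/hm[-> _]//|nC] := pselect (C x).
    by rewrite /partial (derive_outside _ (compact_rV_closed cC) psi0 nC) !mulr0.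
  have psiE : \int[mu]_(x in Omega) (gradient (partial_bump_sum m) x ord0 i * psi x) =
      \int[mu]_(x in Omega) (bump_gradient x ord0 i * psi x).
    apply: eq_Rintegral => x _; have [/hm[_ ->]//|nC] := pselect (C x).
    by rewrite psi0 // !mulr0.
  by rewrite psiE.
Qed.

Let geometric_tail k : (\sum_(0 <= j <oo) (2 ^- (k + j).+1)%:E <= (2 ^- k : R)%:E)%E.
Proof.
have k0 : 0 <= 2 ^- k :> R by rewrite invr_ge0 exprn_ge0.
have := @epsilon_trick R (fun=> 0%E) (2 ^- k) xpredT (fun=> lexx _) k0.
rewrite [X in (_ <= X + _)%E]eseries0 // add0e; apply: le_trans; apply: lee_nneseries => // i _.
by rewrite add0e lee_fin -addnS exprD invfM natrX.
Qed.

(** [G] stands for a remainder of index [k]: by disjointness it is at each point zero or a single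
    term, hence dominated by the series of the terms. *)
Let integral_tail (g : nat -> 'rV[R]_n -> \bar R) (G : 'rV[R]_n -> \bar R) k :
  (forall j, measurable_fun Omega (g j)) -> measurable_fun Omega G ->
  (forall j x, Omega x -> (0 <= g j x)%E) -> (forall x, Omega x -> (0 <= G x)%E) ->
  (forall x, Omega x -> G x = 0%E \/ exists j, (k <= j)%N /\ G x = g j x) ->
  (forall j, (\int[mu]_(x in Omega) g j x <= (2 ^- j.+1)%:E)%E) ->
  (\int[mu]_(x in Omega) G x <= (2 ^- k)%:E)%E.
Proof.
move=> mg mG g0 G0 hG hI; apply: le_trans (geometric_tail k).
apply: (@le_trans _ _ (\int[mu]_(x in Omega) \sum_(0 <= j <oo) g (k + j)%N x)%E).
  apply: ge0_le_integral => //.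
    by apply: ge0_emeasurable_sum => [j x Ox _|j _]; [exact: g0|exact: mg].
  move=> x Ox; have s0 : (0 <= \sum_(0 <= j <oo) g (k + j)%N x)%E.
    by apply: nneseries_ge0 => j _ _; exact: g0.
  have [->//|[j [kj ->]]] := hG x Ox.
  rewrite (@nneseriesD1 _ _ (j - k)%N) // ?subnKC //; last by move=> i _; exact: g0.
  by rewrite leeDl // nneseries_ge0 // => i _ _; exact: g0.
rewrite integral_nneseries //; last by move=> j x Ox; exact: g0.
by apply: lee_nneseries => [i _ _|i _]; [apply: integral_ge0 => x Ox; exact: g0|exact: hI].
Qed.

Let cvg_geometric0 (x : nat -> \bar R) : (forall k, (0 <= x k)%E) ->
  (forall k, (x k <= (2 ^- k)%:E)%E) -> x k @[k --> \oo] --> 0%E.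
Proof.
move=> x0 xk; apply/cvg_ge0_ereal0P => // e e0.
have h : (2^-1 : R) ^+ k @[k --> \oo] --> (0 : R).
  by apply: cvg_expr; rewrite ger0_norm ?invr_ge0 // invf_lt1 ?ltr1n.
have /cvgrPdist_le /(_ _ e0) := h; apply: filterS => k.
rewrite sub0r normrN exprVn ger0_norm ?invr_ge0 ?exprn_ge0 // => hk.
by apply: le_trans (xk k) _; rewrite lee_fin.
Qed.

Lemma bump_sum_W1p0 : W1p0 Omega F p bump_sum.
Proof.
exists bump_gradient; first exact: weak_differential_bump_sum.
exists partial_bump_sum; first exact: test_partial_bump_sum.
have wd k : weak_differential Omega (bump_sum \- partial_bump_sum k)
    (bump_gradient \- gradient (partial_bump_sum k)).
  have -> : bump_sum \- partial_bump_sum k = (fun x => -1 * partial_bump_sum k x + bump_sum x).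
    by apply/funext => x /=; rewrite mulN1r addrC.
  have -> : bump_gradient \- gradient (partial_bump_sum k) =
      (fun x => -1 *: gradient (partial_bump_sum k) x + bump_gradient x).
    by apply/funext => x /=; rewrite scaleN1r addrC.
  apply: weak_differential_lin weak_differential_bump_sum => //.
  by apply: weak_differential_test => //; exact: test_partial_bump_sum.
have mabs (v : 'rV[R]_n -> R) : measurable_fun Omega v -> measurable_fun Omega (fun x => (`|v x| `^ p)%:E).
  move=> mv; apply/measurable_EFinP; apply: (measurableT_comp (measurable_powR p)).
  exact: measurableT_comp.
have mcom v dv : weak_differential Omega v dv -> measurable_fun Omega (fun x => cometric F x (dv x) `^ p)%E.
  move=> wv; apply: (measurableT_comp (measurable_poweR p)).
  exact: weak_differential_cometric_measurable wv.
have wphi j := weak_differential_test Omega_open (@test_phi j).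
apply/(sobolev_norm_cvg Omega F p_gt1); split; apply: cvg_geometric0.
- by move=> k; apply: integral_ge0 => x _; rewrite lee_fin powR_ge0.
- move=> k; apply: (@integral_tail (fun j x => (`|phi j x| `^ p)%:E)).
  + by move=> j; apply: mabs; have [[]] := wphi j.
  + by apply: mabs; have [[]] := wd k.
  + by move=> j x _; rewrite lee_fin powR_ge0.
  + by move=> x _; rewrite lee_fin powR_ge0.
  + move=> x Ox; have [[j [kj _ E _]]|[E _]] := bump_sum_tail k x.
      by right; exists j; split => //; rewrite /= E.
    by left; rewrite /= E subrr normr0 powR0 // gt_eqF.
  + by move=> j; have [_ []] := bump j.
- by move=> k; apply: integral_ge0 => x _; exact: poweR_ge0.
- move=> k; apply: (@integral_tail (fun j x => cometric F x (gradient (phi j) x) `^ p)%E).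
  + by move=> j; exact: mcom (wphi j).
  + exact: mcom (wd k).
  + by move=> j x _; exact: poweR_ge0.
  + by move=> x _; exact: poweR_ge0.
  + move=> x Ox; have [[j [kj _ _ E]]|[_ E]] := bump_sum_tail k x.
      by right; exists j; split => //; rewrite /= E.
    by left; rewrite /= E subrr (cometric0 finslerF) // poweR_EFin powR0 // gt_eqF.
  + by move=> j; have [_ []] := bump j.
Qed.

(** An approximant has compact support, so some bump [m] lies outside it. On [K m] the differential
    of the difference is then that of the candidate alone, with energy at least one whatever the
    weak differential, which is incompatible with convergence to zero. *)
Lemma opp_bump_sum_W1p0 : ~ W1p0 Omega F p (fun x => - bump_sum x).
Proof.
move=> [dv wv [v_ tv]].
move=> /(sobolev_norm_cvg Omega F p_gt1)[_].
have ge0 k : (0 <= \int[mu]_(x in Omega) cometric F x ((dv \- gradient (v_ k)) x) `^ p)%E.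
  by apply: integral_ge0 => x _; exact: poweR_ge0.
have h2 : 0 < 2^-1 :> R by rewrite invr_gt0.
move=> /(cvg_ge0_ereal0P ge0) /(_ _ h2) [k _ /(_ k (leqnn k)) hk].
have [C [cC CO sv v0]] := test_functionE (tv k).
have [m hm] := exhaustion_absorbs Omega_open cC CO.
have [[_ KC _ _] [_ _ lower]] := bump m.
have [_ ldv hdv] := wv.
have /lower : forall i, locally_integrable_row Omega (fun x => dv x ord0 i) by [].
have hyp psi i : test_function Omega psi -> (forall x, ~ K m x -> psi x = 0) ->
    \int[mu]_(x in Omega) (dv x ord0 i * psi x) = \int[mu]_(x in Omega) (phi m x * partial i psi x).
  move=> tpsi psi0; apply: oppr_inj; rewrite -(hdv psi i tpsi) -mulN1r -RintegralZl //.
    apply: eq_Rintegral => x _; rewrite mulN1r -mulNr.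
    have [Kx|nK] := pselect (K m x); first by rewrite /bump_sum (bump_indexE Kx).
    by rewrite /partial (derive_outside _ (compact_rV_closed (@compactK m)) psi0 nK) !mulr0.
  have tD : test_function Omega (partial i psi) by exact: test_function_derive.
  exact: (test_function_integrable (test_functionM (@smooth_phi m) tD)).
move=> /(_ hyp); apply/negP; rewrite -ltNge.
apply: (@le_lt_trans _ _ (2^-1 : R)%:E); last by rewrite lte_fin invf_lt1 ?ltr1n.
apply: le_trans hk.
have E : (\int[mu]_(x in K m) cometric F x (dv x) `^ p =
    \int[mu]_(x in K m) cometric F x ((dv \- gradient (v_ k)) x) `^ p)%E.
  apply: eq_integral => x /set_mem Kx; have [_ nx] := KC _ Kx.
  have nC : ~ C x by move=> /hm.
  have -> : (dv \- gradient (v_ k)) x = dv x; last by [].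
  rewrite /= (_ : gradient (v_ k) x = 0) ?subr0 //; apply/rowP => i; rewrite gradientE mxE.
  exact: (derive_outside (delta_mx ord0 i) (compact_rV_closed cC) v0 nC).
rewrite E; apply: ge0_subset_integral => //.
- exact: compact_rV_measurable.
- apply: (measurableT_comp (measurable_poweR p)).
  apply: (cometric_measurable Omega_open finslerF) => i.
  have -> : (fun x => (dv \- gradient (v_ k)) x ord0 i) =
      (fun x => dv x ord0 i - gradient (v_ k) x ord0 i).
    by apply/funext => x; rewrite /= !mxE.
  have [_ h _] := weak_differential_test Omega_open (tv k); have [h1 _] := h i.
  by apply: measurable_funB => //; case: (ldv i).
- by move=> x _; exact: poweR_ge0.
Qed.

End locally_finite_sum.

(** * Infinite reversibility and nonlinearity *)

Section reversibility_nonlinearity.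
Context {R : realType} {n : nat}.
Context (Omega : set 'rV[R]_n) (F : 'rV[R]_n -> 'rV[R]_n -> R) (p : R).
Context (Omega_open : open Omega) (finslerF : finsler_metric Omega F).
Context (n_gt0 : (0 < n)%N) (p_gt1 : 1 < p).

Lemma reversibility_infinite_nonlinear : reversibility Omega F = +oo%E -> nonlinear_W1p0 Omega F p.
Proof.
move=> rev; have irr L : exists z w, [/\ Omega z, w != 0 & L * F z w < F z (- w)].
  apply: contrapT => h; have : (reversibility Omega F != +oo)%E.
    apply/(reversibility_finP finslerF); exists L => z w Oz w0.
    by rewrite leNgt; apply/negP => hw; apply: h; exists z, w.
  by rewrite rev.
have [phi [K [hb disj]]] := expensive_sequence Omega_open finslerF n_gt0 p_gt1 irr.
move=> [/set_mem h0 hlin].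
apply: (opp_bump_sum_W1p0 Omega_open finslerF p_gt1 hb disj).
have hu := bump_sum_W1p0 Omega_open finslerF n_gt0 p_gt1 hb disj.
(* Closure under [a *: u + v] with [a = -1] and [v = 0] would put the opposite of the sum into the
   space. *)
have := hlin (-1) _ _ (mem_set hu) (mem_set h0) => /set_mem.
have -> : (-1 *: (bump_sum phi K : 'rV[R]_n -> R^o) + 0) = (fun x => - bump_sum phi K x) => //.
by rewrite addr0 scaleN1r.
Qed.

Lemma nonlinear_reversibility_infinite : nonlinear_W1p0 Omega F p -> reversibility Omega F = +oo%E.
Proof.
move=> nl; apply/eqP; apply: contrapT => /negP /(reversibility_finP finslerF)[L hL]; apply: nl.
exact: reversible_submod_closed hL.
Qed.

End reversibility_nonlinearity.

Theorem theorem1p6 (R : realType) (n : nat) (n_ge2 : (2 <= n)%N)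
    (Omega : set 'rV[R]_n) (F : 'rV[R]_n -> 'rV[R]_n -> R)
    (Omega_open : open Omega) (Omega_connected : connected Omega)
    (Omega_strictly_convex : strictly_convex Omega) (Omega_0 : Omega 0)
    (F_finsler : finsler_metric Omega F)
    (F_forward_complete : forward_complete Omega F)
    (F_projectively_flat : projectively_flat Omega F)
    (F_constant_curvature : constant_flag_curvature Omega F) :
  [<-> reversibility Omega F = +oo%E;
       ~ backward_complete Omega F;
       exists p : R, 1 < p /\ nonlinear_W1p0 Omega F p;
       forall p : R, 1 < p -> nonlinear_W1p0 Omega F p].
Proof.
have n_gt0 : (0 < n)%N by exact: ltnW.
have bc := reversibility_backward_complete Omega_open Omega_strictly_convex Omega_0 F_finsler
  F_forward_complete F_projectively_flat F_constant_curvature.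
tfae.
- by move=> rev /bc; rewrite rev.
- move=> nbc; exists 2; have p2 : 1 < 2 :> R by rewrite ltr1n.
  split=> //; apply: reversibility_infinite_nonlinear => //.
  by apply/eqP; apply: contrapT => /negP /bc.
- move=> [q [q1 nl]] p p1; apply: reversibility_infinite_nonlinear => //.
  exact: nonlinear_reversibility_infinite nl.
- move=> /(_ 2); rewrite ltr1n => /(_ isT).
  by apply: nonlinear_reversibility_infinite => //; rewrite ltr1n.
Qed.
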